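(* Let $G\subset\mathbb{C}$ be an open set, let $f$ be a function meromorphic on an open set $G'\supset \mathrm{cl}(G)$, let $\epsilon\in(0,\infty)$, and let $\Lambda$ be a bounded connected component of the level set $E_{f,\epsilon}=\{z\in G' : |f(z)|=\epsilon\}$ with $\Lambda\subset G$. If $z$ is a vertex of $\Lambda$, then the number of edges of $\Lambda$ which are incident to $z$ (an edge with both endpoints at $z$ being counted twice) is exactly $2(\mathrm{mult}(z)+1)$.
   Context: The set $\Lambda$ is regarded as a planar graph (a finite graph embedded in the plane without edge crossings, loops and multiple edges allowed, a simple closed path also being counted as a planar graph): its vertices are the critical points of $f$ (zeros of $f'$) in $\Lambda$, and its edges are the paths in $\Lambda$ joining critical points, with no critical points in their interiors. If $z\in G$ is a zero of $f'$, $\mathrm{mult}(z)$ denotes the multiplicity of $z$ as a zero of $f'$. *)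

(* Defs.v *)
From HB Require Import structures.
From mathcomp Require Import all_boot all_order all_algebra.
From mathcomp Require Import complex.
From mathcomp Require Import all_classical all_reals all_analysis.

Set Implicit Arguments.
Unset Strict Implicit.
Unset Printing Implicit Defensive.

Import Order.TTheory GRing.Theory Num.Theory.
Import numFieldNormedType.Exports.

Local Open Scope classical_set_scope.
Local Open Scope ring_scope.
Local Open Scope complex_scope.

(* The complex numbers seen as an abstract [numFieldType], which is the form on
   which the library defines topology, norm and derivatives: with scalar field
   [C R], [derivable f z 1] is complex differentiability and [derive1 f] is the
   complex derivative. *)
Definition C (R : realType) : numFieldType := R[i].

Section LevelCurves.
Context {R : realType}.
Implicit Types (f h : C R -> C R) (U L e : set (C R)) (z v w : C R).

Definition pole f z : Prop := `|f w| @[w --> z^'] --> +oo.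

(* A meromorphic function is a total function whose value at a pole is
   irrelevant: poles are excluded from level sets, as |f| = +oo there.
   Poles are isolated by the first clause. *)
Definition meromorphic_on U f : Prop :=
  forall z, U z ->
    (\forall w \near z^', derivable f w 1) /\ (derivable f z 1 \/ pole f z).

Definition level_set U f (eps : R) : set (C R) :=
  [set z | [/\ U z, ~ pole f z & `|f z| = eps%:C]].

Definition zero_of_order (m : nat) h z : Prop :=
  exists g : C R -> C R,
    [/\ \forall w \near z, derivable g w 1, g z != 0 &
        \forall w \near z, h w = (w - z) ^+ m * g w].

(* The order is unique when it exists; the default value 0 is only reached
   when [derive1 f] has no order at [z]. *)
Definition mult f z : nat :=
  xget 0%N [set m | zero_of_order m (derive1 f) z].

Definition vertices f L : set (C R) := [set z | L z /\ derive1 f z = 0].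

(* [e] is an edge of [L] with endpoints [v] and [w].  An edge is identified
   with its underlying point set, so that reparametrizing or reversing a path
   does not give a new edge; for [v = w] the edge is a simple closed path. *)
Definition edge f L v w e : Prop :=
  exists gamma : R -> C R,
    [/\ {within `[0, 1], continuous gamma},
        {in `]0, 1[ &, injective gamma} &
        e = gamma @` `[0, 1]] /\
    [/\ e `<=` L,
        vertices f L v /\ vertices f L w,
        gamma 0 = v /\ gamma 1 = w &
        forall t, t \in `]0, 1[ -> ~ vertices f L (gamma t)].

Definition link_edges f L z : set (set (C R)) :=
  [set e | exists2 w, w != z & edge f L z w e].

Definition loop_edges f L z : set (set (C R)) := [set e | edge f L z z e].

Definition has_degree f L z (n : nat) : Prop :=
  exists a b : nat,
    [/\ (link_edges f L z #= `I_a)%card, (loop_edges f L z #= `I_b)%card &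
        n = (a + 2 * b)%N].

End LevelCurves.

(* Main.v *)
(* Near a point p of L of multiplicity m as a zero of f', write
   f - f(p) = (w - p)^n g with n = m + 1 and g(p) != 0 (Cauchy's formula along
   circles gives the power series facts this needs).  The Cayley transform
   q = (f - f(p)) / (f + f(p)) maps |f| = eps to the imaginary axis, and solving
   q = +-i s^n for s >= 0 with a contraction shows that L is, near p, a union of
   2n arcs leaving p: arg f increases away from p on n of them and decreases on
   the other n.  For n = 1 this gives a chart in which arg f is a parameter.

   Hence a curve of L through a regular point is parametrized by the angle t,
   with f = c0 cis t, and has a maximal extension.  If it accumulates at a
   vertex it cannot be periodic, so it is injective; the angle stays bounded
   because f takes each value finitely often on the compact set L; and at both
   ends the curve converges to a vertex.  These maximal curves are exactly the
   open edges, since a curve of regular points cannot leave a set that is open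
   and closed in the regular part of L.

   So every edge is oriented by arg f.  Each of the n outgoing arcs at z is the
   beginning of exactly one edge and each of the n incoming arcs is the end of
   exactly one edge; the loops are the edges in both families, the links those
   in exactly one.  Therefore #links + 2 #loops = 2n. *)
Require Import Defs.
From HB Require Import structures.
From mathcomp Require Import all_boot all_order all_algebra.
From mathcomp Require Import complex.
From mathcomp Require Import all_classical all_reals all_analysis.
From mathcomp Require Import separable cyclotomic.
From mathcomp Require Import ring lra zify.
Set Implicit Arguments.
Unset Strict Implicit.
Unset Printing Implicit Defensive.
Import Order.TTheory GRing.Theory Num.Theory.
Import numFieldNormedType.Exports.
Local Open Scope classical_set_scope.
Local Open Scope ring_scope.
Local Open Scope complex_scope.

(** * Complex modulus and complex derivatives *)

Section Modulus.
Context {R : realType}.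
Implicit Types (x y z w : C R) (r : R).

(** The Cayley transform stands in for a logarithm of [f / f p]: it is rational, needs no choice of
    branch, and equals [i * tan (t / 2)] when [f] has turned by the angle [t]. Writing [w = p + s v]
    turns [q = +-i s^n] into [v^n g1 (p + s v) = +-i], a perturbation of a polynomial equation with
    [n] simple roots, so the arcs come from one contraction per root and stay distinct. The
    contraction needs a local Lipschitz bound on the quotient by a power of [w - p], although only
    complex differentiability of [f] is given; this is what the Cauchy integral supplies, together
    with the holomorphy of [f']. The global obstacle is that an edge is the image of an arbitrary
    injective path, unrelated to the angle of [f]. Such paths are never reparametrized: they are
    compared with maximal curves through their images only. The hypotheses on [G], [G'] and
    boundedness serve to make [L] compact. *)

Definition nm (x : C R) : R := ComplexField.Normc.normc x.
Definition rc (r : R) : C R := r%:C.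
Definition reC (x : C R) : R := complex.Re x.
Definition imC (x : C R) : R := complex.Im x.
Definition iC : C R := Complex 0 1.

Lemma normE x : `|x| = rc (nm x). Proof. by []. Qed.

Lemma nm_def x : nm x = Num.sqrt (reC x ^+ 2 + imC x ^+ 2).
Proof. by case: x. Qed.

Lemma nm_ge0 x : 0 <= nm x. Proof. by rewrite nm_def sqrtr_ge0. Qed.
Lemma nmM x y : nm (x * y) = nm x * nm y. Proof. exact: ComplexField.Normc.normcM. Qed.
Lemma nmD x y : nm (x + y) <= nm x + nm y. Proof. exact: le_normcD. Qed.
Lemma nmN x : nm (- x) = nm x. Proof. exact: normcN. Qed.
Lemma nm0 : nm 0 = 0. Proof. exact: ComplexField.Normc.normc0. Qed.
Lemma nm1 : nm 1 = 1. Proof. exact: ComplexField.Normc.normc1. Qed.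
Lemma nmV x : nm x^-1 = (nm x)^-1. Proof. exact: ComplexField.Normc.normcV. Qed.

Lemma nm_eq0 x : (nm x == 0) = (x == 0).
Proof.
by apply/eqP/eqP => [/ComplexField.Normc.eq0_normc // | ->]; rewrite nm0.
Qed.

Lemma nm_gt0 x : (0 < nm x) = (x != 0).
Proof. by rewrite lt_neqAle nm_ge0 eq_sym nm_eq0 andbT. Qed.

Lemma nmB x y : nm (x - y) = nm (y - x). Proof. by rewrite -nmN opprB. Qed.

Lemma nmX x n : nm (x ^+ n) = nm x ^+ n.
Proof. by elim: n => [|n IH]; rewrite ?expr0 ?nm1// !exprS nmM IH. Qed.

Lemma nmf x y : nm (x / y) = nm x / nm y. Proof. by rewrite nmM nmV. Qed.

Lemma rcD r s : rc (r + s) = rc r + rc s. Proof. exact: rmorphD. Qed.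
Lemma rcN r : rc (- r) = - rc r. Proof. exact: rmorphN. Qed.
Lemma rcB r s : rc (r - s) = rc r - rc s. Proof. exact: rmorphB. Qed.
Lemma rcM r s : rc (r * s) = rc r * rc s. Proof. exact: rmorphM. Qed.
Lemma rcX r n : rc (r ^+ n) = rc r ^+ n. Proof. exact: rmorphXn. Qed.
Lemma rc0 : rc 0 = 0. Proof. by []. Qed.
Lemma rc1 : rc 1 = 1. Proof. by []. Qed.
Lemma rcV r : rc r^-1 = (rc r)^-1. Proof. exact: fmorphV. Qed.
Lemma rc_inj : injective rc. Proof. by move=> r s []. Qed.
Lemma rc_eq0 r : (rc r == 0) = (r == 0). Proof. exact: fmorph_eq0. Qed.

Lemma nm_rc r : nm (rc r) = `|r|.
Proof. by rewrite nm_def /= expr0n addr0 sqrtr_sqr. Qed.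

Lemma nm_iC : nm iC = 1.
Proof. by rewrite nm_def /= expr0n add0r expr1n sqrtr1. Qed.

Lemma iC2 : iC * iC = -1.
Proof. by rewrite /iC -[RHS](@sqr_i R) expr2. Qed.

Lemma CE x : x = rc (reC x) + iC * rc (imC x).
Proof. exact: complexE. Qed.

Lemma C_inj x y : reC x = reC y -> imC x = imC y -> x = y.
Proof. by case: x y => [a b] [c d] /= -> ->. Qed.

Lemma reD x y : reC (x + y) = reC x + reC y. Proof. by case: x y => [a b] [c d]. Qed.
Lemma imD x y : imC (x + y) = imC x + imC y. Proof. by case: x y => [a b] [c d]. Qed.
Lemma reN x : reC (- x) = - reC x. Proof. by case: x. Qed.
Lemma imN x : imC (- x) = - imC x. Proof. by case: x. Qed.
Lemma reB x y : reC (x - y) = reC x - reC y. Proof. by rewrite reD reN. Qed.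
Lemma imB x y : imC (x - y) = imC x - imC y. Proof. by rewrite imD imN. Qed.
Lemma reM x y : reC (x * y) = reC x * reC y - imC x * imC y.
Proof. by case: x y => [a b] [c d]. Qed.
Lemma imM x y : imC (x * y) = reC x * imC y + imC x * reC y.
Proof. by case: x y => [a b] [c d]. Qed.
Lemma im_rc r : imC (rc r) = 0. Proof. by []. Qed.
Lemma re_le_nm x : `|reC x| <= nm x.
Proof.
by rewrite nm_def -[leLHS]sqrtr_sqr ler_sqrt ?lerDl ?addr_ge0 ?sqr_ge0.
Qed.

Lemma im_le_nm x : `|imC x| <= nm x.
Proof.
by rewrite nm_def -[leLHS]sqrtr_sqr ler_sqrt ?lerDr ?addr_ge0 ?sqr_ge0.
Qed.

Lemma nm_le_reim x : nm x <= `|reC x| + `|imC x|.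
Proof.
by rewrite [in leLHS](CE x) (le_trans (nmD _ _))// nmM nm_iC mul1r !nm_rc.
Qed.

Lemma nm_dist x y : `|nm x - nm y| <= nm (x - y).
Proof.
have h u v : nm u - nm v <= nm (u - v).
  by rewrite lerBlDr (le_trans _ (nmD _ _))// subrK.
by rewrite ler_norml h andbT lerNl opprB nmB h.
Qed.

Lemma nm_triB x y z : nm (x - z) <= nm (x - y) + nm (y - z).
Proof. by rewrite (le_trans _ (nmD _ _))// addrA subrK. Qed.

Lemma nm_sqr x : nm x ^+ 2 = reC x ^+ 2 + imC x ^+ 2.
Proof. by rewrite nm_def sqr_sqrtr// addr_ge0// sqr_ge0. Qed.

Lemma ltr_rc r x : (`|x| < rc r) = (nm x < r).
Proof. by rewrite normE ltcR. Qed.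

(** Balls of [C R] have complex radii, but positivity in the complex order forces a radius to be
    real; real radii therefore suffice, and the estimates below take place in [R]. *)
Lemma cnbhsP z (A : set (C R)) :
  nbhs z A <-> exists2 r : R, 0 < r & forall w, nm (w - z) < r -> A w.
Proof.
split.
  move=> /nbhs_ballP[e /= e0 h].
  have er : rc (reC e) = e.
    by move: e0; rewrite (@ltcE R) => /andP[/eqP ie _]; apply: C_inj; rewrite //= im_rc /imC ie.
  exists (reC e); first by rewrite -(@ltcR R) -/(rc (reC e)) er.
  move=> w wz; apply: h; rewrite -ball_normE /ball_ /=.
  by rewrite distrC -er ltr_rc.
move=> [r r0 h]; apply/nbhs_ballP; exists (rc r) => /=; first by rewrite ltcR.
by move=> w; rewrite -ball_normE /ball_ /= distrC ltr_rc => /h.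
Qed.

Lemma near_nm z e : 0 < e -> \forall w \near z, nm (w - z) < e.
Proof. by move=> e0; apply/cnbhsP; exists e. Qed.

Lemma ccvgP {T} (F : set_system T) {FF : Filter F} (f : T -> C R) (l : C R) :
  f @ F --> l <-> forall e : R, 0 < e -> \forall x \near F, nm (f x - l) < e.
Proof.
split.
  by move=> h e e0; apply: (h [set y | nm (y - l) < e]); exact: near_nm.
move=> h A /cnbhsP[r r0 hr]; apply: filterS (h _ r0) => x; exact: hr.
Qed.

Lemma cvg_nm {T} (F : set_system T) {FF : Filter F} (f : T -> C R) (l : C R) :
  f @ F --> l -> nm (f x) @[x --> F] --> nm l.
Proof.
move=> /ccvgP h; apply/cvgrPdist_lt => e e0; near=> x.
rewrite distrC (le_lt_trans (nm_dist _ _))//; near: x; exact: h.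
Unshelve. all: by end_near. Qed.

Lemma cvg_reC {T} (F : set_system T) {FF : Filter F} (f : T -> C R) (l : C R) :
  f @ F --> l -> reC (f x) @[x --> F] --> reC l.
Proof.
move=> /ccvgP h; apply/cvgrPdist_lt => e e0; near=> x.
rewrite distrC -reB (le_lt_trans (re_le_nm _))//; near: x; exact: h.
Unshelve. all: by end_near. Qed.

Lemma cvg_imC {T} (F : set_system T) {FF : Filter F} (f : T -> C R) (l : C R) :
  f @ F --> l -> imC (f x) @[x --> F] --> imC l.
Proof.
move=> /ccvgP h; apply/cvgrPdist_lt => e e0; near=> x.
rewrite distrC -imB (le_lt_trans (im_le_nm _))//; near: x; exact: h.
Unshelve. all: by end_near. Qed.

Lemma cvg_rc {T} (F : set_system T) {FF : Filter F} (f : T -> R) (l : R) :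
  f @ F --> l -> rc (f x) @[x --> F] --> rc l.
Proof.
move=> /cvgrPdist_lt h; apply/ccvgP => e e0; near=> x.
rewrite -rcB nm_rc distrC; near: x; exact: h.
Unshelve. all: by end_near. Qed.

Lemma continuous_nm : continuous nm.
Proof. by move=> x; apply: (@cvg_nm _ (nbhs x) _ id x); exact: cvg_id. Qed.
(** Heine-Borel: the set lies in the image of a compact real square under [(x, y) |-> x + i y]. *)
Lemma bounded_closed_compactC (A : set (C R)) :
  bounded_set A -> closed A -> compact A.
Proof.
move=> /pinfty_ex_gt0 [M _ hM] cA.
pose K := [set rc p.1 + iC * rc p.2 | p in `[- reC M, reC M] `*` `[- reC M, reC M]].
have cK : compact K.
  apply: continuous_compact; last first.
    by apply: compact_setX; exact: segment_compact.
  apply: continuous_subspaceT => p; apply: cvgD.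
    by apply: cvg_rc; exact: cvg_fst.
  by apply: cvgM; [exact: cvg_cst|apply: cvg_rc; exact: cvg_snd].
apply: subclosed_compact cA cK _ => x Ax.
have nx : nm x <= reC M.
  have /= := hM _ Ax; rewrite (@lecE R) => /andP[_]; exact: id.
exists (reC x, imC x); last by rewrite [RHS]CE.
split => /=; rewrite in_itv /= -ler_norml (le_trans _ nx)//.
- exact: re_le_nm.
- exact: im_le_nm.
Qed.

(** Division-free form of [f'(z) = d]: the point [w = z] is not excluded, and the epsilons are
    real. *)
Definition isd (f : C R -> C R) z d := forall e : R, 0 < e ->
  exists2 r : R, 0 < r & forall w, nm (w - z) < r ->
    nm (f w - f z - d * (w - z)) <= e * nm (w - z).

Lemma isd_is_derive f z d : isd f z d -> is_derive z 1 f d.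
Proof.
move=> h.
suff hc : h^-1 *: (f (h *: 1 + z) - f z) @[h --> 0^'] --> d.
  by apply: DeriveDef; [apply/cvg_ex; exists d|exact: cvg_lim hc].
apply/ccvgP => e e0; have [|r r0 hr] := h (e / 2); first by rewrite divr_gt0.
apply/cnbhsP; exists r => // k; rewrite subr0 => kr k0.
have := hr (k + z); rewrite addrK => /(_ kr).
have -> : k *: (1 : C R) = k by rewrite /GRing.scale /= mulr1.
move=> {}hr.
have -> : k^-1 *: (f (k + z) - f z) - d = (f (k + z) - f z - d * k) / k.
  rewrite /GRing.scale /= -[in LHS](mulfK k0 d); ring.
rewrite nmf ltr_pdivrMr ?nm_gt0// (le_lt_trans hr)// ltr_pM2r ?nm_gt0//.
by rewrite ltr_pdivrMr// ltr_pMr// ltr1n.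
Qed.

Lemma isd_derivable f z d : isd f z d -> derivable f z 1.
Proof. by move=> /isd_is_derive[]. Qed.

Lemma isd_derive1 f z d : isd f z d -> derive1 f z = d.
Proof. by move=> /isd_is_derive[_ <-]; rewrite derive1E. Qed.

Lemma derivable_isd f z : derivable f z 1 -> isd f z (derive1 f z).
Proof.
move=> /[dup] df /cvg_ex [d hd]; have <- : d = derive1 f z.
  by rewrite derive1E; apply/esym/cvg_lim.
move: hd => /ccvgP h e e0.
have /cnbhsP [r r0 hr] := h _ e0; exists r => // w wz.
have [->|wz0] := eqVneq w z; first by rewrite !subrr mulr0 subrr nm0 mulr0.
have k0 : w - z != 0 by rewrite subr_eq0.
have := hr (w - z); rewrite subr0 => /(_ wz k0).
rewrite /= /GRing.scale /= mulr1 subrK => {}hr.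
have -> : f w - f z - d * (w - z) = ((w - z)^-1 * (f w - f z) - d) * (w - z).
  by rewrite mulrBl [_ * (f w - _)]mulrC -mulrA mulVf// mulr1.
by rewrite nmM ler_wpM2r ?nm_ge0// ltW.
Qed.

Lemma derivable_cont (f : C R -> C R) z : derivable f z 1 -> {for z, continuous f}.
Proof. by move=> h; apply: differentiable_continuous; exact/derivable1_diffP. Qed.

Lemma isd_near f g z d : (\forall w \near z, f w = g w) -> isd f z d -> isd g z d.
Proof.
move=> /cnbhsP [r r0 hr] h e e0; have [s s0 hs] := h _ e0.
have fz : f z = g z by apply: hr; rewrite subrr nm0.
exists (Num.min r s); first by rewrite lt_min r0 s0.
by move=> w; rewrite lt_min => /andP[wr ws]; rewrite -hr// -fz; exact: hs.
Qed.

Lemma derivable_near (f g : C R -> C R) z :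
  (\forall w \near z, f w = g w) -> derivable f z 1 -> derivable g z 1.
Proof. by move=> h /derivable_isd /(isd_near h) /isd_derivable. Qed.

Lemma derive1_near (f g : C R -> C R) z :
  (\forall w \near z, f w = g w) -> derivable f z 1 -> derive1 f z = derive1 g z.
Proof. by move=> h /derivable_isd hf; rewrite (isd_derive1 (isd_near h hf)). Qed.

End Modulus.

(** * Integrals of complex functions on a real interval *)

Section ComplexIntegral.
Context {R : realType}.
Implicit Types (a b c t : R) (f g : R -> R) (h k : R -> C R).

Definition cont_on a b (f : R -> R) :=
  forall t, a <= t <= b -> {for t, continuous f}.

Definition rint f a b : R := Rintegral lebesgue_measure `[a, b]%classic f.

Lemma cont_on_integrable a b f : cont_on a b f ->
  lebesgue_measure.-integrable `[a, b]%classic (EFin \o f).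
Proof.
move=> cf; apply: continuous_compact_integrable; first exact: segment_compact.
apply: continuous_in_subspaceT => t; rewrite inE /= in_itv /=; exact: cf.
Qed.

Lemma rintD a b f g : cont_on a b f -> cont_on a b g ->
  rint (fun t => f t + g t) a b = rint f a b + rint g a b.
Proof. by move=> cf cg; apply: RintegralD => //; exact: cont_on_integrable. Qed.

Lemma rintZ a b f r : cont_on a b f ->
  rint (fun t => r * f t) a b = r * rint f a b.
Proof. by move=> cf; apply: RintegralZl => //; exact: cont_on_integrable. Qed.

Lemma rint_split a b c f : a <= b -> b <= c -> cont_on a c f ->
  rint f a c = rint f a b + rint f b c.
Proof.
move=> ab bc cf; have If := cont_on_integrable cf.
have := Rintegral_itvB If; move=> /(_ b); rewrite !bnd_simp => /(_ ab bc) h.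
rewrite /rint [in RHS]addrC; apply/eqP; rewrite -subr_eq h; apply/eqP.
apply: Rintegral_itv_obnd_cbnd; apply: integrableS If => //.
by move=> x /=; rewrite !in_itv /= => /andP[bx ->]; rewrite (le_trans ab (ltW bx)).
Qed.

Lemma rint_FTC a b F f : a <= b -> cont_on a b f ->
  (forall t, a <= t <= b -> is_derive t 1 F (f t)) ->
  rint f a b = F b - F a.
Proof.
rewrite le_eqVlt => /predU1P[<- _ _|ab cf dF].
  by rewrite /rint set_itv1 Rintegral_set1 subrr.
rewrite /rint /Rintegral (@continuous_FTC2 _ f F)//.
- by apply: continuous_in_subspaceT => t; rewrite inE /= in_itv /=; exact: cf.
- have cF t : a <= t <= b -> {for t, continuous F}.
    move=> tab; apply: differentiable_continuous; apply/derivable1_diffP.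
    by have [] := dF _ tab.
  split.
  + by move=> t; rewrite in_itv /= => /andP[/ltW at_ /ltW tb]; have [] := dF _ (introT andP (conj at_ tb)).
  + by apply: cvg_at_right_filter; apply: cF; rewrite lexx ltW.
  + by apply: cvg_at_left_filter; apply: cF; rewrite lexx ltW.
- move=> t; rewrite in_itv /= => /andP[/ltW at_ /ltW tb].
  by rewrite derive1E; have [_] := dF _ (introT andP (conj at_ tb)).
Qed.

Lemma rint_bound a b f (M : R) : a <= b -> cont_on a b f ->
  (forall t, a <= t <= b -> `|f t| <= M) -> `|rint f a b| <= M * (b - a).
Proof.
move=> ab cf hM; have If := cont_on_integrable cf.
rewrite (le_trans (le_normr_Rintegral _ If))//.
have cM : cont_on a b (fun=> M) by move=> t _; exact: cvg_cst.
have cn : cont_on a b (fun t => `|f t|).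
  by move=> t tab; apply: cvg_norm; exact: cf.
apply: (@le_trans _ _ (rint (fun=> M) a b)).
  apply: le_Rintegral.
  - by [].
  - exact: (cont_on_integrable cn).
  - exact: (cont_on_integrable cM).
  - by move=> x /=; rewrite in_itv /=; exact: hM.
have dM t : a <= t <= b -> is_derive t 1 (M \*: id) M.
  by move=> _; apply: is_derive_eq; rewrite /GRing.scale /= mulr1.
by rewrite (rint_FTC ab cM dM) /= /GRing.scale /= mulrBr.
Qed.

Variant contC a b h : Prop :=
  ContC of (forall t, a <= t <= b -> h x @[x --> t] --> h t).

Definition cint h a b : C R := Complex (rint (reC \o h) a b) (rint (imC \o h) a b).

Lemma contC_re a b h : contC a b h -> cont_on a b (reC \o h).
Proof. by move=> [ch] t tab; apply: cvg_reC; exact: ch. Qed.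
Lemma contC_im a b h : contC a b h -> cont_on a b (imC \o h).
Proof. by move=> [ch] t tab; apply: cvg_imC; exact: ch. Qed.

Lemma contCD a b h k : contC a b h -> contC a b k -> contC a b (fun t => h t + k t).
Proof. by move=> [ch] [ck]; split=> t tab; apply: cvgD; [exact: ch|exact: ck]. Qed.

Lemma contCM a b h k : contC a b h -> contC a b k -> contC a b (fun t => h t * k t).
Proof. by move=> [ch] [ck]; split=> t tab; apply: cvgM; [exact: ch|exact: ck]. Qed.

Lemma contC_cst a b z : contC a b (fun=> z).
Proof. by split=> t _; exact: cvg_cst. Qed.

Lemma contCZ a b h z : contC a b h -> contC a b (fun t => z * h t).
Proof. by move=> ch; apply: contCM ch; exact: contC_cst. Qed.

Lemma contCN a b h : contC a b h -> contC a b (fun t => - h t).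
Proof. by move=> [ch]; split=> t tab; apply: cvgN; exact: ch. Qed.

Lemma contCB a b h k : contC a b h -> contC a b k -> contC a b (fun t => h t - k t).
Proof. by move=> ch ck; apply: contCD ch _; exact: contCN. Qed.

Lemma contCV a b h : (forall t, a <= t <= b -> h t != 0) -> contC a b h ->
  contC a b (fun t => (h t)^-1).
Proof. by move=> h0 [ch]; split=> t tab; apply: cvgV; [exact: h0|exact: ch]. Qed.

Lemma contCX a b h n : contC a b h -> contC a b (fun t => h t ^+ n).
Proof.
move=> ch; elim: n => [|n IH]; first exact: contC_cst.
rewrite (_ : (fun _ => _) = (fun t => h t * h t ^+ n)); first exact: contCM.
by apply/funext => t; rewrite exprS.
Qed.

Lemma contC_rc a b f : cont_on a b f -> contC a b (fun t => rc (f t)).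
Proof. by move=> cf; split=> t tab; apply: cvg_rc; exact: cf. Qed.

Lemma contC_comp a b h (F : C R -> C R) : contC a b h ->
  (forall t, a <= t <= b -> {for h t, continuous F}) -> contC a b (fun t => F (h t)).
Proof.
by move=> [ch] cF; split=> t tab; exact: continuous_cvg (cF _ tab) (ch _ tab).
Qed.

Lemma cint_ext a b h k : (forall t, a <= t <= b -> h t = k t) ->
  cint h a b = cint k a b.
Proof.
move=> hk; congr Complex; apply: eq_Rintegral => t; rewrite inE /= in_itv /=;
  by move=> /hk /= ->.
Qed.

Lemma cintD a b h k : contC a b h -> contC a b k ->
  cint (fun t => h t + k t) a b = cint h a b + cint k a b.
Proof.
move=> ch ck; apply: C_inj; rewrite ?reD ?imD /=.
- rewrite -rintD; [|exact: contC_re..].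
  by congr rint; apply/funext => t; rewrite /= reD.
- rewrite -rintD; [|exact: contC_im..].
  by congr rint; apply/funext => t; rewrite /= imD.
Qed.

Lemma cintZ a b h z : contC a b h ->
  cint (fun t => z * h t) a b = z * cint h a b.
Proof.
move=> ch; have cr := contC_re ch; have ci := contC_im ch.
have cZ (f : R -> R) r : cont_on a b f -> cont_on a b (fun t => r * f t).
  by move=> cf t tab; apply: cvgM; [exact: cvg_cst|exact: cf].
apply: C_inj; rewrite ?reM ?imM /=.
- rewrite -[_ - _]/(_ + - _) -mulNr -!rintZ// -rintD; [|exact: cZ..].
  by congr rint; apply/funext => t; rewrite /= reM mulNr.
- rewrite -!rintZ// -rintD; [|exact: cZ..].
  by congr rint; apply/funext => t; rewrite /= imM.
Qed.

Lemma cintB a b h k : contC a b h -> contC a b k ->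
  cint (fun t => h t - k t) a b = cint h a b - cint k a b.
Proof.
move=> ch ck; rewrite -mulN1r -(cintZ _ ck) -(cintD ch); last exact: contCZ.
by apply: cint_ext => t _; rewrite mulN1r.
Qed.

Lemma cint_split a b c h : a <= b -> b <= c -> contC a c h ->
  cint h a c = cint h a b + cint h b c.
Proof.
move=> ab bc ch; apply: C_inj; rewrite ?reD ?imD /=.
- by apply: rint_split => //; exact: contC_re.
- by apply: rint_split => //; exact: contC_im.
Qed.

(** Real and imaginary parts are bounded separately, whence the factor 2; only the order of
    magnitude matters later. *)
Lemma cint_bound a b h M : a <= b -> contC a b h ->
  (forall t, a <= t <= b -> nm (h t) <= M) -> nm (cint h a b) <= 2 * M * (b - a).
Proof.
move=> ab ch hM; rewrite (le_trans (nm_le_reim _))//.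
rewrite mulrC mulr_natl mulrnAr mulr2n mulrC; apply: lerD.
- apply: rint_bound => //; first exact: contC_re.
  by move=> t tab; rewrite (le_trans (re_le_nm _)) ?hM.
- apply: rint_bound => //; first exact: contC_im.
  by move=> t tab; rewrite (le_trans (im_le_nm _)) ?hM.
Qed.

Lemma cint_FTC a b (P : R -> C R) h : a <= b -> contC a b h ->
  (forall t, a <= t <= b -> is_derive t 1 (reC \o P) (reC (h t)) /\
                            is_derive t 1 (imC \o P) (imC (h t))) ->
  cint h a b = P b - P a.
Proof.
move=> ab ch dP; apply: C_inj; rewrite ?reB ?imB /=.
- apply: (@rint_FTC _ _ (reC \o P)) => //; [exact: contC_re|by move=> t /dP[]].
- apply: (@rint_FTC _ _ (imC \o P)) => //; [exact: contC_im|by move=> t /dP[]].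
Qed.

Lemma cint_cst a b z : a <= b -> cint (fun=> z) a b = z * rc (b - a).
Proof.
move=> ab; rewrite (@cint_FTC _ _ (fun t => z * rc t))//.
- by rewrite rcB; ring.
- exact: contC_cst.
move=> t _; split.
- rewrite [X in is_derive _ _ X _](_ : _ = reC z \*: id).
    by apply: is_derive_eq; rewrite /GRing.scale /= mulr1.
  by apply/funext => s; rewrite /= reM im_rc mulr0 subr0.
- rewrite [X in is_derive _ _ X _](_ : _ = imC z \*: id).
    by apply: is_derive_eq; rewrite /GRing.scale /= mulr1.
  by apply/funext => s; rewrite /= imM im_rc mulr0 add0r.
Qed.

End ComplexIntegral.

(** * Cauchy's formula on circles *)

Section Bisection.
Context {R : realType}.
Variables (a b c d : R) (N : R -> R -> R -> R -> R).
Hypotheses (ab : a <= b) (cd : c <= d).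
Hypothesis Nadd : forall l1 l l2 t1 t t2, a <= l1 -> l1 <= l -> l <= l2 -> l2 <= b ->
  c <= t1 -> t1 <= t -> t <= t2 -> t2 <= d ->
  N l1 l2 t1 t2 <= N l1 l t1 t + N l l2 t1 t + N l1 l t t2 + N l l2 t t2.
Hypothesis Nloc : forall x y, a <= x <= b -> c <= y <= d -> forall e, 0 < e ->
  exists2 r, 0 < r & forall l1 l2 t1 t2, a <= l1 -> l1 <= x <= l2 -> l2 <= b ->
    c <= t1 -> t1 <= y <= t2 -> t2 <= d -> l2 - l1 < r -> t2 - t1 < r ->
    N l1 l2 t1 t2 <= e * ((l2 - l1) + (t2 - t1)) ^+ 2.

(** The point is the supremum of the left ends, which every right end bounds. *)
Lemma nested_limit (l A : nat -> R) : (forall n, l n <= l n.+1) ->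
  (forall n, l n.+1 + A n.+1 <= l n + A n) -> (forall n, 0 <= A n) ->
  exists x, forall n, l n <= x <= l n + A n.
Proof.
move=> l1 l2 A0.
have ml n m : l n <= l (n + m)%N.
  by elim: m => [|m IH]; rewrite ?addn0// addnS (le_trans IH).
have mu n m : l (n + m)%N + A (n + m)%N <= l n + A n.
  by elim: m => [|m IH]; rewrite ?addn0// addnS (le_trans (l2 _)).
have lu n m : l n <= l m + A m.
  have [nm|/ltnW mn] := leqP n m.
    by rewrite -(subnKC nm) (le_trans (ml n (m - n)%N))// lerDl.
  by rewrite -(subnKC mn) (le_trans _ (mu m (n - m)%N))// lerDl.
have hs : has_sup (range l).
  split; first by exists (l 0%N), 0%N.
  by exists (l 0%N + A 0%N) => _ [n _ <-].
exists (sup (range l)) => n; apply/andP; split.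
  by apply: (ub_le_sup hs.2); exists n.
by apply: (ge_sup hs.1) => _ [m _ <-].
Qed.

Let A n := (b - a) / 2 ^+ n.
Let B n := (d - c) / 2 ^+ n.
Let V n (p : R * R) := N p.1 (p.1 + A n) p.2 (p.2 + B n).

(** The first quarter that carries at least a fourth of the parent's [N]; if the first three fail,
    [Nadd] forces the fourth. *)
Let step n (p : R * R) : R * R :=
  let v := V n p / 4 in
  let p1 := p in let p2 := (p.1 + A n.+1, p.2) in
  let p3 := (p.1, p.2 + B n.+1) in let p4 := (p.1 + A n.+1, p.2 + B n.+1) in
  if v <= V n.+1 p1 then p1 else if v <= V n.+1 p2 then p2
  else if v <= V n.+1 p3 then p3 else p4.

Let Fixpoint sq n := if n is m.+1 then step m (sq m) else (a, c).

(** Quartering keeps [N] above [N a b c d / 4 ^+ n], while [Nloc] at the limit point bounds it by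
    [e] times the squared size, which also scales like the inverse of [4 ^+ n]. A small [e] makes a
    positive [N a b c d] impossible. *)
Lemma bisection_le0 : N a b c d <= 0.
Proof.
rewrite leNgt; apply/negP => N0.
have A0 n : 0 <= A n by rewrite divr_ge0 ?subr_ge0// exprn_ge0.
have B0 n : 0 <= B n by rewrite divr_ge0 ?subr_ge0// exprn_ge0.
have AS n : A n = A n.+1 + A n.+1 by rewrite /A exprS invfM; field; rewrite expf_neq0.
have BS n : B n = B n.+1 + B n.+1 by rewrite /B exprS invfM; field; rewrite expf_neq0.
have inv n : [/\ a <= (sq n).1, (sq n).1 + A n <= b, c <= (sq n).2,
    (sq n).2 + B n <= d & N a b c d / 4 ^+ n <= V n (sq n)]
    /\ [/\ (sq n).1 <= (sq n.+1).1, (sq n.+1).1 + A n.+1 <= (sq n).1 + A n,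
       (sq n).2 <= (sq n.+1).2 & (sq n.+1).2 + B n.+1 <= (sq n).2 + B n].
  have hB : [/\ (sq n).1 <= (sq n.+1).1, (sq n.+1).1 + A n.+1 <= (sq n).1 + A n,
       (sq n).2 <= (sq n.+1).2 & (sq n.+1).2 + B n.+1 <= (sq n).2 + B n].
    have := A0 n.+1; have := B0 n.+1; have := AS n; have := BS n.
    rewrite /= /step; case: (sq n) => l t /= -> -> ? ?.
    by do 3?[case: ifP => _]; split => /=; lra.
  split=> //; elim: n {hB} => [|n [i1 i2 i3 i4 i5]].
    rewrite /V /= /A /B !expr0 !divr1.
    by have e1 : a + (b - a) = b by [rewrite addrC subrK];
       have e2 : c + (d - c) = d by [rewrite addrC subrK]; rewrite e1 e2.
  have hA := A0 n.+1; have hB := B0 n.+1; have hAS := AS n; have hBS := BS n.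
  have {}i5 : N a b c d / 4 ^+ n.+1 <= V n (sq n) / 4.
    by rewrite exprSr invfM mulrA ler_pM2r.
  move: i1 i2 i3 i4 i5; rewrite /= /step; case: (sq n) => l t /=.
  set v := V n (l, t) => i1 i2 i3 i4 i5.
  have hsum : v <= V n.+1 (l, t) + V n.+1 (l + A n.+1, t) + V n.+1 (l, t + B n.+1)
                 + V n.+1 (l + A n.+1, t + B n.+1).
    rewrite /v /V /= -!addrA -AS -BS !addrA.
    by apply: Nadd => //=; lra.
  case: ifPn => [h1|]; first by split => //=; try lra; exact: le_trans i5 h1.
  rewrite -ltNge => h1.
  case: ifPn => [h2|]; first by split => //=; try lra; exact: le_trans i5 h2.
  rewrite -ltNge => h2.
  case: ifPn => [h3|]; first by split => //=; try lra; exact: le_trans i5 h3.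
  rewrite -ltNge => h3.
  by split => //=; try lra; apply: le_trans i5 _; lra.
have [x hx] : exists x, forall n, (sq n).1 <= x <= (sq n).1 + A n.
  by apply: (@nested_limit (fun n => (sq n).1) A) => n //; have [_ []] := inv n.
have [y hy] : exists x, forall n, (sq n).2 <= x <= (sq n).2 + B n.
  by apply: (@nested_limit (fun n => (sq n).2) B) => n //; have [_ []] := inv n.
have xab : a <= x <= b.
  have [[i1 i2 _ _ _] _] := inv 0%N; have /andP[h1 h2] := hx 0%N.
  by rewrite (le_trans i1 h1) (le_trans h2 i2).
have ycd : c <= y <= d.
  have [[_ _ i1 i2 _] _] := inv 0%N; have /andP[h1 h2] := hy 0%N.
  by rewrite (le_trans i1 h1) (le_trans h2 i2).
pose D := (b - a) + (d - c).
have D0 : 0 <= D by rewrite addr_ge0 ?subr_ge0.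
(* Chosen so that [e * D ^+ 2] is less than [N a b c d]. *)
pose e := N a b c d / (2 * (D ^+ 2 + 1)).
have DD : 0 < D ^+ 2 + 1 by rewrite ltr_wpDl// sqr_ge0.
have e0 : 0 < e by rewrite divr_gt0// mulr_gt0.
have [r r0 hr] := Nloc xab ycd e0.
have [n hn] : exists n, D / 2 ^+ n < r.
  have : D * 2^-1 ^+ n @[n --> \oo] --> (0 : R).
    rewrite -(mulr0 D); apply: cvgM; first exact: cvg_cst.
    by apply: cvg_expr; rewrite ger0_norm// invf_lt1// ltr1n.
  move=> /cvgrPdist_lt /(_ _ r0) [n _ /(_ n (leqnn n))] /=.
  rewrite sub0r normrN ger0_norm; last by rewrite mulr_ge0// exprn_ge0.
  by rewrite exprVn; exists n.
have [[i1 i2 i3 i4 i5] _] := inv n.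
have hAB : A n + B n = D / 2 ^+ n by rewrite /A /B -mulrDl.
have := hr _ _ _ _ i1 (hx n) i2 i3 (hy n) i4.
rewrite ![_.1 + _]addrC ![_.2 + _]addrC !addrK.
have An := A0 n; have Bn := B0 n.
move=> /(_ ltac:(lra) ltac:(lra)); rewrite hAB => hle.
have := le_trans i5 (le_trans _ hle).
rewrite /V ![_.1 + _]addrC ![_.2 + _]addrC => /(_ (lexx _)).
have -> : (D / 2 ^+ n) ^+ 2 = D ^+ 2 / 4 ^+ n.
  by rewrite expr_div_n exprAC; congr (_ / _ ^+ _); rewrite -natrX.
rewrite mulrA ler_pM2r ?invr_gt0 ?exprn_gt0// /e; apply/negP; rewrite -ltNge.
rewrite -mulrA gtr_pMr// mulrC ltr_pdivrMr ?mulr_gt0//; have := sqr_ge0 D; lra.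
Qed.

End Bisection.

(** * The unit circle as a curve *)

Section Cis.
Context {R : realType}.
Implicit Types (t s : R).

Definition cis t : C R := Complex (cos t) (sin t).

Lemma nm_cis t : nm (cis t) = 1.
Proof. by rewrite nm_def /= cos2Dsin2 sqrtr1. Qed.

Lemma cis_neq0 t : cis t != 0. Proof. by rewrite -nm_gt0 nm_cis. Qed.

Lemma cis0 : cis 0 = 1. Proof. by rewrite /cis cos0 sin0. Qed.

Lemma cisD t s : cis (t + s) = cis t * cis s.
Proof. by apply: C_inj; rewrite ?reM ?imM /= ?cosD ?sinD// addrC [X in X + _]mulrC [X in _ + X]mulrC addrC mulrC [X in _ + X]mulrC. Qed.

Lemma cisN t : cis (- t) = (cis t)^-1.
Proof. by apply: (mulfI (cis_neq0 t)); rewrite -cisD subrr cis0 divff ?cis_neq0. Qed.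

Lemma cis2pi : cis (pi *+ 2) = 1.
Proof. by rewrite /cis cos2pi sin2pi. Qed.

Lemma cis_cont t : cis x @[x --> t] --> cis t.
Proof.
have E : cis = fun x => rc (cos x) + iC * rc (sin x) by apply/funext => x; rewrite [LHS]CE.
rewrite E; apply: cvgD; first by apply: cvg_rc; exact: continuous_cos.
by apply: cvgM; [exact: cvg_cst|apply: cvg_rc; exact: continuous_sin].
Qed.

Lemma contC_cis (a b : R) : contC a b cis.
Proof. by split=> t _; exact: cis_cont. Qed.

Lemma cint_cis (a b : R) : a <= b -> cint (fun t => iC * cis t) a b = cis b - cis a.
Proof.
move=> ab; apply: cint_FTC => //; first exact/contCZ/contC_cis.
by move=> t _; rewrite reM imM /= !(mul0r, mul1r, sub0r, add0r); split;
  [exact: is_derive_cos|exact: is_derive_sin].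
Qed.

Lemma cis_lip t s : nm (cis t - cis s) <= 2 * `|t - s|.
Proof.
wlog st : t s / s <= t => [h|].
  by have [/h//|/ltW /h] := leP s t; rewrite nmB distrC.
rewrite -cint_cis// ger0_norm ?subr_ge0// -[2 in leRHS]mulr1.
by apply: cint_bound => // [|x _]; [exact/contCZ/contC_cis|rewrite nmM nm_iC nm_cis mulr1].
Qed.

(** A primitive is a multiple of [cis (- (t *+ n.+1))], which takes equal values at 0 and [2 pi]. *)
Lemma cint_cisX n : cint (fun t => (cis t)^-1 ^+ n.+1) 0 (pi *+ 2) = 0.
Proof.
have E t : (cis t)^-1 ^+ n.+1 = cis (- (t *+ n.+1)).
  elim: n => [|m IH]; first by rewrite cisN.
  by rewrite exprS IH -cisN -cisD [in RHS]mulrS opprD.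
have per : cis (- ((pi *+ 2) *+ n.+1)) = 1.
  by rewrite -E cis2pi invr1 expr1n.
pose k : R := n.+1%:R.
have k0 : k != 0 by rewrite pnatr_eq0.
have d t : is_derive t 1 (fun x : R => - (x *+ n.+1)) (- k).
  rewrite [X in is_derive _ _ X _](_ : _ = (- k) \*: id).
    by apply: is_derive_eq; rewrite /GRing.scale /= mulr1.
  by apply/funext => x; transitivity (- k * x); first by rewrite mulNr mulr_natl.
have := @cint_FTC _ 0 (pi *+ 2) (fun t => cis (- (t *+ n.+1)))
  (fun t => - (iC * rc k) * cis (- (t *+ n.+1))).
rewrite per mul0rn oppr0 cis0 subrr => h.
have cE : contC 0 (pi *+ 2) (fun t => cis (- (t *+ n.+1))).
  split=> t _; apply: (@continuous_cvg _ _ _ _ _ (fun t => - (t *+ n.+1)) cis).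
    exact: cis_cont.
  by apply: cvgN; apply: cvgMn; exact: cvg_id.
have c0 : - (iC * rc k) != 0 :> C R.
  by rewrite oppr_eq0 mulf_neq0 ?rc_eq0// -nm_gt0 nm_iC.
apply: (mulfI c0); rewrite mulr0 -[RHS]h.
- rewrite -cintZ; first by apply: cint_ext => t _; rewrite E.
  by split=> t tab; under eq_fun do rewrite E; rewrite E; case: cE => cE; exact: cE.
- by rewrite mulrn_wge0// pi_ge0.
- exact: contCZ.
- move=> t _; rewrite reM imM !reN !imN !reM !imM /= !(mul0r, mul1r, mulr0, subr0, addr0, add0r, sub0r, oppr0).
  split.
  + apply: is_derive_eq.
      exact: (@is_derive1_comp _ cos (fun x => - (x *+ n.+1))).
    by rewrite /=; ring.
  + apply: is_derive_eq.
      exact: (@is_derive1_comp _ sin (fun x => - (x *+ n.+1))).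
    by rewrite /=; ring.
Qed.

End Cis.

(** * Cauchy's formula, by contracting the circle to w *)

Section CauchyFormula.
Context {R : realType}.
Variables (F : C R -> C R) (w : C R) (rho : R).
Hypotheses (rho0 : 0 < rho) (wrho : nm w < rho).
Hypothesis dF : forall x, nm x <= rho -> derivable F x 1.

Let ze t : C R := rc rho * cis t.
(** Segments from [w] ([l = 0]) to the circle ([l = 1]). *)
Let Psi l t := w + rc l * (ze t - w).
(** Along a curve with [l] fixed, [dx / (x - w) = i * bk t * dt], whatever [l] is. *)
Let bk t := ze t / (ze t - w).

Let nm_ze t : nm (ze t) = rho.
Proof. by rewrite nmM nm_rc nm_cis mulr1 gtr0_norm. Qed.

Let gap : 0 < rho - nm w. Proof. by rewrite subr_gt0. Qed.

Let nm_zew t : rho - nm w <= nm (ze t - w).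
Proof. by rewrite -(nm_ze t) (le_trans _ (nm_dist _ _))// ler_norm. Qed.

Let zew_neq0 t : ze t - w != 0.
Proof. by rewrite -nm_gt0 (lt_le_trans gap (nm_zew t)). Qed.

Let iC0 : iC != 0 :> C R. Proof. by rewrite -nm_gt0 nm_iC. Qed.

Let contC_ze (a b : R) : contC a b ze.
Proof. exact/contCZ/contC_cis. Qed.

Let contC_zew (a b : R) : contC a b (fun t => ze t - w).
Proof. by apply: contCB; [exact: contC_ze|exact: contC_cst]. Qed.

Let contC_bk (a b : R) : contC a b bk.
Proof.
apply: contCM; first exact: contC_ze.
by apply: contCV (contC_zew a b) => t _; exact: zew_neq0.
Qed.

Let nm_bk t : nm (bk t) <= rho / (rho - nm w).
Proof. by rewrite nmf nm_ze ler_pM2l// lef_pV2// posrE (lt_le_trans gap). Qed.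

Let nm_Psi l t : 0 <= l <= 1 -> nm (Psi l t) <= rho.
Proof.
move=> /andP[l0 l1].
have -> : Psi l t = rc (1 - l) * w + rc l * ze t by rewrite /Psi rcB rc1; ring.
rewrite (le_trans (nmD _ _))// [nm (rc l * _)]nmM nmM nm_ze !nm_rc !ger0_norm ?subr_ge0//.
have := ler_wpM2l (_ : 0 <= 1 - l) (ltW wrho); rewrite subr_ge0 => /(_ l1); lra.
Qed.

Let nm_PsiB l t l' t' : 0 <= l <= 1 ->
  nm (Psi l t - Psi l' t') <= 2 * rho * (`|l - l'| + `|t - t'|).
Proof.
move=> /andP[l0 l1].
have -> : Psi l t - Psi l' t' = rc l * rc rho * (cis t - cis t') + rc (l - l') * (ze t' - w).
  by rewrite /Psi /ze rcB; ring.
rewrite (le_trans (nmD _ _))// !nmM !nm_rc (ger0_norm l0) (gtr0_norm rho0).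
have h1 : l * rho * nm (cis t - cis t') <= 2 * rho * `|t - t'|.
  apply: (@le_trans _ _ (rho * (2 * `|t - t'|))); last by rewrite mulrCA mulrA.
  by rewrite ler_pM ?mulr_ge0 ?nm_ge0 ?(ltW rho0) ?cis_lip ?ler_piMl// ltW.
have h2 : nm (ze t' - w) <= 2 * rho.
  by rewrite (le_trans (nmD _ _))// nmN nm_ze; have := wrho; lra.
by have := ler_wpM2l (normr_ge0 (l - l')) h2; lra.
Qed.

Let contC_F (a b : R) h : contC a b h -> (forall t, a <= t <= b -> nm (h t) <= rho) ->
  contC a b (fun t => F (h t)).
Proof.
move=> ch hh; apply: contC_comp ch _ => t tab.
by apply: derivable_cont; apply: dF; exact: hh.
Qed.

Let contC_Psi1 (a b l : R) : contC a b (fun t => Psi l t).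
Proof. by apply: contCD; [exact: contC_cst|apply: contCZ; exact: contC_zew]. Qed.

Let contC_rcid (a b : R) : contC a b rc.
Proof. by apply: contC_rc => t _; exact: cvg_id. Qed.

Let contC_Psi2 (a b t : R) : contC a b (fun l => Psi l t).
Proof.
by apply: contCD; [exact: contC_cst|apply: contCM; [exact: contC_rcid|exact: contC_cst]].
Qed.

Let contC_FPsi1 (a b l : R) : 0 <= l <= 1 -> contC a b (fun t => F (Psi l t)).
Proof. by move=> hl; apply: contC_F => [|t _]; [exact: contC_Psi1|exact: nm_Psi]. Qed.

Let contC_FPsi2 (a b t : R) : 0 <= a -> b <= 1 -> contC a b (fun l => F (Psi l t)).
Proof.
move=> a0 b1; apply: contC_F => [|l /andP[la lb]]; first exact: contC_Psi2.
by apply: nm_Psi; rewrite (le_trans a0 la) (le_trans lb b1).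
Qed.

Let contC_rcV (a b : R) : 0 < a -> contC a b (fun l => (rc l)^-1).
Proof.
move=> a0; apply: contCV (contC_rcid a b) => l /andP[la _].
by rewrite rc_eq0 gt_eqF// (lt_le_trans a0).
Qed.

(* The circulation of the form G (dl / l + i bk dt), the pull-back of
   F(x) dx / (x - w) under Psi when G = F \o Psi, around a rectangle. *)
Let wind (G : R -> R -> C R) (l1 l2 t1 t2 : R) : C R :=
  iC * (cint (fun t => G l2 t * bk t) t1 t2 - cint (fun t => G l1 t * bk t) t1 t2)
  - (cint (fun l => G l t2 * (rc l)^-1) l1 l2 - cint (fun l => G l t1 * (rc l)^-1) l1 l2).

(** Continuity of [G l] is asked for the two sides that occur, because [F \o Psi] is controlled only
    for [l] in [[0, 1]]. *)
Let windB G H (l1 l2 t1 t2 : R) : 0 < l1 ->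
  (forall l, contC t1 t2 (H l)) -> (forall t, contC l1 l2 (H^~ t)) ->
  (forall l, l \in [:: l1; l2] -> contC t1 t2 (G l)) -> (forall t, contC l1 l2 (G^~ t)) ->
  wind (fun l t => G l t - H l t) l1 l2 t1 t2 = wind G l1 l2 t1 t2 - wind H l1 l2 t1 t2.
Proof.
move=> l10 cH1 cH2 cG1 cG2.
have e1 l : l \in [:: l1; l2] ->
    cint (fun t => (G l t - H l t) * bk t) t1 t2 =
    cint (fun t => G l t * bk t) t1 t2 - cint (fun t => H l t * bk t) t1 t2.
  move=> hl; rewrite -cintB; [|apply: contCM; [|exact: contC_bk]..].
  - by apply: cint_ext => t _; rewrite mulrBl.
  - exact: cG1.
  - exact: cH1.
have e2 t : cint (fun l => (G l t - H l t) * (rc l)^-1) l1 l2 =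
    cint (fun l => G l t * (rc l)^-1) l1 l2 - cint (fun l => H l t * (rc l)^-1) l1 l2.
  rewrite -cintB; [|apply: contCM; [|exact: contC_rcV]..].
  - by apply: cint_ext => l _; rewrite mulrBl.
  - exact: cG2.
  - exact: cH2.
rewrite /wind !e2 !e1 ?inE ?eqxx ?orbT//; ring.
Qed.

Let affine k c (l t : R) : C R := k + c * (rc l * (ze t - w)).

(** In the variable [x = Psi l t], [affine k c] is [k + c (x - w)]. The constant gives a form with
    separated variables, which has no circulation, and the linear term gives the exact form
    [c dx]. *)
Let wind_affine k c (l1 l2 t1 t2 : R) : 0 < l1 -> l1 <= l2 -> t1 <= t2 ->
  wind (affine k c) l1 l2 t1 t2 = 0.
Proof.
move=> l10 l12 t12.
have e1 l : cint (fun t => affine k c l t * bk t) t1 t2 =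
    k * cint bk t1 t2 + c * rc l * (rc rho * cint cis t1 t2).
  rewrite -!cintZ; [|exact: contC_ze|exact: contC_cis|exact: contC_bk].
  rewrite -cintD; [|exact/contCZ/contC_bk|exact/contCZ/contC_ze].
  apply: cint_ext => t _; rewrite /affine mulrDl; congr (_ + _).
  by rewrite -[rc rho * cis t]/(ze t) /bk; field; exact: zew_neq0.
have icis : iC * cint cis t1 t2 = cis t2 - cis t1.
  by rewrite -cintZ ?cint_cis//; exact: contC_cis.
have e2 t : cint (fun l => affine k c l t * (rc l)^-1) l1 l2 =
    k * cint (fun l => (rc l)^-1) l1 l2 + c * (ze t - w) * rc (l2 - l1).
  rewrite -cint_cst// -cintZ; last exact: contC_rcV.
  rewrite -cintD; [|exact/contCZ/contC_rcV|exact: contC_cst].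
  apply: cint_ext => l /andP[ll _]; rewrite /affine mulrDl; congr (_ + _).
  by rewrite [rc l * _]mulrC mulrA mulfK// rc_eq0 gt_eqF// (lt_le_trans l10).
rewrite /wind !e1 !e2 rcB /ze.
set I := cint cis _ _ in icis *; set J := cint bk _ _; set K := cint _ l1 l2.
have -> : cis t2 = iC * I + cis t1 by rewrite icis subrK.
ring.
Qed.

Let wind_bound G (l1 l2 t1 t2 M : R) : 0 < l1 -> l1 <= l2 -> t1 <= t2 ->
  contC t1 t2 (G l1) -> contC t1 t2 (G l2) ->
  contC l1 l2 (G^~ t1) -> contC l1 l2 (G^~ t2) ->
  (forall l t, l1 <= l <= l2 -> t1 <= t <= t2 -> nm (G l t) <= M) ->
  nm (wind G l1 l2 t1 t2) <=
    4 * M * (rho / (rho - nm w) + l1^-1) * ((l2 - l1) + (t2 - t1)).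
Proof.
move=> l10 l12 t12 c1 c2 c3 c4 hM.
have M0 : 0 <= M by apply: le_trans (hM l1 t1 _ _); rewrite ?nm_ge0// ?lexx.
set B := rho / _; have B0 : 0 <= B by rewrite divr_ge0// ltW.
have hB t : nm (bk t) <= B := nm_bk t.
clearbody B.
have V0 : 0 <= l1^-1 by rewrite invr_ge0 ltW.
have b1 l : l1 <= l <= l2 -> contC t1 t2 (G l) ->
    nm (cint (fun t => G l t * bk t) t1 t2) <= 2 * (M * B) * (t2 - t1).
  move=> hl cG; apply: cint_bound => //; first by apply: contCM => //; exact: contC_bk.
  by move=> t ht; rewrite nmM ler_pM ?nm_ge0// ?hM.
have b2 t : t1 <= t <= t2 -> contC l1 l2 (G^~ t) ->
    nm (cint (fun l => G l t * (rc l)^-1) l1 l2) <= 2 * (M * l1^-1) * (l2 - l1).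
  move=> ht cG; apply: cint_bound => //; first by apply: contCM => //; exact: contC_rcV.
  move=> l /[dup] hl /andP[ll _].
  rewrite nmM ler_pM ?nm_ge0// ?hM// nmV nm_rc gtr0_norm ?(lt_le_trans l10)//.
  by rewrite lef_pV2 ?posrE// (lt_le_trans l10).
have := b1 l1; have := b1 l2; have := b2 t1; have := b2 t2.
rewrite !lexx l12 t12 => /(_ erefl c4) x4 /(_ erefl c3) x3 /(_ erefl c2) x2 /(_ erefl c1) x1.
rewrite /wind (le_trans (nmD _ _))// nmN nmM nm_iC mul1r.
have tri (x y : C R) : nm (x - y) <= nm x + nm y by rewrite (le_trans (nmD _ _))// nmN.
have := lerD (le_trans (tri _ _) (lerD x2 x1)) (le_trans (tri _ _) (lerD x4 x3)).
move=> /le_trans; apply.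
have L : 0 <= l2 - l1 by rewrite subr_ge0.
have T : 0 <= t2 - t1 by rewrite subr_ge0.
have m1 : 0 <= M * B * (l2 - l1) by rewrite !mulr_ge0.
have m2 : 0 <= M * l1^-1 * (t2 - t1) by rewrite !mulr_ge0.
lra.
Qed.

Let FP l t := F (Psi l t).

(** On a small rectangle [F \o Psi] differs from an affine function of [Psi] by [o(S)]. The affine
    part has no circulation and the perimeter is again of order [S], so [Nloc] holds. The bound
    [a > 0] keeps [1 / l] under control. *)
Let wind_FP0 (a c d : R) : 0 < a -> a <= 1 -> c <= d -> wind FP a 1 c d = 0.
Proof.
move=> a0 a1 cd.
suff : nm (wind FP a 1 c d) <= 0 by move=> h; apply/eqP; rewrite -nm_eq0 eq_le h nm_ge0.
apply: (bisection_le0 (N := fun l1 l2 t1 t2 => nm (wind FP l1 l2 t1 t2)) a1 cd).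
  move=> l1 l l2 t1 t t2 al1 l1l ll2 l21 ct1 t1t tt2 t2d.
  have l10 : 0 < l1 := lt_le_trans a0 al1.
  have l12 := le_trans l1l ll2.
  have h01 x : l1 <= x -> x <= l2 -> 0 <= x <= 1.
    by move=> h1 h2; rewrite (le_trans (ltW l10) h1) (le_trans h2 l21).
  have s1 x : l1 <= x -> x <= l2 -> cint (fun s => FP x s * bk s) t1 t2 =
      cint (fun s => FP x s * bk s) t1 t + cint (fun s => FP x s * bk s) t t2.
    move=> h1 h2; apply: cint_split => //; apply: contCM; last exact: contC_bk.
    exact/contC_FPsi1/h01.
  have s2 s : cint (fun x => FP x s * (rc x)^-1) l1 l2 =
      cint (fun x => FP x s * (rc x)^-1) l1 l + cint (fun x => FP x s * (rc x)^-1) l l2.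
    apply: cint_split => //; apply: contCM; last exact: contC_rcV.
    by apply: contC_FPsi2 => //; exact: ltW.
  have -> : wind FP l1 l2 t1 t2 = wind FP l1 l t1 t + wind FP l l2 t1 t
      + wind FP l1 l t t2 + wind FP l l2 t t2.
    have e1 := s1 l1 (lexx _) l12; have e2 := s1 l2 l12 (lexx _).
    rewrite /wind e1 e2 (s2 t1) (s2 t2).
    repeat match goal with |- context [cint ?f ?x ?y] => move: (cint f x y) => ? end.
    ring.
  by do 3 (rewrite (le_trans (nmD _ _))// lerD2r).
move=> x y /andP[ax x1] ycd e e0.
have x0 : 0 < x := lt_le_trans a0 ax.
have hx : 0 <= x <= 1 by rewrite ltW.
set K := rho / (rho - nm w) + a^-1.
have K0 : 0 < K by rewrite addr_gt0 ?divr_gt0 ?invr_gt0.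
have dFx := derivable_isd (dF (nm_Psi y hx)).
set D := derive1 F (Psi x y) in dFx.
(* Absorbs the constants 4 and [K] of [wind_bound] and [2 * rho] of [nm_PsiB]. *)
pose e' := e / (4 * K * (2 * rho)).
have e'0 : 0 < e' by rewrite divr_gt0 ?mulr_gt0.
have [r r0 hr] := dFx _ e'0.
exists (r / (4 * rho)); first by rewrite divr_gt0 ?mulr_gt0.
move=> l1 l2 t1 t2 al1 /andP[l1x xl2] l21 ct1 /andP[t1y yt2] t2d dl dt.
have l10 : 0 < l1 := lt_le_trans a0 al1.
have l12 := le_trans l1x xl2; have t12 := le_trans t1y yt2.
pose k := F (Psi x y) - D * (Psi x y - w).
have cA1 l : contC t1 t2 (affine k D l).
  by apply: contCD; [exact: contC_cst|apply/contCZ/contCZ; exact: contC_zew].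
have cA2 t : contC l1 l2 ((affine k D)^~ t).
  apply: contCD; first exact: contC_cst.
  by apply: contCZ; apply: contCM; [exact: contC_rcid|exact: contC_cst].
have cF2 t : contC l1 l2 (FP^~ t) by apply: contC_FPsi2 => //; exact: ltW.
have cF1 l : l \in [:: l1; l2] -> contC t1 t2 (FP l).
  rewrite !inE => hl; apply: contC_FPsi1.
  by case/orP: hl => /eqP ->; rewrite ?(ltW l10) ?(le_trans l12 l21)// l21 (le_trans (ltW l10) l12).
have E := windB l10 cA1 cA2 cF1 cF2.
rewrite (wind_affine _ _ l10 l12 t12) subr0 in E; rewrite -E.
pose S := (l2 - l1) + (t2 - t1).
have S0 : 0 <= S by rewrite addr_ge0 // subr_ge0.
have hM l t : l1 <= l <= l2 -> t1 <= t <= t2 ->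
    nm (FP l t - affine k D l t) <= e' * (2 * rho * S).
  move=> /andP[hl1 hl2] /andP[ht1 ht2].
  have -> : FP l t - affine k D l t = F (Psi l t) - F (Psi x y) - D * (Psi l t - Psi x y).
    have -> : affine k D l t = k + D * (Psi l t - w) by rewrite /affine /Psi; congr (_ + _ * _); rewrite [RHS]addrC addKr.
    by rewrite /FP /k; ring.
  have hl : 0 <= l <= 1 by rewrite (le_trans (ltW l10) hl1) (le_trans hl2 l21).
  have hP : nm (Psi l t - Psi x y) <= 2 * rho * S.
    rewrite (le_trans (nm_PsiB _ _ _ hl))// ler_pM2l ?mulr_gt0//.
    by apply: lerD; rewrite ler_norml; apply/andP; split; lra.
  apply: le_trans (hr _ _) _; last by rewrite ler_pM2l.
  apply: le_lt_trans hP _; rewrite /S.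
  have : (l2 - l1) + (t2 - t1) < r / (4 * rho) + r / (4 * rho) by apply: ltrD.
  rewrite -(ltr_pM2l (_ : 0 < 2 * rho)) ?mulr_gt0// => /lt_le_trans; apply.
  suff -> : 2 * rho * (r / (4 * rho) + r / (4 * rho)) = r by [].
  by field; rewrite gt_eqF.
apply: le_trans (wind_bound l10 l12 t12 _ _ _ _ hM) _.
- by apply: contCB => //; apply: cF1; rewrite inE eqxx.
- by apply: contCB => //; apply: cF1; rewrite !inE eqxx orbT.
- exact: contCB.
- exact: contCB.
rewrite -/S expr2.
have K1 : rho / (rho - nm w) + l1^-1 <= K by rewrite lerD2l lef_pV2.
apply: (@le_trans _ _ (4 * (e' * (2 * rho * S)) * K * S)).
  apply: ler_wpM2r => //; apply: ler_wpM2l => //.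
  by rewrite pmulr_rge0// pmulr_rge0// !mulr_ge0// ltW.
rewrite le_eqVlt; apply/orP; left; apply/eqP; rewrite /e'; field.
by rewrite !gt_eqF.
Qed.

Let tau : R := pi *+ 2.
Let tau0 : 0 <= tau. Proof. by rewrite mulrn_wge0// pi_ge0. Qed.

(** The sides [t = 0] and [t = tau] have the same image under [Psi] and cancel, which leaves the two
    closed curves. *)
Let radial_const l : 0 < l -> l <= 1 ->
  cint (fun t => FP l t * bk t) 0 tau = cint (fun t => FP 1 t * bk t) 0 tau.
Proof.
move=> l0 l1; have := wind_FP0 l0 l1 tau0.
have -> : wind FP l 1 0 tau = iC * (cint (fun t => FP 1 t * bk t) 0 tau - cint (fun t => FP l t * bk t) 0 tau).
  rewrite {1}/wind; suff -> : cint (fun x => FP x tau * (rc x)^-1) l 1 = cint (fun x => FP x 0 * (rc x)^-1) l 1.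
    by rewrite subrr subr0.
  by apply: cint_ext => x _; rewrite /FP /Psi /ze /tau cis2pi cis0.
by move=> /esym h; apply/esym/subr0_eq; apply: (mulfI iC0); rewrite mulr0.
Qed.

(** By [radial_const] the curve can be taken so close to [w] that [F] is within [e'] of [F w] all
    along it. *)
Let cauchy_kernel : cint (fun t => FP 1 t * bk t) 0 tau = F w * cint bk 0 tau.
Proof.
apply/eqP; rewrite -subr_eq0 -nm_eq0 eq_le nm_ge0 andbT; apply/ler_addgt0Pr => e e0.
rewrite add0r; set B := rho / (rho - nm w).
have B0 : 0 < B by rewrite divr_gt0.
have hB t : nm (bk t) <= B := nm_bk t.
clearbody B.
pose e' := e / (2 * B * (tau + 1)).
have T0 : 0 < tau + 1 by rewrite ltr_wpDl.
have e'0 : 0 < e' by rewrite divr_gt0// !mulr_gt0.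
have /ccvgP /(_ _ e'0) /cnbhsP [r r0 hr] := derivable_cont (dF (ltW wrho)).
(* [nm (Psi l t - w)] is at most [2 * rho * l], hence at most [r / 2]. *)
pose l := Num.min 1 (r / (4 * rho)).
have l0 : 0 < l by rewrite lt_min ltr01 divr_gt0 ?mulr_gt0.
have l1 : l <= 1 by rewrite ge_min lexx.
have hl : 0 <= l <= 1 by rewrite ltW.
rewrite -(radial_const l0 l1) -cintZ; last exact: contC_bk.
have cl : contC 0 tau (fun t => FP l t * bk t).
  by apply: contCM; [exact: contC_FPsi1|exact: contC_bk].
rewrite -cintB//; last exact/contCZ/contC_bk.
apply: (@le_trans _ _ (2 * (e' * B) * (tau - 0))).
  apply: cint_bound => //; first by apply: contCB => //; exact/contCZ/contC_bk.
  move=> t _; rewrite -mulrBl nmM ler_pM ?nm_ge0// ltW//.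
  apply: hr; rewrite /Psi addrC addKr nmM nm_rc gtr0_norm//.
  have : nm (ze t - w) <= 2 * rho.
    by rewrite (le_trans (nmD _ _))// nmN nm_ze; have := wrho; lra.
  move=> h; apply: (@le_lt_trans _ _ (r / (4 * rho) * (2 * rho))).
    by rewrite ler_pM ?nm_ge0 ?(ltW l0)// ge_min lexx orbT.
  rewrite (_ : _ * _ = r / 2); last by field; rewrite gt_eqF.
  by rewrite ltr_pdivrMr// ltr_pMr// ltr1n.
rewrite subr0 (_ : _ * tau = e * (tau / (tau + 1))); last first.
  have [B' T'] : B != 0 /\ tau + 1 != 0 by rewrite !gt_eqF.
  by rewrite /e'; move: (tau) T' => T T'; field; rewrite B' T'.
by rewrite ger_pMr// ler_pdivrMr// mul1r lerDl.
Qed.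

(** The geometric expansion of [ze / (ze - w)] in powers of [w / ze], peeled one term at a time.
    Terms of positive degree integrate to 0, so the remainder [k 1] equals every [k n.+1], and these
    decay like [(nm w / rho) ^+ n]. *)
Let cint_bk : cint bk 0 tau = rc tau.
Proof.
pose k n := cint (fun t => (w / ze t) ^+ n * bk t) 0 tau.
have q0 : 0 <= nm w / rho < 1.
  by rewrite divr_ge0 ?nm_ge0 ?(ltW rho0)// ltr_pdivrMr// mul1r.
have cV : contC 0 tau (fun t => w / ze t).
  apply/contCZ/contCV; last exact: contC_ze.
  by move=> t _; rewrite -nm_gt0 nm_ze.
have kS n : k n = k n.+1 + cint (fun t => (w / ze t) ^+ n) 0 tau.
  rewrite -cintD; last 2 first.
  - by apply: contCM; [exact: contCX|exact: contC_bk].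
  - exact: contCX.
  apply: cint_ext => t _; rewrite exprSr /bk.
  have z0 : ze t != 0 by rewrite -nm_gt0 nm_ze.
  move: (_ ^+ n) => u; field.
  by rewrite z0 zew_neq0.
have k0 : cint bk 0 tau = k 1%N + rc tau.
  rewrite -[cint bk _ _]/(cint _ 0 tau) -[rc tau]mul1r -[X in rc X]subr0 -cint_cst//.
  rewrite -(kS 0%N); apply: cint_ext => t _; by rewrite expr0 mul1r.
have k1 n : k 1%N = k n.+1.
  elim: n => // n ->; rewrite kS.
  rewrite (@cint_ext _ _ _ _ (fun t => (w / rc rho) ^+ n.+1 * (cis t)^-1 ^+ n.+1)).
    rewrite cintZ; first by rewrite cint_cisX mulr0 addr0.
    by apply/contCX/contCV => [t _|]; [exact: cis_neq0|exact: contC_cis].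
  by move=> t _; rewrite -exprMn /ze invfM mulrA.
suff k10 : k 1%N = 0 by rewrite k0 k10 add0r.
set B := rho / (rho - nm w).
have B0 : 0 < B by rewrite divr_gt0.
have hB t : nm (bk t) <= B := nm_bk t.
clearbody B.
have kb n : nm (k 1%N) <= 2 * B * tau * (nm w / rho) ^+ n.
  apply: le_trans (_ : 2 * ((nm w / rho) ^+ n.+1 * B) * (tau - 0) <= _).
    rewrite (k1 n); apply: cint_bound => //.
      by apply: contCM; [exact: contCX|exact: contC_bk].
    move=> t _; rewrite nmM nmX nmf nm_ze ler_wpM2l// exprn_ge0//.
    by case/andP: q0.
  rewrite subr0 exprS; case/andP: q0 => q0 q1.
  have : 0 <= 2 * B * tau * (nm w / rho) ^+ n.
    by rewrite !mulr_ge0 ?exprn_ge0// ltW.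
  move=> /(ler_wpM2l) /(_ _ _ (ltW q1)).
  by rewrite mulr1; apply: le_trans; rewrite le_eqVlt; apply/orP; left; apply/eqP; ring.
have lim : 2 * B * tau * (nm w / rho) ^+ n @[n --> \oo] --> (0 : R).
  rewrite -(mulr0 (2 * B * tau)); apply: cvgM; first exact: cvg_cst.
  by case/andP: q0 => ? ?; apply: cvg_expr; rewrite ger0_norm.
apply/eqP; rewrite -nm_eq0 eq_le nm_ge0 andbT.
apply: (cvgr_to_ge lim); exact: nearW.
Qed.

Lemma cauchy_formula :
  F w = (rc tau)^-1 * cint (fun t => F (ze t) * bk t) 0 tau.
Proof.
have -> : cint (fun t => F (ze t) * bk t) 0 tau = cint (fun t => FP 1 t * bk t) 0 tau.
  by apply: cint_ext => t _; rewrite /FP /Psi mul1r addrC subrK.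
rewrite cauchy_kernel cint_bk mulrCA mulVf ?mulr1// rc_eq0 gt_eqF//.
by rewrite /tau mulrn_wgt0// pi_gt0.
Qed.

End CauchyFormula.

(** * Cauchy integrals and zeros of holomorphic functions *)

Section CauchyIntegrals.
Context {R : realType}.
Implicit Types (H : R -> C R) (rho : R) (w x p : C R).

Let tau : R := pi *+ 2.
Let tau0 : 0 <= tau. Proof. by rewrite mulrn_wge0// pi_ge0. Qed.

Lemma contC_bounded (a b : R) H : a <= b -> contC a b H ->
  exists2 B, 0 < B & forall t, a <= t <= b -> nm (H t) <= B.
Proof.
move=> ab [cH].
have cn : {within `[a, b], continuous (nm \o H)}.
  apply: continuous_in_subspaceT => t; rewrite inE /= in_itv /= => tab.
  by apply: cvg_nm; exact: cH.
have [c _ hc] := EVT_max ab cn.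
exists (nm (H c) + 1); first by rewrite ltr_wpDl ?nm_ge0.
move=> t tab; rewrite (le_trans (hc t _)) ?in_itv//= lerDl//.
Qed.

(** Differentiation under the integral sign: a remainder quadratic in [w' - w], uniformly in [t],
    survives integration. *)
Lemma cint_isd H (k : C R -> R -> C R) (d : R -> C R) w r M :
  contC 0 tau H -> 0 < r -> 0 <= M ->
  (forall w', nm (w' - w) < r -> contC 0 tau (k w')) -> contC 0 tau d ->
  (forall w' t, nm (w' - w) < r ->
     nm (k w' t - k w t - (w' - w) * d t) <= M * nm (w' - w) ^+ 2) ->
  isd (fun w => cint (fun t => H t * k w t) 0 tau) w (cint (fun t => H t * d t) 0 tau).
Proof.
move=> cH r0 M0 ck cd hM e e0.
have [B B0 hB] := contC_bounded tau0 cH.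
have T0 : 0 < tau + 1 by rewrite ltr_wpDl.
have K0 : 0 < 2 * B * (M + 1) * (tau + 1) by rewrite !mulr_gt0// ltr_wpDl.
exists (Num.min r (e / (2 * B * (M + 1) * (tau + 1)))).
  by rewrite lt_min r0 divr_gt0.
move=> w'; rewrite lt_min => /andP[wr we].
have c1 := contCM cH (ck _ wr).
have c0 : contC 0 tau (fun t => H t * k w t).
  by apply: contCM => //; apply: ck; rewrite subrr nm0.
have cHd := contCM cH cd.
rewrite [_ * (w' - w)]mulrC -cintZ// -cintB// -cintB//; last 2 first.
- exact: contCB.
- exact: contCZ.
apply: le_trans (cint_bound (M := B * (M * nm (w' - w) ^+ 2)) tau0 _ _) _.
- by apply: contCB; [exact: contCB|exact: contCZ].
- move=> t /hB Ht.
  rewrite (_ : _ - _ = H t * (k w' t - k w t - (w' - w) * d t)); last by ring.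
  by rewrite nmM ler_pM ?nm_ge0// hM.
rewrite subr0 expr2.
have n0 := nm_ge0 (w' - w).
apply: (@le_trans _ _ (2 * B * (M + 1) * (tau + 1) * nm (w' - w) * nm (w' - w))).
  move: (nm _) n0 => N n0.
  rewrite (_ : 2 * (B * (M * (N * N))) * tau = 2 * B * M * tau * (N * N)); last by ring.
  rewrite -[leRHS]mulrA ler_wpM2r ?mulr_ge0// ler_pM ?mulr_ge0 ?(ltW B0)//; last by rewrite lerDl.
  by rewrite ler_pM2l ?mulr_gt0// lerDl.
apply: ler_wpM2r => //; move: we; rewrite ltr_pdivlMr// mulrC; exact: ltW.
Qed.

(** The factors [1 / (2 pi i)] and [dx / dt] of the usual Cauchy integral are absorbed in the
    density [H], so that dividing the density by the variable on the circle stays in the same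
    class. *)
Definition cauchyI rho H n w := cint (fun t => H t * (rc rho * cis t - w)^-1 ^+ n) 0 tau.

(** * Differentiation and Taylor expansion of Cauchy integrals *)

Section Kernel.
Variables (rho : R).
Hypothesis rho0 : 0 < rho.
Let K w t := (rc rho * cis t - w)^-1.

Let nm_zeta t : nm (rc rho * cis t) = rho.
Proof. by rewrite nmM nm_rc nm_cis mulr1 gtr0_norm. Qed.

Let zetaB_neq0 w t : nm w < rho -> rc rho * cis t - w != 0.
Proof.
move=> wr; rewrite subr_eq0; apply: contraTneq wr => <-.
by rewrite nm_zeta ltxx.
Qed.

Let contC_zeta : contC 0 tau (fun t => rc rho * cis t).
Proof. exact/contCZ/contC_cis. Qed.

Lemma contC_kernel w : nm w < rho -> contC 0 tau (K w).
Proof.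
move=> wr; apply: contCV => [t _|]; first exact: zetaB_neq0.
by apply: contCB; [exact: contC_zeta|exact: contC_cst].
Qed.

Lemma nm_kernel w t : nm w <= rho / 2 -> nm (K w t) <= 2 / rho.
Proof.
move=> wr; rewrite nmV.
have h : rho / 2 <= nm (rc rho * cis t - w).
  rewrite (le_trans _ (nm_dist _ _))// nm_zeta (le_trans _ (ler_norm _))//; lra.
rewrite -[leRHS]invrK lef_pV2 ?posrE ?invr_gt0 ?divr_gt0//.
  by rewrite invf_div.
by rewrite (lt_le_trans _ h)// divr_gt0.
Qed.

Let half_lt w : nm w <= rho / 2 -> nm w < rho.
Proof. by move=> h; rewrite (le_lt_trans h)// ltr_pdivrMr// ltr_pMr// ltr1n. Qed.

(** The resolvent identity, source of the derivatives and of the Lipschitz bound alike. *)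
Let kernelB w w' t : nm w < rho -> nm w' < rho ->
  K w' t - K w t = (w' - w) * (K w t * K w' t).
Proof.
move=> wr wr'; rewrite /K; field.
by rewrite !zetaB_neq0.
Qed.

Lemma kernel_isd1 H w : contC 0 tau H -> nm w < rho / 2 ->
  isd (cauchyI rho H 1) w (cauchyI rho H 2 w).
Proof.
move=> cH wr; set r := rho / 2 - nm w.
have r0 : 0 < r by rewrite subr_gt0.
have hr w' : nm (w' - w) < r -> nm w' <= rho / 2.
  move=> h; have := nmD (w' - w) w; rewrite subrK => /le_trans; apply.
  by rewrite -lerBrDr ltW.
have P0 : 0 < 2 / rho by rewrite divr_gt0.
apply: (@cint_isd _ (fun w t => K w t ^+ 1) _ w r ((2 / rho) ^+ 3)) => //.
- exact/exprn_ge0/ltW.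
- by move=> w' /hr /half_lt h; apply: contCX; exact: contC_kernel.
- by apply: contCX; apply: contC_kernel; exact/half_lt/ltW.
move=> w' t wr'; have h' := hr _ wr'; have h := ltW wr.
rewrite !expr1 kernelB ?half_lt//.
have -> : (w' - w) * (K w t * K w' t) - (w' - w) * K w t ^+ 2 =
    (w' - w) * K w t * (K w' t - K w t) by ring.
rewrite kernelB ?half_lt// !nmM.
have n1 := nm_ge0 (w' - w); have n2 := nm_ge0 (K w t); have n3 := nm_ge0 (K w' t).
rewrite (_ : _ * _ = nm (w' - w) ^+ 2 * (nm (K w t) * nm (K w t) * nm (K w' t))); last by ring.
rewrite mulrC ler_wpM2r ?exprn_ge0// !exprS expr0 mulr1 -mulrA.
by rewrite !ler_pM ?mulr_ge0// nm_kernel.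
Qed.

(** Two uses of the resolvent identity extract the factor [(w' - w) ^+ 2]. This second derivative is
    what makes [derive1 f] holomorphic. *)
Lemma kernel_isd2 H w : contC 0 tau H -> nm w < rho / 2 ->
  isd (cauchyI rho H 2) w (cint (fun t => H t * (2 * K w t ^+ 3)) 0 tau).
Proof.
move=> cH wr; set r := rho / 2 - nm w.
have r0 : 0 < r by rewrite subr_gt0.
have hr w' : nm (w' - w) < r -> nm w' <= rho / 2.
  move=> h; have := nmD (w' - w) w; rewrite subrK => /le_trans; apply.
  by rewrite -lerBrDr ltW.
have P0 : 0 < 2 / rho by rewrite divr_gt0.
apply: (@cint_isd _ (fun w t => K w t ^+ 2) _ w r (3 * (2 / rho) ^+ 4)) => //.
- by rewrite mulr_ge0// exprn_ge0// ltW.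
- by move=> w' /hr /half_lt h; apply: contCX; exact: contC_kernel.
- by apply: contCZ; apply: contCX; apply: contC_kernel; exact/half_lt/ltW.
move=> w' t wr'; have h' := hr _ wr'; have h := ltW wr.
have kB := kernelB t (half_lt h) (half_lt h').
have -> : K w' t ^+ 2 - K w t ^+ 2 - (w' - w) * (2 * K w t ^+ 3) =
    (w' - w) ^+ 2 * (K w t ^+ 2 * K w' t * (K w' t + 2 * K w t)).
  have -> : K w' t ^+ 2 - K w t ^+ 2 = (K w' t - K w t) * (K w' t + K w t) by ring.
  rewrite kB.
  have -> : (w' - w) * (K w t * K w' t) * (K w' t + K w t) - (w' - w) * (2 * K w t ^+ 3) =
    (w' - w) * K w t * ((K w' t - K w t) * (K w' t + 2 * K w t)) by ring.
  by rewrite kB; ring.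
have k1 := nm_kernel t h; have k2 := nm_kernel t h'.
have n1 := nm_ge0 (w' - w); have n2 := nm_ge0 (K w t); have n3 := nm_ge0 (K w' t).
rewrite nmM (nmX (w' - w)) mulrC ler_wpM2r ?exprn_ge0// 2!nmM (nmX (K w t)).
have k3 : nm (K w' t + 2 * K w t) <= 3 * (2 / rho).
  rewrite (le_trans (nmD _ _))// nmM.
  have -> : nm (2 : C R) = 2.
    have -> : (2 : C R) = rc 2 by rewrite /rc rmorphMn.
    by rewrite nm_rc ger0_norm.
  lra.
rewrite (_ : 3 * _ ^+ 4 = (2 / rho) ^+ 2 * (2 / rho) * (3 * (2 / rho))); last by ring.
by rewrite !ler_pM ?mulr_ge0 ?exprn_ge0 ?nm_ge0// !expr2 ler_pM.
Qed.

Lemma kernel_lip H : contC 0 tau H -> exists M, forall w w',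
  nm w < rho / 2 -> nm w' < rho / 2 ->
  nm (cauchyI rho H 1 w - cauchyI rho H 1 w') <= M * nm (w - w').
Proof.
move=> cH; have [B B0 hB] := contC_bounded tau0 cH.
exists (2 * (B * (2 / rho * (2 / rho))) * tau) => w w' /ltW wr /ltW wr'.
have cK x : nm x <= rho / 2 -> contC 0 tau (fun t => H t * K x t ^+ 1).
  by move=> /half_lt h; apply: contCM => //; apply: contCX; exact: contC_kernel.
rewrite /cauchyI -cintB; [|exact: cK..].
apply: le_trans (cint_bound (M := B * (nm (w - w') * (2 / rho * (2 / rho)))) tau0 _ _) _.
- by apply: contCB; exact: cK.
- move=> t /hB Ht; rewrite !expr1 -mulrBr nmM ler_pM ?nm_ge0//.
  rewrite -[X in nm (_ - X)]/(K w' t) -[X in nm (X - _)]/(K w t) kernelB ?half_lt// !nmM.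
  by rewrite ler_wpM2l ?nm_ge0// ler_pM ?nm_ge0// nm_kernel.
rewrite subr0 le_eqVlt; apply/orP; left; apply/eqP; ring.
Qed.

(** [1 / (x - w) = 1 / x + (w / x) / (x - w)] under the integral: one Taylor coefficient comes off,
    and the remainder is again a Cauchy integral, with density [H / x]. *)
Lemma kernel_taylor1 H w : contC 0 tau H -> nm w < rho ->
  let H' t := H t * (rc rho * cis t)^-1 in contC 0 tau H' /\
  cauchyI rho H 1 w = cauchyI rho H 1 0 + w * cauchyI rho H' 1 w.
Proof.
move=> cH wr H'.
have z0 t : rc rho * cis t != 0 by rewrite -nm_gt0 nm_zeta.
have cH' : contC 0 tau H' by apply: contCM cH _; apply: contCV contC_zeta.
split=> //.
have cK x : nm x < rho -> contC 0 tau (fun t => K x t ^+ 1).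
  by move=> h; apply: contCX; exact: contC_kernel.
rewrite -cintZ; last by apply: contCM => //; exact: cK.
rewrite -cintD; last 2 first.
- by apply: contCM => //; apply: (cK 0); rewrite nm0.
- by apply: contCZ; apply: contCM => //; exact: cK.
apply: cint_ext => t _; rewrite !expr1 subr0 /H'.
have := zetaB_neq0 t wr; have := z0 t; move: (rc rho * cis t) => z z1 z2; field.
by rewrite z1 z2.
Qed.

(** The Taylor coefficients are the values at 0 for the densities [HN n]. The first nonzero one
    gives the order of the zero; if all vanish, the integral equals its remainder of every order,
    which decays geometrically on the half disc. *)
Lemma kernel_dichotomy H : contC 0 tau H ->
  (forall w, nm w < rho / 2 -> cauchyI rho H 1 w = 0) \/
  exists N H', [/\ contC 0 tau H', cauchyI rho H' 1 0 != 0 &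
    forall w, nm w < rho -> cauchyI rho H 1 w = w ^+ N * cauchyI rho H' 1 w].
Proof.
move=> cH.
pose HN n t := H t * (rc rho * cis t)^-1 ^+ n.
have cHN n : contC 0 tau (HN n).
  apply: contCM => //; apply: contCX; apply: contCV contC_zeta => t _.
  by rewrite -nm_gt0 nm_zeta.
have HNS n : (fun t => HN n t * (rc rho * cis t)^-1) = HN n.+1.
  by apply/funext => t; rewrite /HN exprSr mulrA.
have rem n w : nm w < rho -> (forall k, (k < n)%N -> cauchyI rho (HN k) 1 0 = 0) ->
    cauchyI rho H 1 w = w ^+ n * cauchyI rho (HN n) 1 w.
  move=> wr; elim: n => [|n IH] hn.
    by rewrite expr0 mul1r; apply: cint_ext => t _; rewrite /HN expr0 mulr1.
  rewrite IH; last by move=> k kn; apply: hn; exact: leqW.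
  have [_ ->] := kernel_taylor1 (cHN n) wr.
  by rewrite HNS hn// add0r exprSr mulrA.
case: (pselect (exists n, cauchyI rho (HN n) 1 0 != 0)) => [ex|nex]; [right|left].
  have [N hN hmin] := ex_minnP ex.
  exists N, (HN N); split => // w wr; apply: rem => // k kN.
  by apply/eqP/negPn/negP => /hmin; rewrite leqNgt kN.
have all0 n : cauchyI rho (HN n) 1 0 = 0.
  by apply/eqP/negPn/negP => h; apply: nex; exists n.
move=> w /ltW wr; have [B B0 hB] := contC_bounded tau0 cH.
have bound n : nm (cauchyI rho H 1 w) <= 2 * (B * (2 / rho)) * tau * (nm w / rho) ^+ n.
  rewrite (rem n w (half_lt wr) (fun k _ => all0 k)) nmM nmX.
  apply: (@le_trans _ _ (nm w ^+ n * (2 * (B * rho^-1 ^+ n * (2 / rho)) * (tau - 0)))).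
    apply: ler_wpM2l; first by rewrite exprn_ge0// nm_ge0.
    apply: cint_bound => //.
      by apply: contCM => //; apply: contCX; apply: contC_kernel; exact: half_lt.
    move=> t /hB Ht; rewrite expr1 nmM ler_pM ?nm_ge0//; last exact: nm_kernel.
    by rewrite /HN nmM nmX nmV nm_zeta ler_wpM2r// exprn_ge0// invr_ge0 ltW.
  rewrite subr0 expr_div_n exprVn le_eqVlt; apply/orP; left; apply/eqP; ring.
have q0 : 0 <= nm w / rho < 1.
  by rewrite divr_ge0 ?nm_ge0 ?(ltW rho0)// ltr_pdivrMr// mul1r half_lt.
have lim : 2 * (B * (2 / rho)) * tau * (nm w / rho) ^+ n @[n --> \oo] --> (0 : R).
  rewrite -(mulr0 (2 * (B * (2 / rho)) * tau)); apply: cvgM; first exact: cvg_cst.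
  by case/andP: q0 => ? ?; apply: cvg_expr; rewrite ger0_norm.
apply/eqP; rewrite -nm_eq0 eq_le nm_ge0 andbT.
apply: (cvgr_to_ge lim); exact: nearW.
Qed.

End Kernel.

(** * Local structure of holomorphic functions *)

Definition holo_near (f : C R -> C R) p := \forall w \near p, derivable f w 1.

Lemma isd_shift (f : C R -> C R) p x d : isd (fun y => f (y + p)) x d <-> isd f (x + p) d.
Proof.
split=> h e e0; have [r r0 hr] := h e e0; exists r => // w wr.
  have := hr (w - p); rewrite -addrA -opprD [p + x]addrC subrK.
  exact.
by have := hr (w + p); rewrite opprD addrACA subrr addr0; exact.
Qed.

Lemma near_ball_sub x p r : nm (x - p) < r -> \forall w \near x, nm (w - p) < r.
Proof.
move=> xr; apply/cnbhsP; exists (r - nm (x - p)); first by rewrite subr_gt0.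
by move=> w wx; rewrite (le_lt_trans (nm_triB _ x _))// -ltrBrDr.
Qed.

Lemma holo_rep f p : holo_near f p -> exists rho H,
  [/\ 0 < rho, contC 0 tau H & forall x, nm (x - p) < rho ->
      derivable f x 1 /\ f x = cauchyI rho H 1 (x - p)].
Proof.
move=> /cnbhsP [r r0 hr]; pose F y := f (y + p).
(* Half the radius keeps the closed disc inside the domain. *)
have r20 : 0 < r / 2 by rewrite divr_gt0.
have r2r : r / 2 < r by rewrite ltr_pdivrMr// ltr_pMr// ltr1n.
have dF x : nm x <= r / 2 -> derivable F x 1.
  move=> xr; apply: isd_derivable; apply/isd_shift; apply: derivable_isd.
  by apply: hr; rewrite addrK (le_lt_trans xr).
have cF : contC 0 tau (fun t => F (rc (r / 2) * cis t)).
  apply: contC_comp; first exact/contCZ/contC_cis.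
  move=> t _; apply: derivable_cont; apply: dF.
  by rewrite nmM nm_rc nm_cis mulr1 gtr0_norm.
have cH : contC 0 tau (fun t => F (rc (r / 2) * cis t) * (rc (r / 2) * cis t)).
  by apply: contCM => //; exact/contCZ/contC_cis.
exists (r / 2), (fun t => (rc tau)^-1 * (F (rc (r / 2) * cis t) * (rc (r / 2) * cis t))).
split => //; first exact: contCZ.
move=> x xr; split; first by apply: hr; exact: lt_trans r2r.
have -> : f x = F (x - p) by rewrite /F subrK.
rewrite (cauchy_formula r20 xr dF) -cintZ.
  by apply: cint_ext => t _; rewrite expr1 !mulrA.
apply: contCM => //; apply: contCM; first exact/contCZ/contC_cis.
have := contC_kernel r20 xr; exact.
Qed.

Lemma holo_lip f p : holo_near f p -> exists2 r, 0 < r & exists M, forall w w',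
  nm (w - p) < r -> nm (w' - p) < r -> nm (f w - f w') <= M * nm (w - w').
Proof.
move=> /holo_rep [rho [H [rho0 cH hf]]]; have [M hM] := kernel_lip rho0 cH.
have r2 : rho / 2 < rho by rewrite ltr_pdivrMr// ltr_pMr// ltr1n.
exists (rho / 2); first by rewrite divr_gt0.
exists M => w w' wr wr'.
rewrite (hf w (lt_trans wr r2)).2 (hf w' (lt_trans wr' r2)).2.
by have := hM _ _ wr wr'; rewrite opprB addrA subrK.
Qed.

Lemma holo_derive f p : holo_near f p -> holo_near (derive1 f) p.
Proof.
move=> /holo_rep [rho [H [rho0 cH hf]]].
have r2 : rho / 2 < rho by rewrite ltr_pdivrMr// ltr_pMr// ltr1n.
have hd x : nm (x - p) < rho / 2 -> derive1 f x = cauchyI rho H 2 (x - p).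
  move=> xr; apply: isd_derive1.
  have h := (isd_shift _ (- p) _ _).2 (kernel_isd1 rho0 cH xr).
  apply: isd_near h; near=> w.
  rewrite (hf w _).2// (lt_trans _ r2)//; near: w; exact: near_ball_sub.
apply/cnbhsP; exists (rho / 2); first by rewrite divr_gt0.
move=> x xr; apply: isd_derivable.
have h := (isd_shift _ (- p) _ _).2 (kernel_isd2 rho0 cH xr).
by apply: isd_near h; near=> w; rewrite hd//; near: w; exact: near_ball_sub.
Unshelve. all: by end_near. Qed.

Lemma holo_dichotomy f p : holo_near f p ->
  (\forall w \near p, f w = 0) \/
  exists m g, [/\ holo_near g p, g p != 0 & \forall w \near p, f w = (w - p) ^+ m * g w].
Proof.
move=> /holo_rep [rho [H [rho0 cH hf]]].
have r20 : 0 < rho / 2 by rewrite divr_gt0.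
have r2 : rho / 2 < rho by rewrite ltr_pdivrMr// ltr_pMr// ltr1n.
have [h0|[N [H' [cH' h0 hN]]]] := kernel_dichotomy rho0 cH.
  by left; apply/cnbhsP; exists (rho / 2) => // w wr; rewrite (hf _ (lt_trans wr r2)).2 h0.
right; exists N, (fun w => cauchyI rho H' 1 (w - p)); split.
- apply/cnbhsP; exists (rho / 2) => // x xr.
  apply: (@isd_derivable _ _ _ (cauchyI rho H' 2 (x - p))).
  exact: (isd_shift _ (- p) _ _).2 (kernel_isd1 rho0 cH' xr).
- by rewrite subrr.
- by apply/cnbhsP; exists rho => // w wr; rewrite (hf _ wr).2 hN.
Qed.

End CauchyIntegrals.

(** * Level arcs at a point *)

Section Branches.
Context {R : realType}.
Implicit Types (a b w v p z : C R) (r s e : R).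

Lemma rnbhsP s (A : set R) :
  nbhs s A <-> exists2 r : R, 0 < r & forall x, `|x - s| < r -> A x.
Proof.
split=> [/nbhs_ballP[r r0 h]|[r r0 h]].
  by exists r => // x xs; apply: h; rewrite /ball /= distrC.
by apply/nbhs_ballP; exists r => // x; rewrite /ball /= distrC; exact: h.
Qed.

Lemma near_dist s d : 0 < d -> \forall x \near s, `|x - s| < d.
Proof. by move=> d0; apply/rnbhsP; exists d. Qed.

Lemma near_abs s d : `|s| < d -> \forall x \near s, `|x| < d.
Proof.
move=> sd; apply/rnbhsP; exists (d - `|s|); first by rewrite subr_gt0.
move=> x; rewrite ltrBrDr; apply: le_lt_trans.
by rewrite (le_trans _ (ler_normD _ _))// subrK.
Qed.

(** The roots are one root [a0] times the [n]-th roots of unity, distinct because [X^n - 1] is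
    separable in characteristic 0. The product formula later locates a root near an approximate
    solution. *)
Lemma nth_roots n (c : C R) : (0 < n)%N -> c != 0 -> exists r : seq (C R),
  [/\ size r = n, uniq r & forall u, u ^+ n - c = \prod_(a <- r) (u - a)].
Proof.
move=> n0 c0; pose a0 : C R := nthroot n (c : R[i]).
have a0n : a0 ^+ n = c by exact: rootCK.
have a00 : a0 != 0 by apply: contraNneq c0 => h; rewrite -a0n h expr0n gtn_eqF.
have [r hr] := closed_field_poly_normal ('X^n - 1 : {poly R[i]}).
have lc : lead_coef ('X^n - 1 : {poly R[i]}) = 1.
  by have := monicXnsubC (1 : R[i]) n0; rewrite polyC1 => /monicP.
rewrite lc scale1r in hr.
have ur : uniq r.
  by rewrite -separable_prod_XsubC -hr separable_Xn_sub_1// pnatr_eq0 -lt0n.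
have sr : size r = n.
  by apply: succn_inj; rewrite -(size_prod_XsubC r id) -hr size_XnsubC.
exists (map (fun z => a0 * z) r); split; first by rewrite size_map.
  by rewrite map_inj_uniq//; exact: mulfI.
move=> u; rewrite big_map.
have -> : \prod_(i <- r) (u - a0 * i) = \prod_(i <- r) (a0 * (u / a0 - i)).
  by apply: eq_bigr => i _; rewrite mulrBr mulrCA divff// mulr1.
rewrite big_split /= big_const_seq count_predT sr iter_mulr_1.
have key (v : R[i]) : \prod_(i <- r) (v - i) = v ^+ n - 1.
  have := congr1 (fun P => P.[v]) hr; rewrite !hornerE horner_prod => ->.
  by apply: eq_bigr => i _; rewrite !hornerE.
have -> : \prod_(i <- r) (u / a0 - i) = (u / a0) ^+ n - 1 by exact: key.
by rewrite expr_div_n a0n mulrBr mulr1 mulrCA divff ?mulr1.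
Qed.

Lemma compact_cball a e : compact [set v : C R | nm (v - a) <= e].
Proof.
apply: bounded_closed_compactC.
  exists (rc (`|e| + nm a)); split.
    by apply: ger0_real; rewrite (@ler0c R) addr_ge0 ?nm_ge0.
  move=> x /ltW xM v /= ve; apply: le_trans xM.
  by rewrite normE lecR -[v](subrK a) (le_trans (nmD _ _))// lerD2r (le_trans ve)// ler_norm.
rewrite (_ : [set v | _] = (fun v => nm (v - a)) @^-1` [set x | x <= e])//.
apply: closed_comp; last exact: closed_le.
move=> v _; apply: (@cvg_nm _ _ (nbhs v) _ (fun v => v - a)).
by apply: cvgB; [exact: cvg_id|exact: cvg_cst].
Qed.

(* Edelstein's argument: a point where |T v - v| is minimal is fixed. *)
Lemma contraction_fixpoint a e (T : C R -> C R) : 0 <= e ->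
  (forall v, nm (v - a) <= e -> nm (T v - a) <= e) ->
  (forall v v', nm (v - a) <= e -> nm (v' - a) <= e -> nm (T v - T v') <= nm (v - v') / 2) ->
  exists2 v, nm (v - a) <= e & T v = v.
Proof.
move=> e0 TK hT; pose K := [set v : C R | nm (v - a) <= e].
have cK : {within K, continuous (fun v => nm (T v - v))}.
  apply/subspace_continuousP => v Kv; apply/cvgrPdist_lt => d d0.
  rewrite near_withinE; near=> w => Kw; rewrite distrC (le_lt_trans (nm_dist _ _))//.
  have -> : T w - w - (T v - v) = (T w - T v) - (w - v) by ring.
  rewrite (le_lt_trans (nmD _ _))// nmN (le_lt_trans (lerD (hT _ _ Kw Kv) (lexx _)))//.
  have : nm (w - v) < d / 2 by near: w; apply: near_nm; rewrite divr_gt0.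
  have := nm_ge0 (w - v); lra.
have K0 : K !=set0 by exists a; rewrite /K /= subrr nm0.
have [v /set_mem Kv hv] := compact_EVT_min K0 (@compact_cball a e) cK.
have KTv := TK _ Kv; exists v => //.
have := hv _ (mem_set KTv); have := hT _ _ KTv Kv.
have := nm_ge0 (T v - v) => h1 h2 h3; apply/eqP; rewrite -subr_eq0 -nm_eq0; apply/eqP; lra.
Unshelve. all: by end_near. Qed.

(** The divided difference of the [n]-th power, that is the sum over [i < n] of
    [v ^+ i * v' ^+ (n - 1 - i)]; on the diagonal it is the derivative. *)
Fixpoint divdiff n (v v' : C R) : C R :=
  if n is m.+1 then v ^+ m + divdiff m v v' * v' else 0.

Lemma divdiffE n v v' : v ^+ n - v' ^+ n = (v - v') * divdiff n v v'.
Proof.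
elim: n => [|n IH] /=; first by rewrite subrr mulr0.
rewrite mulrDr mulrA -IH !exprSr; ring.
Qed.

Lemma divdiff_close n a d : 0 < d -> exists2 e, 0 < e & forall v v',
  nm (v - a) <= e -> nm (v' - a) <= e -> nm (divdiff n v v' - a ^+ n.-1 *+ n) <= d.
Proof.
move=> d0.
have c : divdiff n z.1 z.2 @[z --> (nbhs a, nbhs a)] --> a ^+ n.-1 *+ n.
  elim: n => [|n IH]; first by rewrite mulr0n; exact: cvg_cst.
  have -> : a ^+ n.+1.-1 *+ n.+1 = a ^+ n + a ^+ n.-1 *+ n * a.
    by rewrite mulrS mulrnAl; case: (n) => [|m]; rewrite ?mulr0n//= exprSr.
  have c2 : z.2 @[z --> (nbhs a, nbhs a)] --> a by exact: cvg_snd.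
  have c1 : z.1 ^+ n @[z --> (nbhs a, nbhs a)] --> a ^+ n.
    have c1 : z.1 @[z --> (nbhs a, nbhs a)] --> a by exact: cvg_fst.
    elim: {IH} n => [|n IH]; first exact: cvg_cst.
    by rewrite exprS; under eq_fun do rewrite exprS; exact: (cvgM c1 IH).
  exact: (cvgD c1 (cvgM IH c2)).
move: c => /ccvgP /(_ _ d0) [[A B] [/= /cnbhsP[r1 r10 h1] /cnbhsP[r2 r20 h2]] hAB].
exists (Num.min r1 r2 / 2); first by rewrite divr_gt0// lt_min r10.
have lt2 r x : 0 < r -> x <= Num.min r1 r2 / 2 -> Num.min r1 r2 <= r -> x < r.
  move=> r0 h h'; have : 0 < Num.min r1 r2 by rewrite lt_min r10.
  by move: h h'; lra.
move=> v v' hv hv'; apply: ltW; apply: (hAB (v, v')); split => /=.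
- by apply: h1; apply: lt2 hv _ => //; rewrite ge_min lexx.
- by apply: h2; apply: lt2 hv' _ => //; rewrite ge_min lexx orbT.
Qed.

Lemma small_scale (K d : R) : 0 <= K -> 0 < d ->
  exists2 s1, 0 < s1 & forall s, `|s| < s1 -> K * `|s| <= d.
Proof.
move=> K0 d0; have K1 : 0 < K + 1 by rewrite ltr_wpDl.
exists (d / (K + 1)); first by rewrite divr_gt0.
move=> s; rewrite ltr_pdivlMr// mulrC => /ltW; apply: le_trans.
by rewrite ler_wpM2r// lerDl.
Qed.

(** At [s = 0] the equation has the simple root [a]; for small [s], Newton's map with its slope
    frozen at [a] contracts a disc around [a]. The radius [e] is left to the caller, who has to
    separate the discs of different roots. *)
Lemma local_branch (g : C R -> C R) p n a b r M : (0 < n)%N -> 0 < r -> 0 <= M ->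
  (forall x y, nm (x - p) < r -> nm (y - p) < r -> nm (g x - g y) <= M * nm (x - y)) ->
  a ^+ n * g p = b -> b != 0 ->
  exists2 e1, 0 < e1 & forall e, 0 < e -> e <= e1 -> exists2 s1, 0 < s1 &
    exists u : R -> C R, forall s, `|s| < s1 ->
      [/\ nm (u s - a) <= e, u s ^+ n * g (p + rc s * u s) = b,
          (forall v, nm (v - a) <= e -> v ^+ n * g (p + rc s * v) = b -> v = u s) &
          u x @[x --> s] --> u s].
Proof.
move=> n0 r0 M0 lipg hab b0.
have a0 : a != 0 by apply: contraNneq b0 => ha; rewrite -hab ha expr0n gtn_eqF// mul0r.
have g0 : g p != 0 by apply: contraNneq b0 => h; rewrite -hab h mulr0.
pose L := a ^+ n.-1 *+ n; pose A := L * g p.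
have L0 : L != 0.
  by rewrite /L -mulr_natr mulf_neq0 ?expf_neq0// pnatr_eq0 -lt0n.
have A0 : A != 0 by rewrite mulf_neq0.
have nA0 : 0 < nm A by rewrite nm_gt0.
have ng0 : 0 < nm (g p) by rewrite nm_gt0.
have d20 : 0 < nm A / (8 * nm (g p)) by rewrite divr_gt0// mulr_gt0.
have [e2 e20 he2] := @divdiff_close n a _ d20.
exists (Num.min e2 1); first by rewrite lt_min e20 ltr01.
move=> e e0; rewrite le_min => /andP[ee2 e1].
pose m := nm a + 1; have m1 : 1 <= m by rewrite lerDr nm_ge0.
have m0 : 0 <= m := le_trans ler01 m1.
pose D := nm L + nm A / (8 * nm (g p)).
have D0 : 0 <= D by rewrite addr_ge0 ?nm_ge0// ltW.
have mM0 : 0 <= m ^+ n * M by rewrite mulr_ge0// exprn_ge0.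
(* [m] bounds [nm v] on the disc and [D] the divided difference. [s1] keeps [p + s v] where [g] is
   Lipschitz, [s2] and [s3] together with [e2] give the contraction factor 1/2, and [s4] makes [T]
   preserve the disc. *)
have [s1 s10 hs1] := small_scale m0 (divr_gt0 r0 (ltr0n _ 2)).
have [s2 s20 hs2] := small_scale (mulr_ge0 (mulr_ge0 D0 M0) m0) (divr_gt0 nA0 (ltr0n _ 8)).
have [s3 s30 hs3] := small_scale mM0 (divr_gt0 nA0 (ltr0n _ 4)).
have [s4 s40 hs4] := small_scale (mulr_ge0 mM0 m0) (divr_gt0 (mulr_gt0 nA0 e0) (ltr0n _ 2)).
pose sm := Num.min (Num.min s1 s2) (Num.min s3 s4).
have bnd v : nm (v - a) <= e -> nm v <= m.
  by move=> h; rewrite -[v](subrK a) (le_trans (nmD _ _))// addrC lerD2l (le_trans h).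
have in_r s v : `|s| < sm -> nm (v - a) <= e -> nm (p + rc s * v - p) < r.
  rewrite !lt_min => /andP[/andP[/hs1 h _] _] /bnd hv.
  rewrite addrC addKr nmM nm_rc mulrC.
  apply: (@le_lt_trans _ _ (r / 2)); last by rewrite ltr_pdivrMr// ltr_pMr// ltr1n.
  by apply: le_trans h; rewrite ler_wpM2r.
have glip s v v' : `|s| < sm -> nm (v - a) <= e -> nm (v' - a) <= e ->
    nm (g (p + rc s * v) - g (p + rc s * v')) <= M * (`|s| * nm (v - v')).
  move=> hs hv hv'; rewrite (le_trans (lipg _ _ (in_r _ _ hs hv) (in_r _ _ hs hv')))//.
  by rewrite opprD addrACA subrr add0r -mulrBr nmM nm_rc.
have glip0 s v : `|s| < sm -> nm (v - a) <= e ->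
    nm (g (p + rc s * v) - g p) <= M * (`|s| * m).
  move=> hs hv; rewrite (le_trans (lipg _ _ (in_r _ _ hs hv) _)) ?subrr ?nm0//.
  by rewrite addrC addKr nmM nm_rc ler_wpM2l// ler_wpM2l// bnd.
pose T s v := v - (v ^+ n * g (p + rc s * v) - b) / A.
have a_in : nm (a - a) <= e by rewrite subrr nm0 ltW.
have vn v : nm (v - a) <= e -> nm (v ^+ n) <= m ^+ n.
  by move=> /bnd h; rewrite nmX lerXn2r ?nnegrE ?nm_ge0.
have T_lip s v v' : `|s| < sm -> nm (v - a) <= e -> nm (v' - a) <= e ->
    nm (T s v - T s v') <= nm (v - v') / 2.
  move=> hs hv hv'.
  set P := divdiff n v v'; set gv := g (p + rc s * v); set gv' := g (p + rc s * v').
  have -> : T s v - T s v' = ((v - v') * (A - P * gv) - v' ^+ n * (gv - gv')) / A.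
    rewrite /T -/gv -/gv'.
    have -> : v ^+ n = v' ^+ n + (v - v') * P by rewrite -divdiffE addrC subrK.
    by field.
  rewrite nmf ler_pdivrMr// (le_trans (nmD _ _))// nmN (nmM (v - v')) (nmM (v' ^+ n)).
  have h1 : nm (A - P * gv) <= nm A / 4.
    have hP : nm (P - L) <= nm A / (8 * nm (g p)).
      by apply: he2; rewrite (le_trans _ ee2).
    have nP : nm P <= D.
      by rewrite -[P](subrK L) (le_trans (nmD _ _))// addrC lerD2l.
    have -> : A - P * gv = - ((P - L) * g p) - P * (gv - g p) by rewrite /A; ring.
    rewrite (le_trans (nmD _ _))// !nmN (nmM (P - L)) (nmM P).
    have q1 : nm (P - L) * nm (g p) <= nm A / 8.
      apply: le_trans (ler_wpM2r (nm_ge0 _) hP) _.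
      by rewrite le_eqVlt; apply/orP; left; apply/eqP; field; rewrite gt_eqF.
    have q2 : nm P * nm (gv - g p) <= nm A / 8.
      move: (hs); rewrite !lt_min => /andP[/andP[_ /hs2 h] _]; apply: le_trans h.
      have -> : D * M * m * `|s| = D * (M * (`|s| * m)) by ring.
      by rewrite ler_pM ?nm_ge0// glip0.
    by move: q1 q2; clear; lra.
  have h2 : nm (v' ^+ n) * nm (gv - gv') <= nm A / 4 * nm (v - v').
    move: (hs); rewrite !lt_min => /andP[_ /andP[/hs3 h _]].
    apply: le_trans (ler_wpM2r (nm_ge0 _) h); rewrite -!mulrA.
    by rewrite ler_pM ?nm_ge0// ?vn// glip.
  by have h3 := ler_wpM2l (nm_ge0 (v - v')) h1; move: h2 h3; clear; lra.
have T_a s : `|s| < sm -> nm (T s a - a) <= e / 2.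
  move=> hs; have -> : T s a - a = - (a ^+ n * (g (p + rc s * a) - g p) / A).
    by rewrite /T mulrBr hab; ring.
  rewrite nmN nmf nmM ler_pdivrMr//.
  move: (hs); rewrite !lt_min => /andP[_ /andP[_ /hs4 h]].
  apply: le_trans (_ : nm A * e / 2 <= _); last by rewrite le_eqVlt; apply/orP; left; apply/eqP; ring.
  apply: le_trans h; rewrite -!mulrA [m * _]mulrC.
  by rewrite ler_pM ?nm_ge0// ?vn// glip0.
have T_in s v : `|s| < sm -> nm (v - a) <= e -> nm (T s v - a) <= e.
  move=> hs hv; rewrite (le_trans (nm_triB _ (T s a) _))//.
  by have := T_lip _ _ _ hs hv a_in; have := T_a _ hs; move: hv; clear; lra.
have T_fix s v : (T s v = v) <-> (v ^+ n * g (p + rc s * v) = b).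
  split=> [h|h]; last by rewrite /T h subrr mul0r subr0.
  apply/eqP; rewrite -subr_eq0.
  have : (v ^+ n * g (p + rc s * v) - b) / A = 0.
    by transitivity (v - T s v); [rewrite /T opprB [RHS]addrC subrK|rewrite h subrr].
  by move=> /(congr1 (fun x => x * A)); rewrite divfK// mul0r => ->.
have uniq_fix s v v' : `|s| < sm -> nm (v - a) <= e -> nm (v' - a) <= e ->
    T s v = v -> T s v' = v' -> v = v'.
  move=> hs hv hv' h h'; have := T_lip _ _ _ hs hv hv'; rewrite h h' => h2.
  by apply/eqP; rewrite -subr_eq0 -nm_eq0; apply/eqP; by have := nm_ge0 (v - v'); move: h2; clear; lra.
have ex_fix s : `|s| < sm -> exists2 v, nm (v - a) <= e & T s v = v.
  move=> hs; apply: contraction_fixpoint; first exact: ltW.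
  - by move=> v; exact: T_in.
  - by move=> v v'; exact: T_lip.
have sm0 : 0 < sm by rewrite !lt_min s10 s20 s30 s40.
exists sm => //.
have /choice[u hu] : forall s, exists v, `|s| < sm -> nm (v - a) <= e /\ T s v = v.
  move=> s; case: (pselect (`|s| < sm)) => [hs|]; last by exists 0.
  by have [v h1 h2] := ex_fix _ hs; exists v.
exists u => s hs; have [us fs] := hu _ hs; split => //.
- exact/T_fix.
- by move=> v hv /T_fix h; apply: uniq_fix hs _ _ _ _.
apply/ccvgP => d d0.
(* Fixed points at [x] and [s] are compared through [T x (u s)]: the contraction costs half of
   [nm (u x - u s)], and [T] varies with its parameter at rate at most [Q / 2]. *)
pose Q := 2 * (m ^+ n * M * m / nm A).
have Q0 : 0 <= Q by rewrite !mulr_ge0 ?invr_ge0 ?nm_ge0 ?exprn_ge0.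
near=> x.
have hx : `|x| < sm.
  near: x; exact: near_abs.
have [ux fx] := hu _ hx.
have e3 : nm (T x (u s) - T s (u s)) <= Q / 2 * `|x - s|.
  have -> : T x (u s) - T s (u s) = - (u s ^+ n * (g (p + rc x * u s) - g (p + rc s * u s)) / A).
    by rewrite /T; ring.
  rewrite nmN nmf nmM ler_pdivrMr//.
  apply: (@le_trans _ _ (m ^+ n * (M * (`|x - s| * m)))).
    rewrite ler_pM ?nm_ge0// ?vn// (le_trans (lipg _ _ (in_r _ _ hx us) (in_r _ _ hs us)))//.
    by rewrite opprD addrACA subrr add0r -mulrBl -rcB nmM nm_rc ler_wpM2l// ler_wpM2l// bnd.
  by rewrite /Q le_eqVlt; apply/orP; left; apply/eqP; field; rewrite gt_eqF.
have e4 : nm (u x - u s) <= Q * `|x - s|.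
  have h := nm_triB (u x) (T x (u s)) (u s).
  have h1 := T_lip x (u x) (u s) hx ux us; rewrite fx in h1.
  by rewrite fs in e3 h; move: h h1 e3; clear; lra.
apply: le_lt_trans e4 _.
have : `|x - s| < d / (Q + 1).
  by near: x; apply: near_dist; rewrite divr_gt0// ltr_wpDl.
have Q1 : 0 < Q + 1 by rewrite ltr_wpDl.
rewrite ltr_pdivlMr// => h; apply: le_lt_trans h; rewrite mulrC ler_wpM2l// lerDl.
Unshelve. all: by end_near. Qed.

End Branches.

(** * The level set near one of its points *)

Section LocalLevelSet.
Context {R : realType}.
Implicit Types (a b c w v p z : C R) (r s e : R).

Lemma reC_div v w : reC (v / w) = (reC v * reC w + imC v * imC w) / nm w ^+ 2.
Proof.
rewrite nm_sqr reM.
have -> : reC w^-1 = reC w / (reC w ^+ 2 + imC w ^+ 2) by case: w.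
have -> : imC w^-1 = - (imC w / (reC w ^+ 2 + imC w ^+ 2)) by case: w.
ring.
Qed.

(* Maps the circle |w| = |c| to the imaginary axis; the junk value at w = - c
   is excluded by side conditions w + c != 0. *)
Definition cayley c w := (w - c) / (w + c).

(** The real part of [(w - c) / (w + c)] has numerator [nm w ^+ 2 - nm c ^+ 2]. *)
Lemma cayley_circle c w : w + c != 0 -> (nm w = nm c) <-> (reC (cayley c w) = 0).
Proof.
move=> wc0; rewrite /cayley reC_div.
have -> : reC (w - c) * reC (w + c) + imC (w - c) * imC (w + c) = nm w ^+ 2 - nm c ^+ 2.
  by rewrite !nm_sqr reB reD imB imD; ring.
split=> [->|/eqP]; first by rewrite subrr mul0r.
rewrite mulf_eq0 invr_eq0 expf_eq0 /= nm_eq0 (negbTE wc0) orbF subr_eq0.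
by rewrite eqrXn2 ?nm_ge0// => /eqP.
Qed.

Lemma cayleyK c w : w + c != 0 -> w * (1 - cayley c w) = c * (1 + cayley c w).
Proof. by move=> h; rewrite /cayley; field. Qed.

Lemma cayley_inj c w v : c != 0 -> w + c != 0 -> v + c != 0 ->
  cayley c w = cayley c v -> w = v.
Proof.
move=> c0 wc vc h.
have h1 := cayleyK wc; have h2 := cayleyK vc; rewrite h in h1.
have q1 : 1 - cayley c v != 0.
  rewrite (_ : 1 - _ = 2 * c / (v + c)); last by rewrite /cayley; field.
  by rewrite !mulf_neq0 ?invr_eq0// pnatr_eq0.
by apply: (mulIf q1); rewrite h1 h2.
Qed.

Lemma fin_min_pos (I : finType) (e : I -> R) : (forall i, 0 < e i) ->
  exists2 e0, 0 < e0 & forall i, e0 <= e i.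
Proof.
move=> he; exists (\big[Order.min/1]_i e i).
  by apply: lt_bigmin => // i _.
by move=> i; exact: bigmin_le_cond.
Qed.

(** Used backwards: a product below [e ^+ size rs] puts [v] within [e] of some root. *)
Lemma prod_sub_ge (rs : seq (C R)) v e : 0 <= e ->
  (forall a, a \in rs -> e <= nm (v - a)) ->
  e ^+ size rs <= nm (\prod_(a <- rs) (v - a)).
Proof.
move=> e0; elim: rs => [|a rs IH] h; first by rewrite big_nil nm1.
rewrite big_cons nmM exprS ler_pM ?exprn_ge0//; first by rewrite h ?inE ?eqxx.
by apply: IH => x xr; apply: h; rewrite inE xr orbT.
Qed.

(** [true] marks the arcs on which the argument of [f] grows away from the point, [false] those on
    which it decreases. *)
Definition signed_i (j : bool) : C R := if j then iC else - iC.

Lemma nm_signed_i j : nm (signed_i j) = 1.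
Proof. by case: j; rewrite /signed_i ?nmN nm_iC. Qed.

Lemma cvg_eps (f : C R -> C R) p (l : C R) e : f w @[w --> p] --> l -> 0 < e ->
  exists2 r, 0 < r & forall w, nm (w - p) < r -> nm (f w - l) < e.
Proof. by move=> /ccvgP h /h /cnbhsP. Qed.

Lemma cvgXn {T} (F : set_system T) {FF : Filter F} (h : T -> C R) (l : C R) n :
  h @ F --> l -> h x ^+ n @[x --> F] --> l ^+ n.
Proof.
move=> hl; elim: n => [|n IH]; first exact: cvg_cst.
by rewrite exprS; under eq_fun do rewrite exprS; exact: (cvgM hl IH).
Qed.

Lemma derivable_div (g h : C R -> C R) w : derivable g w 1 -> derivable h w 1 ->
  h w != 0 -> derivable (fun x => g x * (h x)^-1) w 1.
Proof. by move=> dg dh h0; exact: (derivableM dg (derivableV h0 dh)). Qed.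

Lemma derivable_addc (f : C R -> C R) c w :
  derivable f w 1 -> derivable (fun x => f x + c) w 1.
Proof. by move=> df; exact: (derivableD df (@derivable_cst _ _ _ c w 1)). Qed.

(** With [g1 = g / (f + f p)] the Cayley transform of [f] is [(w - p) ^+ n * g1 w], so
    [local_branch] applies to [g1] at each of the [n] roots, for either sign. Negative [s] are
    included: for [n = 1] a single arc then covers both sides of [p]. *)
Lemma local_level_set (f g : C R -> C R) p n rho : (0 < n)%N -> 0 < rho ->
  f p != 0 -> holo_near f p -> holo_near g p -> g p != 0 ->
  (\forall w \near p, f w - f p = (w - p) ^+ n * g w) ->
  exists s0 r (A : bool -> 'I_n -> R -> C R), [/\ 0 < s0, 0 < r, r <= rho &
   [/\ forall j k s, `|s| < s0 -> [/\ A j k x @[x --> s] --> A j k s,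
        nm (A j k s - p) < rho, f (A j k s) + f p != 0 &
        cayley (f p) (f (A j k s)) = signed_i j * rc s ^+ n],
      forall j k, A j k 0 = p,
      forall j k k' s, `|s| < s0 -> s != 0 -> A j k s = A j k' s -> k = k',
      forall w j s, nm (w - p) < r -> s != 0 ->
        cayley (f p) (f w) = signed_i j * rc s ^+ n ->
        `|s| < s0 /\ exists k, w = A j k s &
      forall w, nm (w - p) < r -> [/\ derivable f w 1, f w + f p != 0,
        nm (cayley (f p) (f w)) < s0 ^+ n & w != p -> cayley (f p) (f w) != 0]]].
Proof.
move=> n0 rho0 fp0 hf hg gp0 hfg.
pose c := f p; have c0 : c + c != 0.
  by rewrite -mulr2n -mulr_natr mulf_neq0// pnatr_eq0.
have cf : f w @[w --> p] --> c by apply: derivable_cont; exact: nbhs_singleton hf.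
have near_fc : \forall w \near p, f w + c != 0.
  have : f w + c @[w --> p] --> c + c by apply: (cvgD cf); exact: cvg_cst.
  move=> /ccvgP /(_ (nm (c + c))); rewrite nm_gt0 => /(_ c0); apply: filterS => w.
  by apply: contraTneq => ->; rewrite sub0r nmN ltxx.
pose g1 w := g w * (f w + c)^-1.
have hg1 : holo_near g1 p.
  apply: filterS3 hg hf near_fc => w dg df fc.
  exact: derivable_div dg (@derivable_addc f c w df) fc.
have g1p0 : g1 p != 0 by rewrite mulf_neq0// invr_eq0.
have cg1 : g1 w @[w --> p] --> g1 p by apply: derivable_cont; exact: nbhs_singleton hg1.
have near_g1 : \forall w \near p, g1 w != 0.
  move: cg1 => /ccvgP /(_ (nm (g1 p))); rewrite nm_gt0 => /(_ g1p0); apply: filterS => w.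
  by apply: contraTneq => ->; rewrite sub0r nmN ltxx.
have /cnbhsP[r1 r10 hr1] : \forall w \near p, [/\ derivable f w 1, f w + c != 0,
    f w - f p = (w - p) ^+ n * g w & g1 w != 0].
  apply: filterS2 (filterI hf near_fc) (filterI hfg near_g1).
  by move=> w [? ?] [? ?].
have [r2 r20 [M lipM]] := holo_lip hg1.
have {}lipM x y : nm (x - p) < r2 -> nm (y - p) < r2 -> nm (g1 x - g1 y) <= `|M| * nm (x - y).
  move=> hx hy; apply: le_trans (lipM _ _ hx hy) _.
  by rewrite ler_wpM2r ?nm_ge0// ler_norm.
have cay w : nm (w - p) < r1 -> cayley c (f w) = (w - p) ^+ n * g1 w.
  by move=> /hr1[_ _ e _]; rewrite /cayley e mulrA.
have sj0 j : signed_i j != 0 :> C R by rewrite -nm_gt0 nm_signed_i.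
have /choice[rs hrs] : forall j, exists rs : seq (C R), [/\ size rs = n, uniq rs &
    forall u, u ^+ n - signed_i j / g1 p = \prod_(a <- rs) (u - a)].
  by move=> j; apply: nth_roots => //; rewrite mulf_neq0// invr_eq0.
pose a (jk : bool * 'I_n) := nth 0 (rs jk.1) jk.2.
have ars jk : a jk \in rs jk.1.
  by rewrite mem_nth//; have [-> _ _] := hrs jk.1.
have an jk : a jk ^+ n * g1 p = signed_i jk.1.
  have [_ _ /(_ (a jk))] := hrs jk.1; rewrite (big_rem _ (ars jk)) /= subrr mul0r.
  by move=> /eqP; rewrite subr_eq0 => /eqP ->; rewrite divfK.
have M0 : 0 <= `|M| by [].
have /choice[e1 he1] : forall jk, exists e1, 0 < e1 /\ forall e, 0 < e -> e <= e1 ->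
    exists2 s1, 0 < s1 & exists u : R -> C R, forall s, `|s| < s1 ->
      [/\ nm (u s - a jk) <= e, u s ^+ n * g1 (p + rc s * u s) = signed_i jk.1,
          (forall v, nm (v - a jk) <= e -> v ^+ n * g1 (p + rc s * v) = signed_i jk.1 -> v = u s) &
          u x @[x --> s] --> u s].
  move=> jk; have [e1 e10 h] := local_branch n0 r20 M0 lipM (an jk) (sj0 _).
  by exists e1.
have [e2 e20 he2] := fin_min_pos (fun jk => (he1 jk).1).
(* A third of the gap between two roots makes the discs of radius [e] around them disjoint; the
   value 1 on the diagonal is a dummy. *)
pose sep (x : (bool * 'I_n) * 'I_n) :=
  if x.1.2 == x.2 then 1 else nm (a x.1 - a (x.1.1, x.2)) / 3.
have sep0 x : 0 < sep x.
  rewrite /sep; case: eqVneq => // hx; rewrite divr_gt0// nm_gt0 subr_eq0 /a /=.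
  have [sz un _] := hrs x.1.1.
  by rewrite nth_uniq ?sz.
have [e3 e30 he3] := fin_min_pos sep0.
pose e := Num.min e2 e3; have e0 : 0 < e by rewrite lt_min e20.
have /choice[s1u hs1u] : forall jk, exists su : R * (R -> C R), 0 < su.1 /\
    forall s, `|s| < su.1 ->
      [/\ nm (su.2 s - a jk) <= e, su.2 s ^+ n * g1 (p + rc s * su.2 s) = signed_i jk.1,
          (forall v, nm (v - a jk) <= e -> v ^+ n * g1 (p + rc s * v) = signed_i jk.1 -> v = su.2 s) &
          su.2 x @[x --> s] --> su.2 s].
  move=> jk; have [s1 s10 [u hu]] := (he1 jk).2 e e0 ltac:(by rewrite ge_min he2).
  by exists (s1, u).
have [s1 s10 hs1] := fin_min_pos (fun jk => (hs1u jk).1).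
pose rm := Num.min rho r1; have rm0 : 0 < rm by rewrite lt_min rho0.
have /choice[s2 hs2] : forall jk, exists s2, 0 < s2 /\ forall s, `|s| < s2 ->
    (nm (a jk) + e) * `|s| <= rm / 2.
  move=> jk; have [||s2 s20 h] := @small_scale _ (nm (a jk) + e) (rm / 2); last by exists s2.
  - by rewrite addr_ge0 ?nm_ge0// ltW.
  - by rewrite divr_gt0.
have [s3 s30 hs3] := fin_min_pos (fun jk => (hs2 jk).1).
pose s0 := Num.min s1 s3; have s00 : 0 < s0 by rewrite lt_min s10.
pose A j k s := p + rc s * (s1u (j, k)).2 s.
have inA j k s : `|s| < s0 -> nm (A j k s - p) < rm.
  rewrite lt_min => /andP[ss1 ss3]; rewrite /A addrC addKr nmM nm_rc.
  have [h _ _ _] := (hs1u (j, k)).2 _ (lt_le_trans ss1 (hs1 _)).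
  apply: (@le_lt_trans _ _ (rm / 2)); last by rewrite ltr_pdivrMr// ltr_pMr// ltr1n.
  apply: le_trans ((hs2 (j, k)).2 _ (lt_le_trans ss3 (hs3 _))); rewrite mulrC ler_wpM2r//.
  by rewrite -[X in nm X](subrK (a (j, k))) (le_trans (nmD _ _))// addrC lerD2l.
have cayA j k s : `|s| < s0 -> cayley c (f (A j k s)) = signed_i j * rc s ^+ n.
  move=> ss0; rewrite cay; last by rewrite (lt_le_trans (inA _ _ _ ss0))// ge_min lexx orbT.
  move: ss0; rewrite lt_min => /andP[ss1 ss3].
  have [_ h _ _] := (hs1u (j, k)).2 _ (lt_le_trans ss1 (hs1 _)).
  have -> : A j k s - p = rc s * (s1u (j, k)).2 s by rewrite /A addrC addKr.
  by rewrite exprMn -mulrA h mulrC.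
have cay_cvg : (w - p) ^+ n * g1 w @[w --> p] --> (0 : C R).
  have -> : 0 = (p - p) ^+ n * g1 p by rewrite subrr expr0n gtn_eqF// mul0r.
  have cX : (w - p) ^+ n @[w --> p] --> (p - p) ^+ n.
    have c1 : w - p @[w --> p] --> p - p by exact: (cvgB cvg_id (cvg_cst p)).
    exact: cvgXn c1.
  exact: (cvgM cX cg1).
have sn0 : 0 < s0 ^+ n by rewrite exprn_gt0.
have en0 : 0 < e ^+ n by rewrite exprn_gt0.
have [r3 r30 hr3] := cvg_eps cay_cvg sn0.
have inv_cvg : (g1 w)^-1 @[w --> p] --> (g1 p)^-1 by exact: (cvgV g1p0 cg1).
have [r4 r40 hr4] := cvg_eps inv_cvg en0.
(* [r1] keeps the factorization valid, [r3] makes the Cayley transform smaller than [s0 ^+ n],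
   whence [|s| < s0], and [r4] brings [1 / g1 w] within [e ^+ n] of [1 / g1 p]. *)
pose r := Num.min (Num.min rho r1) (Num.min r3 r4).
have r0 : 0 < r by rewrite !lt_min rho0 r10 r30.
exists s0, r, A; split; [exact: s00|exact: r0|by rewrite !ge_min lexx|].
split.
- move=> j k s /[dup] ss0; rewrite lt_min => /andP[ss1 ss3].
  have [_ _ _ cu] := (hs1u (j, k)).2 _ (lt_le_trans ss1 (hs1 _)).
  split.
  + exact: (cvgD (cvg_cst p) (cvgM (cvg_rc cvg_id) cu)).
  + by rewrite (lt_le_trans (inA _ _ _ ss0))// ge_min lexx.
  + have /hr1[] // : nm (A j k s - p) < r1.
    by rewrite (lt_le_trans (inA _ _ _ ss0))// ge_min lexx orbT.
  + exact: cayA.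
- by move=> j k; rewrite /A mul0r addr0.
- move=> j k k' s /[dup] ss0; rewrite lt_min => /andP[ss1 ss3] s_neq0.
  rewrite /A => /addrI /(mulfI _) h; have {}h := h ltac:(by rewrite rc_eq0).
  have [h1 _ _ _] := (hs1u (j, k)).2 _ (lt_le_trans ss1 (hs1 _)).
  have [h2 _ _ _] := (hs1u (j, k')).2 _ (lt_le_trans ss1 (hs1 _)).
  rewrite h nmB in h1; have := le_trans (nm_triB _ _ _) (lerD h1 h2).
  move=> {}h; apply/eqP/negPn/negP => kk'.
  have := he3 ((j, k), k'); rewrite /sep /= (negbTE kk').
  have : e <= e3 by rewrite ge_min lexx orbT.
  by have := e0; move: h; clear; lra.
- move=> w j s wr s_neq0.
  have [wr1 wr3 wr4] : [/\ nm (w - p) < r1, nm (w - p) < r3 & nm (w - p) < r4].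
    by move: wr; rewrite /r !lt_min => /andP[/andP[_ ->] /andP[-> ->]].
  rewrite cay// => hw.
  have ss0 : `|s| < s0.
    have := hr3 _ wr3; rewrite subr0 hw nmM nm_signed_i mul1r nmX nm_rc.
    by rewrite ltr_pXn2r ?nnegrE// ltW.
  have ss1 : `|s| < s1 by move: ss0; rewrite lt_min => /andP[].
  split; first exact: ss0.
  have rs0 : rc s != 0 by rewrite rc_eq0.
  pose v := (w - p) / rc s.
  have vn : v ^+ n * g1 w = signed_i j.
    by rewrite expr_div_n mulrAC hw mulfK// expf_neq0.
  have [_ _ _ g1w] := hr1 _ wr1.
  have [sz un hprod] := hrs j.
  (* Since [v ^+ n] is [+-i / g1 w], the product of the distances from [v] to the roots is below
     [e ^+ n], so one of them is below [e]. *)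
  have [k hk] : exists k : 'I_n, nm (v - a (j, k)) < e.
    apply: contrapT => hn.
    have := prod_sub_ge (ltW e0) (v := v) (rs := rs j); rewrite sz -hprod.
    have -> : v ^+ n = signed_i j / g1 w by rewrite -vn mulfK.
    rewrite -mulrBr nmM nm_signed_i mul1r.
    have h4 := hr4 _ wr4 => h5; have : e ^+ n < e ^+ n; last by rewrite ltxx.
    apply: le_lt_trans (h5 _) h4 => x xr.
    have hi : (index x (rs j) < n)%N by rewrite -sz index_mem.
    rewrite -(nth_index 0 xr).
    rewrite leNgt; apply/negP => hlt; by apply: hn; exists (Ordinal hi).
  exists k; rewrite /A.
  have [_ _ hu _] := (hs1u (j, k)).2 _ (lt_le_trans ss1 (hs1 _)).
  have wE : w = p + rc s * v by rewrite /v mulrCA divff// mulr1 addrC subrK.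
  by rewrite -(hu v) //; [exact: ltW|rewrite -wE].
- move=> w wr.
  have [wr1 wr3] : nm (w - p) < r1 /\ nm (w - p) < r3.
    by move: wr; rewrite /r !lt_min => /andP[/andP[_ ->] /andP[-> _]].
  have [h1 h2 h3 h4] := hr1 _ wr1; split; [exact: h1|exact: h2| |].
  + by have := hr3 _ wr3; rewrite subr0 cay.
  + by move=> wp; rewrite cay// mulf_neq0// expf_neq0// subr_eq0.
Qed.

End LocalLevelSet.

(** * Connectedness, cluster points and orders of zeros *)

Section Topology.
Context {R : realType}.
Implicit Types (w v p z : C R) (r s e t : R).

(** Connectedness of an interval in the form of an induction principle, with [P] and its negation
    both relatively open; continuation arguments below use this form. *)
Lemma interval_ind (I : set R) (P : R -> Prop) t0 : is_interval I ->
  (forall t, I t -> P t -> exists2 d, 0 < d & forall x, I x -> `|x - t| < d -> P x) ->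
  (forall t, I t -> ~ P t -> exists2 d, 0 < d & forall x, I x -> `|x - t| < d -> ~ P x) ->
  I t0 -> P t0 -> forall t, I t -> P t.
Proof.
move=> itvI oP oN It0 Pt0.
have /connected_intervalP cI := itvI.
(* [U Q] is open in [R] and has the same trace on [I] as [Q] when [Q] is relatively open. *)
pose U (Q : R -> Prop) : set R := [set t | nbhs t (fun x => I x -> Q x)].
have oU Q : open (U Q) by exact: open_interior.
have UE Q : (forall t, I t -> Q t -> exists2 d, 0 < d & forall x, I x -> `|x - t| < d -> Q x) ->
    I `&` Q = I `&` U Q.
  move=> hQ; apply/seteqP; split=> t [It h]; split => //.
    have [d d0 hd] := hQ t It h; apply/rnbhsP; exists d => // x xt Ix; exact: hd.
  exact: (nbhs_singleton h It).
have := cI (I `&` P); rewrite (UE P oP) => h.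
have E : I `&` U P = I.
  apply: h.
  - by exists t0; rewrite -UE.
  - by exists (U P).
  exists (~` U (fun t => ~ P t)); first exact: open_closedC.
  rewrite -UE//; apply/seteqP; split=> t [It Pt]; split => //.
    by move=> /nbhs_singleton /(_ It).
  by apply: contrapT => nP; apply: Pt; have [] : (I `&` U (fun t => ~ P t)) t by rewrite -(UE _ oN).
by move=> t It; have [] : (I `&` P) t by rewrite (UE P oP) E.
Qed.

Lemma itvoo_interval (a b : R) : is_interval [set t | a < t < b].
Proof.
move=> x y /= /andP[ax xb] /andP[ay yb] c /andP[xc cy].
by rewrite (lt_le_trans ax xc) (le_lt_trans cy yb).
Qed.

Lemma compact_cluster (L : set (C R)) (u : nat -> C R) : compact L -> (forall n, L (u n)) ->
  exists2 v, L v & forall r N, 0 < r -> exists2 n, (N <= n)%N & nm (u n - v) < r.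
Proof.
move=> cL Lu; have [|v [Lv cv]] := cL (u @ \oo) _.
  by exists 0%N => // n _; exact: Lu.
exists v => // r N r0.
have /(_ [set u n | n in [set n | (N <= n)%N]] [set w | nm (w - v) < r]) := cv.
case.
- by exists N => // n /= Nn; exists n.
- exact: near_nm.
by move=> _ [[n /= Nn <-] h]; exists n.
Qed.

Lemma nonzero_near (g : C R -> C R) p : g w @[w --> p] --> g p -> g p != 0 ->
  \forall w \near p, g w != 0.
Proof.
move=> cg g0; have [r r0 hr] : exists2 r, 0 < r & forall w, nm (w - p) < r -> nm (g w - g p) < nm (g p).
  by apply: cvg_eps cg _; rewrite nm_gt0.
apply/cnbhsP; exists r => // w /hr.
by apply: contraTneq => ->; rewrite sub0r nmN ltxx.
Qed.

Lemma holo_near_cvg (g : C R -> C R) p : holo_near g p -> g w @[w --> p] --> g p.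
Proof. by move=> /nbhs_singleton /derivable_cont. Qed.

(** If [m < m'], cancelling [(w - p) ^+ m] off [p] gives [g = (w - p) ^+ (m' - m) * g'], so [g]
    would tend to 0 at [p]. *)
Lemma zero_of_order_le (h : C R -> C R) p m m' :
  zero_of_order m h p -> zero_of_order m' h p -> (m' <= m)%N.
Proof.
move=> [g [hg g0 /cnbhsP[r1 r10 h1]]] [g' [hg' g'0 /cnbhsP[r2 r20 h2]]].
rewrite leqNgt; apply/negP => mm'.
have cg := holo_near_cvg hg.
have cg' : (w - p) ^+ (m' - m) * g' w @[w --> p] --> (0 : C R).
  have -> : 0 = (p - p) ^+ (m' - m) * g' p.
    by rewrite subrr expr0n subn_eq0 leqNgt mm' mul0r.
  have cX : (w - p) ^+ (m' - m) @[w --> p] --> (p - p) ^+ (m' - m).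
    have c1 : w - p @[w --> p] --> p - p by exact: (cvgB cvg_id (cvg_cst p)).
    exact: cvgXn c1.
  exact: (cvgM cX (holo_near_cvg hg')).
have e0 : 0 < nm (g p) / 2 by rewrite divr_gt0// nm_gt0.
have [r3 r30 h3] := cvg_eps cg e0.
have [r4 r40 h4] := cvg_eps cg' e0.
pose r := Num.min (Num.min r1 r2) (Num.min r3 r4) / 2.
have m0 : 0 < Num.min (Num.min r1 r2) (Num.min r3 r4) by rewrite !lt_min r10 r20 r30.
have r0 : 0 < r by rewrite divr_gt0.
have : r < Num.min (Num.min r1 r2) (Num.min r3 r4) by rewrite ltr_pdivrMr// ltr_pMr// ltr1n.
rewrite !lt_min => /andP[/andP[rr1 rr2] /andP[rr3 rr4]].
pose w := p + rc r.
have wp : w - p = rc r by rewrite /w addrC addKr.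
have nwp : nm (w - p) = r by rewrite wp nm_rc gtr0_norm.
have wp0 : (w - p) ^+ m != 0 by rewrite expf_neq0// wp rc_eq0 gt_eqF.
have E : g w = (w - p) ^+ (m' - m) * g' w.
  apply: (mulfI wp0); rewrite mulrA -exprD subnKC ?(ltnW mm')//.
  by rewrite -h1 ?nwp// -h2 ?nwp.
have := h3 w; have := h4 w; rewrite nwp -E subr0 => /(_ rr4) h5 /(_ rr3) h6.
have := nm_triB (g p) (g w) 0; rewrite !subr0 nmB.
by move: h5 h6; clear; lra.
Qed.

Lemma mult_eq (f : C R -> C R) p m : zero_of_order m (derive1 f) p -> mult f p = m.
Proof.
move=> hm; rewrite /mult; case: xgetP => [k _ hk|/(_ m)//].
by apply/eqP; rewrite eqn_leq (zero_of_order_le hm hk) (zero_of_order_le hk hm).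
Qed.

Lemma isd_addc (f : C R -> C R) c w d : isd f w d -> isd (fun x => f x + c) w d.
Proof.
move=> h e e0; have [r r0 hr] := h e e0; exists r => // x xr.
by rewrite opprD addrACA subrr addr0; exact: hr.
Qed.

Lemma isd_sub p w : isd (fun x => x - p) w 1.
Proof.
by apply: isd_addc => e e0; exists 1 => // x _; rewrite mul1r subrr nm0 mulr_ge0 ?nm_ge0// ltW.
Qed.

Lemma isd_subX p n w : isd (fun x => (x - p) ^+ n.+1) w (n.+1%:R * (w - p) ^+ n).
Proof.
have d0 := isd_sub p w.
elim: n => [|n IH]; first by rewrite expr0 mulr1.
have d1 := isd_is_derive IH; have d2 := isd_is_derive d0.
have [d3 d4] := is_deriveM d2 d1.
have := derivable_isd d3; rewrite derive1E d4.
have -> : ((fun x : C R => x - p) * (fun x => (x - p) ^+ n.+1))%R = (fun x => (x - p) ^+ n.+2).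
  by apply/funext => x; rewrite /= exprS.
have -> // : (w - p) *: (n.+1%:R * (w - p) ^+ n) + (w - p) ^+ n.+1 *: (1 : C R) = n.+2%:R * (w - p) ^+ n.+1.
rewrite /GRing.scale /= exprS mulr1 -[n.+2]addn1 natrD; ring.
Qed.

(** By the product rule [f'] is [(w - p) ^+ n.-1] times [n * g + (w - p) * g'], whose value
    [n * g p] at [p] is nonzero in characteristic 0. *)
Lemma order_derive (f g : C R -> C R) p n : (0 < n)%N -> holo_near f p -> holo_near g p ->
  g p != 0 -> (\forall w \near p, f w - f p = (w - p) ^+ n * g w) ->
  zero_of_order n.-1 (derive1 f) p.
Proof.
move=> n0 hf hg g0 hfg; case: n n0 hfg => // n _ hfg /=.
have hg' := holo_derive hg.
exists (fun w => n.+1%:R * g w + (w - p) * derive1 g w); split.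
- apply: filterS2 hg hg' => w d1 d2.
  have d3 := isd_derivable (isd_sub p w).
  have d4 : derivable (fun _ : C R => (n.+1%:R : C R)) w 1 by exact: derivable_cst.
  exact: (derivableD (derivableM d4 d1) (derivableM d3 d2)).
- by rewrite subrr mul0r addr0 mulf_neq0// pnatr_eq0.
(* Interiors are taken because the factorization must hold around [w] to be differentiated at
   [w]. *)
apply: filterS2 (nbhs_interior hfg) (nbhs_interior hg) => w hfw hgw.
have dg := nbhs_singleton hgw.
have d1 := isd_is_derive (isd_subX p n w).
have d2 := isd_is_derive (derivable_isd dg).
have d3 : is_derive w 1 (fun x => (x - p) ^+ n.+1 * g x)
   ((w - p) ^+ n.+1 * derive1 g w + g w * (n.+1%:R * (w - p) ^+ n)).
  exact: (is_deriveM d1 d2).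
have [d4 d5] := d3.
have d6 := isd_derive1 (isd_addc (f p) (derivable_isd d4)).
rewrite [LHS](_ : _ = (w - p) ^+ n.+1 * derive1 g w + g w * (n.+1%:R * (w - p) ^+ n)).
  by rewrite exprS; ring.
rewrite -d5 -derive1E -d6; symmetry; apply: derive1_near.
  by apply: filterS hfw => x <-; rewrite subrK.
exact: isd_derivable (isd_addc (f p) (derivable_isd d4)).
Qed.

End Topology.

(** * Elementary lemmas on real numbers and finite sets *)

Lemma mulrn_unbounded (R : realType) (x y : R) : 0 < y -> exists k, x < y *+ k.
Proof.
move=> y0; exists (Num.trunc (x / y)).+1.
rewrite -mulr_natl -(ltr_pdivrMr _ _ y0); exact: truncnS_gt.
Qed.

Lemma harmonic_lt (R : realType) (x d : R) : 0 < x -> 0 < d ->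
  exists N, forall n, (N <= n)%N -> x / n.+1%:R < d.
Proof.
move=> x0 d0; exists (Num.trunc (x / d)) => n Nn.
rewrite ltr_pdivrMr// mulrC -ltr_pdivrMr//; apply: lt_le_trans (truncnS_gt _) _.
by rewrite ler_nat.
Qed.

Lemma normr_sg (R : realType) (sg y : R) : sg = 1 \/ sg = -1 -> `|sg * y| = `|y|.
Proof. by case=> ->; rewrite ?mul1r// mulN1r normrN. Qed.

Lemma harmonic_approach (R : realType) (T : R) n : 0 < T ->
  [/\ 0 <= T - T / n.+2%:R, T - T / n.+2%:R < T & T - T / n.+1%:R < T - T / n.+2%:R].
Proof.
move=> T0; have h1 : 0 < T / n.+2%:R by rewrite divr_gt0.
split; [|by rewrite ltrBlDr ltrDl|].
  by rewrite subr_ge0 ler_pdivrMr// ler_peMr ?ler1n// ltW.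
by rewrite ltrD2l ltrN2 ltr_pM2l// ltf_pV2 ?posrE// ltr_nat.
Qed.

(** The function changes sign across its zero: with equal signs at both ends, the intermediate value
    theorem would give some value twice. This is invariance of domain in dimension one. *)
Lemma injective_cover (R : realType) (g : R -> R) (a b t0 : R) : a < t0 < b ->
  {within `[a, b], continuous g} -> g t0 = 0 ->
  (forall t s, a <= t <= b -> a <= s <= b -> g t = g s -> t = s) ->
  exists2 m : R, 0 < m & forall y : R, `|y| < m -> exists2 t, a <= t <= b & g t = y.
Proof.
move=> /andP[at0 t0b] cg g0 inj; have ab := ltW (lt_trans at0 t0b).
have fold_absurd (h : R -> R) : {within `[a, b], continuous h} -> h t0 = 0 ->
    (forall t s, a <= t <= b -> a <= s <= b -> h t = h s -> t = s) ->
    0 < h a -> 0 < h b -> False.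
  move=> ch h0 hinj ha hb; pose c := Num.min (h a) (h b) / 2.
  have m0 : 0 < Num.min (h a) (h b) by rewrite lt_min ha.
  have c0 : 0 < c by rewrite divr_gt0.
  have cm : c < Num.min (h a) (h b) by rewrite /c; move: m0; lra.
  move: cm; rewrite lt_min => /andP[/ltW ca /ltW cb].
  have c1 : {within `[a, t0], continuous h}.
    by apply: continuous_subspaceW ch; apply: subset_itvl; rewrite bnd_simp ltW.
  have c2 : {within `[t0, b], continuous h}.
    by apply: continuous_subspaceW ch; apply: subset_itvr; rewrite bnd_simp ltW.
  have [|t1] := IVT (v := c) (ltW at0) c1.
    by rewrite h0 ge_min le_max ca (ltW c0) orbT.
  rewrite in_itv /= => /andP[t1a t10] e1.
  have [|t2] := IVT (v := c) (ltW t0b) c2.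
    by rewrite h0 ge_min le_max cb (ltW c0) orbT.
  rewrite in_itv /= => /andP[t20 t2b] e2.
  have t12 : t1 = t2.
    apply: hinj; rewrite ?e1 ?e2 ?t1a ?t2b ?(le_trans t10 (ltW t0b)) ?(le_trans (ltW at0) t20)//.
  have : t1 = t0 by apply/eqP; rewrite eq_le t10 t12.
  by move=> t1E; move: c0; rewrite -e1 t1E h0 ltxx.
have ga : g a != 0.
  apply/eqP => h; have e : a = t0 by apply: inj; rewrite ?h ?g0 ?lexx ?ab ?(ltW at0) ?(ltW t0b).
  by move: at0; rewrite e ltxx.
have gb : g b != 0.
  apply/eqP => h; have e : b = t0 by apply: inj; rewrite ?h ?g0 ?lexx ?ab ?(ltW at0) ?(ltW t0b).
  by move: t0b; rewrite e ltxx.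
exists (Num.min `|g a| `|g b|); first by rewrite lt_min !normr_gt0 ga.
move=> y; rewrite lt_min !ltr_norml => /andP[/andP[ya1 ya2] /andP[yb1 yb2]].
have hy : Num.min (g a) (g b) <= y <= Num.max (g a) (g b).
  case: (ltgtP (g a) 0) ga => // ga _; case: (ltgtP (g b) 0) gb => // gb _.
  - exfalso; apply: (fold_absurd (fun t => - g t)); rewrite ?g0 ?oppr0 ?oppr_gt0//.
      by move=> t; apply: continuousN; exact: cg.
    by move=> t s tab sab /oppr_inj; exact: inj.
  - move: ya1 yb2; rewrite (ltr0_norm ga) (gtr0_norm gb) opprK => /ltW y1 /ltW y2.
    by rewrite ge_min le_max y1 y2 orbT.
  - move: ya2 yb1; rewrite (gtr0_norm ga) (ltr0_norm gb) opprK => /ltW y1 /ltW y2.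
    by rewrite ge_min le_max y1 y2 orbT.
  - by exfalso; apply: (fold_absurd g).
by have [t] := IVT ab cg hy; rewrite in_itv /= => tab <-; exists t.
Qed.

(** Inclusion-exclusion: elements of exactly one set count once, common ones twice. This is how
    links and loops will be counted. *)
Lemma card_symdiff (T : choiceType) (X Y : set T) n : (X #= `I_n)%card -> (Y #= `I_n)%card ->
  exists a b : nat, [/\ ((X `|` Y) `\` (X `&` Y) #= `I_a)%card, (X `&` Y #= `I_b)%card &
    (2 * n)%N = (a + 2 * b)%N].
Proof.
move=> hX hY.
have fX : finite_set X by exists n.
have fY : finite_set Y by exists n.
have fI : finite_set (X `&` Y) by exact: finite_setIl.
have fU : finite_set (X `|` Y) by rewrite finite_setU.
have fD : finite_set ((X `|` Y) `\` (X `&` Y)) by exact: finite_setD.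
have [[a ha] [b hb]] := (fD, fI); exists a, b; split => //.
have := finmap.cardfsUI (fset_set X) (fset_set Y).
have := finmap.cardfsID (fset_set (X `&` Y)) (fset_set (X `|` Y)).
rewrite -fset_setU// -!fset_setI// -fset_setD// (card_fset_set ha) (card_fset_set hX) (card_fset_set hY).
have -> : (X `|` Y) `&` (X `&` Y) = X `&` Y by apply/seteqP; split=> x; rewrite /=; tauto.
by rewrite (card_fset_set hb); lia.
Qed.

Lemma card_image_ord (T : Type) n (h : 'I_n -> T) : injective h -> (h @` setT #= `I_n)%card.
Proof.
move=> hinj; have : (h @` setT #= [set: 'I_n])%card by apply: inj_card_eq => x y _ _; exact: hinj.
by move=> e; rewrite (card_eqr card_II).
Qed.

(** * Components of the level set *)

Section LevelSets.
Context {R : realType}.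
Variables (G' : set (C R)) (f : C R -> C R) (eps : R).
Hypotheses (oG : open G') (merof : meromorphic_on G' f) (eps0 : 0 < eps).
Implicit Types (w v p z : C R) (r s e t : R).

Lemma not_pole z (M : R) : (forall r, 0 < r ->
  exists2 w, w != z & nm (w - z) < r /\ nm (f w) <= M) -> ~ pole f z.
Proof.
move=> h /(_ [set x | rc M < x]) hp.
have /cnbhsP[r r0 hr] : nbhs z [set w | w != z -> rc M < `|f w|].
  by apply: hp; exists (rc M); split; first exact: (introT (complex_realP (rc M)) (ex_intro _ M erefl)).
have [w wz [wr fM]] := h r r0.
by have := hr w wr wz; rewrite normE ltcR ltNge fM.
Qed.

Lemma exists_neq_near z r : 0 < r -> exists2 w, w != z & nm (w - z) < r.
Proof.
move=> r0; exists (z + rc (r / 2)).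
  by rewrite -subr_eq0 addrC addKr rc_eq0 gt_eqF// divr_gt0.
by rewrite addrC addKr nm_rc gtr0_norm ?divr_gt0// ltr_pdivrMr// ltr_pMr// ltr1n.
Qed.

Lemma derivable_not_pole z : derivable f z 1 -> ~ pole f z.
Proof.
move=> /derivable_cont cf; apply: (@not_pole z (nm (f z) + 1)) => r r0.
have [d d0 hd] := cvg_eps cf ltr01.
have m0 : 0 < Num.min r d by rewrite lt_min r0.
have [w wz] := exists_neq_near z m0; rewrite lt_min => /andP[wr wd].
exists w => //; split=> //.
by rewrite -[f w](subrK (f z)) (le_trans (nmD _ _))// addrC lerD2l ltW// hd.
Qed.

Let E := level_set G' f eps.

Lemma level_setP w : E w -> [/\ G' w, derivable f w 1, nm (f w) = eps & holo_near f w].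
Proof.
move=> [Gw npw nw]; have [h1 [h2|//]] := merof Gw; split=> //.
  by have [] : `|f w| = eps%:C :> C R := nw.
move: h1 => /cnbhsP[r r0 hr]; apply/cnbhsP; exists r; first exact: r0.
move=> v vr; have [->|vw] := eqVneq v w; [exact: h2|exact: hr].
Qed.

Lemma level_set_neq0 w : E w -> f w != 0.
Proof. by move=> /level_setP[_ _ h _]; rewrite -nm_gt0 h. Qed.

Lemma level_setI w : G' w -> derivable f w 1 -> nm (f w) = eps -> E w.
Proof.
move=> Gw dw nw; split=> //; first exact: derivable_not_pole.
by rewrite normE nw.
Qed.

(** Points where [nm \o f] equals [eps] accumulate at [w], so [w] is not a pole and continuity of
    [f] applies. *)
Lemma level_set_closed w : G' w ->
  (forall r, 0 < r -> exists2 v, E v & nm (v - w) < r) -> E w.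
Proof.
move=> Gw hw; have [Ew|nEw] := pselect (E w) => //.
have hw' r : 0 < r -> exists2 v, v != w & nm (v - w) < r /\ nm (f v) <= eps.
  move=> /hw[v Ev vr]; exists v; first by apply/eqP => vw; apply: nEw; rewrite -vw.
  by split => //; have [_ _ -> _] := level_setP Ev.
have [_ [dw|/(not_pole hw')//]] := merof Gw.
apply: level_setI => //; apply/eqP; rewrite -subr_eq0 -normr_eq0 eq_le normr_ge0 andbT.
apply/ler_addgt0Pr => e e0; rewrite add0r.
have [r r0 hr] := cvg_eps (derivable_cont dw) e0.
have [v /level_setP[_ _ <- _] /hr/ltW] := hw r r0.
by rewrite nmB; apply: le_trans; exact: nm_dist.
Qed.

Variables (L : set (C R)).
Hypothesis compL : exists2 x, E x & L = connected_component E x.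

Lemma component_sub w : L w -> E w.
Proof. by have [x Ex ->] := compL => /connected_component_sub. Qed.

(** The image of the interval is a connected part of [E] that meets the component. *)
Lemma component_path (c : R -> C R) a b t0 : a < t0 < b -> L (c t0) ->
  (forall t, a < t < b -> c x @[x --> t] --> c t /\ E (c t)) ->
  forall t, a < t < b -> L (c t).
Proof.
move=> t0ab Lc hc t tab; have [x Ex LE] := compL.
have ex : connected_component E x (c t0) by rewrite -LE.
rewrite LE (same_connected_component ex).
apply: (@connected_component_max _ E (c @` [set t | a < t < b])); last by exists t.
- by exists t0.
- by move=> _ [s /hc[_ h] <-].
apply: connected_continuous_connected.
  exact/connected_intervalP/itvoo_interval.
by apply: continuous_in_subspaceT => s /set_mem /hc[].
Qed.

Hypotheses (cL : compact L).

Lemma component_closed_eps w : (forall r, 0 < r -> exists2 v, L v & nm (v - w) < r) -> L w.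
Proof.
move=> h; have clL : closed L by apply: compact_closed => //; exact: norm_hausdorff.
apply: clL => A /cnbhsP[r r0 hr]; have [v Lv vr] := h r r0.
by exists v; split => //; exact: hr.
Qed.

Lemma component_bounded : exists M, forall w, L w -> nm w <= M.
Proof.
have cn : {within L, continuous (@nm R)}.
  by apply: continuous_subspaceT; exact: continuous_nm.
have [L0|] := pselect (L !=set0); last first.
  by move=> L0; exists 0 => w Lw; exfalso; apply: L0; exists w.
have [v _ hv] := compact_EVT_max L0 cL cn.
by exists (nm (v)) => w Lw; apply: hv; exact: mem_set.
Qed.

Lemma near_const_or_isolated w (c : C R) : holo_near f w -> f w = c ->
  (\forall v \near w, f v = c) \/
  exists n g, [/\ (0 < n)%N, holo_near g w, g w != 0 &
    \forall v \near w, f v - c = (v - w) ^+ n * g v].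
Proof.
move=> hf fw.
have hfc : holo_near (fun v => f v + - c) w.
  by apply: filterS hf => v dv; exact: derivable_addc.
have [h|[m [g [hg gw h]]]] := holo_dichotomy hfc.
  by left; apply: filterS h => v /eqP; rewrite subr_eq0 => /eqP.
right; exists m, g; split=> //; rewrite lt0n; apply/eqP => m0.
have := nbhs_singleton h; rewrite m0 expr0 mul1r fw subrr => /esym/eqP.
by rewrite (negbTE gw).
Qed.

Lemma isolated_value w (c : C R) n g : holo_near g w -> g w != 0 ->
  (\forall v \near w, f v - c = (v - w) ^+ n * g v) ->
  exists2 r : R, 0 < r & forall v, nm (v - w) < r -> f v = c -> v = w.
Proof.
move=> hg gw h; have hn := nonzero_near (holo_near_cvg hg) gw.
have /cnbhsP[r r0 hr] : nbhs w (fun v => f v - c = (v - w) ^+ n * g v /\ g v != 0).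
  exact: filterI h hn.
exists r => // v /hr[e gv] fv.
apply/eqP; rewrite -subr_eq0; apply: contraT => vw.
by move: e; rewrite fv subrr => /esym/eqP; rewrite mulf_eq0 (negbTE gv) orbF expf_eq0 (negbTE vw) andbF.
Qed.

(* Were f constant near p, the points of L near which f is constant would form
   a nonempty bounded set, open and closed along the line p + R. *)
Lemma component_not_const p : L p -> ~ (\forall w \near p, f w = f p).
Proof.
move=> Lp hp; set c := f p in hp.
pose P t := L (p + rc t) /\ \forall w \near p + rc t, f w = c.
have allP t : P t.
  apply: (@interval_ind R setT P 0).
  - by [].
  - move=> s _ [Ls /cnbhsP[r r0 hr]].
    have [Gs _ ns _] := level_setP (component_sub Ls).
    have fs : f (p + rc s) = c by apply: hr; rewrite subrr nm0.
    have /cnbhsP[r' r'0 hr'] : nbhs (p + rc s) G' by exact: open_nbhs_nbhs.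
    pose d := Num.min r r'; have d0 : 0 < d by rewrite lt_min r0.
    have near_c x : nm (x - (p + rc s)) < d -> \forall w \near x, f w = c.
      rewrite lt_min => /andP[xr _]; apply/cnbhsP.
      exists (r - nm (x - (p + rc s))); first by rewrite subr_gt0.
      move=> w wx; apply: hr; rewrite (le_lt_trans (nm_triB _ x _))// -ltrBrDr//.
    have distE x : nm (p + rc x - (p + rc s)) = `|x - s|.
      by rewrite opprD addrACA subrr add0r -rcB nm_rc.
    exists d; first exact: d0.
    move=> x _ xs; split; last by apply: near_c; rewrite distE.
    apply: (@component_path (fun x => p + rc x) (s - d) (s + d) s).
    + by rewrite ltrBlDr ltrDl d0.
    + exact: Ls.
    + move=> t'; rewrite -ltr_distl => t'd.
      have t'd' : nm (p + rc t' - (p + rc s)) < d by rewrite distE.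
      split; first exact: (cvgD (cvg_cst p) (cvg_rc cvg_id)).
      have hc := near_c _ t'd'.
      apply: level_setI.
      * by apply: hr'; move: t'd'; rewrite lt_min => /andP[].
      * apply: (@derivable_near _ (fun _ => c)); last exact: derivable_cst.
        by apply: filterS hc => w ->.
      * by rewrite (nbhs_singleton hc) -fs.
    + by rewrite -ltr_distl.
  - move=> s _ nPs.
    apply: contrapT => hn.
    have hP d : 0 < d -> exists2 x, `|x - s| < d & P x.
      move=> d0; apply: contrapT => h; apply: hn; exists d; first exact: d0.
      by move=> x _ xd Px; apply: h; exists x.
    have distE x : nm (p + rc x - (p + rc s)) = `|x - s|.
      by rewrite opprD addrACA subrr add0r -rcB nm_rc.
    have Ls : L (p + rc s).
      apply: component_closed_eps => r r0; have [x xs [Lx _]] := hP r r0.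
      by exists (p + rc x); rewrite ?distE.
    have [_ ds _ hs] := level_setP (component_sub Ls).
    have fs : f (p + rc s) = c.
      apply/eqP; rewrite -subr_eq0 -nm_eq0 eq_le nm_ge0 andbT.
      apply/ler_addgt0Pr => e e0; rewrite add0r.
      have [r r0 hr] := cvg_eps (derivable_cont ds) e0.
      have [x xs [_ /nbhs_singleton fx]] := hP r r0.
      by rewrite nmB -fx ltW// hr// distE.
    (* Either [f] is constant near the limit point, or the value [c] is isolated there and nearby
       points of [P] can only be that point. *)
    have [h|[n [g [n0 hg gs h]]]] := near_const_or_isolated hs fs; first exact: nPs.
    have [r r0 hr] := isolated_value hg gs h.
    have [x xs [Lx hx]] := hP r r0.
    have /addrI /rc_inj xE := hr (p + rc x) ltac:(by rewrite distE) (nbhs_singleton hx).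
    by apply: nPs; rewrite -xE.
  - by [].
  - by rewrite /P rc0 addr0.
  - by [].
have [M hM] := component_bounded.
(* A point of the line too far from the origin for the bound [M] on [L]. *)
have [Lt _] := allP (M + nm p + 1).
have h1 := hM _ Lt; have h2 := hM _ Lp; have h3 := nm_ge0 p.
have := nmD (p + rc (M + nm p + 1)) (- p).
rewrite addrAC subrr add0r nmN nm_rc ger0_norm; first by lra.
by lra.
Qed.

Lemma component_order p : L p -> exists n g, [/\ (0 < n)%N, holo_near g p, g p != 0 &
    \forall v \near p, f v - f p = (v - p) ^+ n * g v].
Proof.
move=> Lp; have [_ _ _ hf] := level_setP (component_sub Lp).
by have [/(component_not_const Lp)//|] := near_const_or_isolated hf erefl.
Qed.

Definition regular w := L w /\ derive1 f w != 0.

(** [f'] has finite order at every point of [L], so its zeros are isolated there. *)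
Lemma near_regular p : L p -> exists2 rho, 0 < rho & forall w, nm (w - p) < rho ->
  [/\ G' w, derivable f w 1 & w != p -> derive1 f w != 0].
Proof.
move=> Lp; have [Gp dp _ hf] := level_setP (component_sub Lp).
have [n [g [n0 hg gp h]]] := component_order Lp.
have [g2 [hg2 g2p h2]] := order_derive n0 hf hg gp h.
have hn := nonzero_near (holo_near_cvg hg2) g2p.
have nG : nbhs p G' by exact: open_nbhs_nbhs.
have /cnbhsP[r r0 hr] : nbhs p (fun w => (G' w /\ derivable f w 1) /\
    (derive1 f w = (w - p) ^+ n.-1 * g2 w /\ g2 w != 0)).
  exact: filterI (filterI nG hf) (filterI h2 hn).
exists r; first exact: r0.
move=> w /hr[[Gw dw] [fw gw]]; split=> [||wp]; [exact: Gw|exact: dw|].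
by rewrite fw mulf_neq0// expf_neq0// subr_eq0.
Qed.

(** [f'] vanishes to order [n - 1]; regular points are those with [n = 1]. *)
Lemma critical_order p n g : L p -> (0 < n)%N -> holo_near g p -> g p != 0 ->
  (\forall v \near p, f v - f p = (v - p) ^+ n * g v) ->
  (derive1 f p == 0) = (1 < n)%N.
Proof.
move=> Lp n0 hg gp h; have [_ _ _ hf] := level_setP (component_sub Lp).
have [g2 [hg2 g2p h2]] := order_derive n0 hf hg gp h.
rewrite (nbhs_singleton h2) subrr mulf_eq0 (negbTE g2p) orbF.
case: n n0 {h h2} => [//|[|n]] _ /=; first by rewrite expr0 oner_eq0.
by rewrite exprS mul0r eqxx.
Qed.

Lemma re_signed_i (j : bool) (x : R) : reC (signed_i j * rc x) = 0.
Proof. by case: j; rewrite /signed_i reM /= ?oppr0 !(mul0r, mulr0) subrr. Qed.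

Lemma im_signed_i (j : bool) (x : R) : imC (signed_i j * rc x) = if j then x else - x.
Proof. by case: j; rewrite /signed_i imM /= !(mul0r, mulr0, oppr0, mul1r, mulN1r, add0r). Qed.

(** The Cayley transform is purely imaginary on an arc, so the arc stays in the level set; being
    connected and passing through [p], it stays in [L]. Inside the disc of [near_regular], [p] is
    its only critical point. *)
Lemma level_arcs p n g : L p -> (0 < n)%N -> holo_near g p -> g p != 0 ->
  (\forall v \near p, f v - f p = (v - p) ^+ n * g v) ->
  exists s0 r (A : bool -> 'I_n -> R -> C R), [/\ 0 < s0, 0 < r &
   [/\ forall j k s, `|s| < s0 -> [/\ A j k x @[x --> s] --> A j k s,
        L (A j k s), s != 0 -> derive1 f (A j k s) != 0, f (A j k s) + f p != 0 &
        cayley (f p) (f (A j k s)) = signed_i j * rc s ^+ n],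
      forall j k, A j k 0 = p,
      forall j k k' s, `|s| < s0 -> s != 0 -> A j k s = A j k' s -> k = k',
      forall w j s, nm (w - p) < r -> s != 0 ->
        cayley (f p) (f w) = signed_i j * rc s ^+ n ->
        `|s| < s0 /\ exists k, w = A j k s &
      forall w, nm (w - p) < r -> [/\ derivable f w 1, f w + f p != 0,
        nm (cayley (f p) (f w)) < s0 ^+ n & w != p -> cayley (f p) (f w) != 0]]].
Proof.
move=> Lp n0 hg gp h; have Ep := component_sub Lp.
have [_ _ np hf] := level_setP Ep; have fp0 := level_set_neq0 Ep.
have [rho rho0 hrho] := near_regular Lp.
have [s0 [r [A [s00 r0 _ [h1 h2 h3 h4 h5]]]]] := local_level_set n0 rho0 fp0 hf hg gp h.
have EA j k s : `|s| < s0 -> E (A j k s).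
  move=> ss; have [_ Ar fA cA] := h1 j k s ss; have [GA dA _] := hrho _ Ar.
  apply: level_setI => //; rewrite -np; apply/(cayley_circle fA).
  by rewrite cA -rcX re_signed_i.
exists s0, r, A; split; [exact: s00|exact: r0|split].
- move=> j k s ss; have [cA Ar fA caA] := h1 j k s ss; split.
  + exact: cA.
  + have := @component_path (A j k) (- s0) s0 0.
    rewrite h2 oppr_lt0 s00 => /(_ erefl Lp) hp; apply: hp; last by rewrite -ltr_norml.
    move=> t; rewrite -ltr_norml => ts; split; last exact: EA.
    by have [] := h1 j k t ts.
  + move=> s_neq0; have [_ _] := hrho _ Ar; apply; apply/eqP => Ap.
    move: caA; rewrite Ap /cayley subrr mul0r => /esym/eqP.
    by rewrite mulf_eq0 -nm_eq0 nm_signed_i oner_eq0 expf_eq0 rc_eq0 (negbTE s_neq0) andbF.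
  + exact: fA.
  + exact: caA.
- exact: h2.
- exact: h3.
- exact: h4.
- exact: h5.
Qed.

(* The parameter of psi is the angle of f; x is a coordinate on L near p. *)
Lemma regular_chart p : regular p -> exists h0 r (psi : R -> C R) (x : C R -> R),
  [/\ 0 < h0, 0 < r, psi 0 = p,
    forall h, `|h| < h0 -> [/\ psi y @[y --> h] --> psi h, regular (psi h) &
      f (psi h) = f p * cis h] &
    [/\ forall w, nm (w - p) < r -> L w -> exists2 h, `|h| < h0 & w = psi h,
       forall w v, nm (w - p) < r -> nm (v - p) < r -> L w -> L v ->
         f w = f v -> w = v,
       forall w v, nm (w - p) < r -> nm (v - p) < r -> L w -> L v -> x w = x v -> w = v,
       x p = 0 & forall w, nm (w - p) < r -> x y @[y --> w] --> x w]].
Proof.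
move=> [Lp dp]; have Ep := component_sub Lp; have fp0 := level_set_neq0 Ep.
have [n [g [n0 hg gp h]]] := component_order Lp.
have n1 : n = 1%N.
  apply/eqP; rewrite eqn_leq n0 andbT leqNgt -(critical_order Lp n0 hg gp h).
  exact: dp.
subst n.
have [s0 [r [A [s00 r0 [h1 h2 h3 h4 h5]]]]] := level_arcs Lp n0 hg gp h.
pose a := A true ord0.
have np : nm (f p) = eps by have [] := level_setP Ep.
pose x w := imC (cayley (f p) (f w)).
have wa w : nm (w - p) < r -> L w -> `|x w| < s0 /\ w = a (x w).
  move=> wr Lw; have [_ fw cw cw0] := h5 w wr.
  have re0 : reC (cayley (f p) (f w)) = 0.
    by apply/(cayley_circle fw); rewrite np; have [] := level_setP (component_sub Lw).
  have cE : cayley (f p) (f w) = signed_i true * rc (x w) ^+ 1.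
    by rewrite [LHS]CE re0 rc0 add0r expr1.
  have [x0|x0] := eqVneq (x w) 0.
    rewrite x0 normr0 /a h2; split=> //; apply/eqP; apply: contraT => /cw0.
    by rewrite cE x0 expr1 rc0 mulr0 eqxx.
  have [xs [k wE]] := h4 w true (x w) wr x0 cE; split; first exact: xs.
  by rewrite {1}wE (ord1 k).
have cA s : `|s| < s0 -> x (a s) = s.
  by move=> /(h1 true ord0)[_ _ _ _]; rewrite /x => ->; rewrite expr1 im_signed_i.
(* For [|y| < 1] the half angle stays below [pi / 2], so [tan (y / 2)] is continuous. *)
have pihalf1 : (1 : R) / 2 < pi / 2.
  by rewrite ltr_pM2r// (lt_le_trans _ (pi_ge2 R))// ltr1n.
have cosP (y : R) : `|y| < 1 -> 0 < cos (y / 2) :> R.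
  move=> y1; apply: cos_gt0_pihalf; rewrite -ltr_norml normrM [`|2^-1|]gtr0_norm ?invr_gt0//.
  by apply: lt_trans pihalf1; rewrite ltr_pM2r.
have ctan (y : R) : `|y| < 1 -> tan (t / 2) @[t --> y] --> tan (y / 2).
  move=> y1; have c1 : t / 2 @[t --> y] --> y / 2 by apply: cvgM; [exact: cvg_id|exact: cvg_cst].
  by apply: continuous_cvg c1; apply: continuous_tan; rewrite gt_eqF// cosP.
have [h0 h00 hh0] : exists2 h0, 0 < h0 & forall y, `|y| < h0 -> `|y| < 1 /\ `|tan (y / 2)| < s0.
  have := ctan 0; rewrite normr0 ltr01 mul0r tan0 => /(_ erefl) /cvgrPdist_lt /(_ _ s00).
  move=> /rnbhsP[d d0 hd]; exists (Num.min d 1); first by rewrite lt_min d0 ltr01.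
  move=> y; rewrite lt_min => /andP[yd y1]; split => //.
  by have := hd y; rewrite subr0 sub0r normrN; apply.
have [s1 s10 hs1] : exists2 s1, 0 < s1 & forall s, `|s| < s1 -> `|atan s *+ 2| < h0.
  have /cvgrPdist_lt/(_ _ h00) : atan t *+ 2 @[t --> (0 : R)] --> (atan 0 *+ 2 : R).
    by apply: cvgMn; exact: continuous_atan.
  rewrite atan0 mul0rn => /rnbhsP[d d0 hd]; exists d => // s sd.
  by have := hd s; rewrite subr0 sub0r normrN; apply.
have cx w : nm (w - p) < r -> x y @[y --> w] --> x w.
  move=> /h5[dw fw _ _]; have cw := derivable_cont dw.
  have cw' : f y @[y --> w] --> f w by exact: cw.
  have c1 : f y - f p @[y --> w] --> f w - f p by apply: (cvgB cw'); exact: cvg_cst.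
  have c2 : f y + f p @[y --> w] --> f w + f p by apply: (cvgD cw'); exact: cvg_cst.
  exact: (cvg_imC (cvgM c1 (cvgV fw c2))).
have x0 : x p = 0 by rewrite /x /cayley subrr mul0r.
have [r1 r10 hr1] : exists2 r1, 0 < r1 & forall w, nm (w - p) < r1 -> `|x w| < s1.
  have := cx p; rewrite subrr nm0 => /(_ r0) /cvgrPdist_lt /(_ _ s10) /cnbhsP[d d0 hd].
  by exists d => // w /hd; rewrite x0 sub0r normrN.
(* Half-angle substitution: the Cayley transform of [f p * cis y] is [i * tan (y / 2)], so the arc
   parameter is [tan (y / 2)] and the coordinate [x] reads it back. *)
exists h0, (Num.min r r1), (fun y => a (tan (y / 2))), x; split.
- exact: h00.
- by rewrite lt_min r0.
- by rewrite mul0r tan0 /a h2.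
- move=> y /hh0[y1 ys]; have [cA1 LA dA fA caA] := h1 true ord0 _ ys.
  split.
  + exact: continuous_cvg cA1 (ctan _ y1).
  + split; first exact: LA.
    by have [->|/dA//] := eqVneq (tan (y / 2)) 0; rewrite /a h2.
  + have := cayleyK fA; rewrite caA expr1 /=.
    set F := f _; set c := cos (y / 2); set s := sin (y / 2).
    have c0 : rc c != 0 by rewrite rc_eq0 gt_eqF// cosP.
    rewrite -/(a _) in F *; rewrite /tan -/c -/s rcM rcV => hF.
    have cy : cis y = (rc c + iC * rc s) * (rc c + iC * rc s).
      by rewrite {1}[y]splitr cisD; congr (_ * _); rewrite [LHS]CE.
    have unit : (rc c + iC * rc s) * (rc c - iC * rc s) = 1.
      rewrite -rc1 -(cos2Dsin2 (y / 2)) rcD !rcX -/c -/s.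
      rewrite (_ : _ * _ = rc c ^+ 2 - (iC * iC) * rc s ^+ 2); last by ring.
      by rewrite iC2 mulN1r opprK.
    (* [cayleyK] with the denominator [cos (y / 2)] cleared. *)
    have hF' : F * (rc c - iC * rc s) = f p * (rc c + iC * rc s).
      apply: (mulIf (invr_neq0 c0)).
      transitivity (F * (1 - iC * (rc s / rc c))); first by field.
      by rewrite hF; field.
    rewrite cy mulrA -hF' -mulrA [(rc c - _) * _]mulrC unit mulr1//.
- split.
  + move=> w; rewrite lt_min => /andP[wr /hr1 xs] Lw.
    have [_ wE] := wa w wr Lw; exists (atan (x w) *+ 2); first exact: hs1.
    by rewrite -[atan _ *+ 2]mulr_natr mulfK// atanK.
  + move=> w v; rewrite !lt_min => /andP[wr _] /andP[vr _] Lw Lv fwv.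
    by have [_ ->] := wa w wr Lw; have [_ ->] := wa v vr Lv; rewrite /x fwv.
  + move=> w v; rewrite !lt_min => /andP[wr _] /andP[vr _] Lw Lv xwv.
    by have [_ ->] := wa w wr Lw; have [_ ->] := wa v vr Lv; rewrite xwv.
  + exact: x0.
  + by move=> w; rewrite lt_min => /andP[wr _]; exact: cx.
Qed.

(** * Curves parametrized by the angle of f *)

Lemma cvgr_eps (eta : R -> C R) t (l : C R) e : eta x @[x --> t] --> l -> 0 < e ->
  exists2 d : R, 0 < d & forall x : R, `|x - t| < d -> nm (eta x - l) < e.
Proof. by move=> /ccvgP h /h /rnbhsP. Qed.

(** The coincidence set is open because [f] is injective on [L] near a regular point, and closed by
    continuity. *)
Lemma curve_uniq (I : set R) (c1 c2 : R -> C R) t0 : is_interval I ->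
  (forall t, I t -> [/\ c1 x @[x --> t] --> c1 t, c2 x @[x --> t] --> c2 t, regular (c1 t),
     L (c2 t) & f (c1 t) = f (c2 t)]) ->
  I t0 -> c1 t0 = c2 t0 -> forall t, I t -> c1 t = c2 t.
Proof.
move=> itvI h It0 e0; apply: (@interval_ind R I (fun t => c1 t = c2 t) t0 itvI _ _ It0 e0).
- move=> t tab e; have [k1 k2 reg _ _] := h t tab.
  have [h0 [r [psi [x [_ r0 _ _ [_ inj _ _ _]]]]]] := regular_chart reg.
  have [d1 d10 hd1] := cvgr_eps k1 r0; have [d2 d20 hd2] := cvgr_eps k2 r0.
  exists (Num.min d1 d2); first by rewrite lt_min d10.
  move=> s sab; rewrite lt_min => /andP[/hd1 s1 /hd2 s2]; rewrite -e in s2.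
  by have [_ _ [L1 _] L2 f12] := h s sab; exact: inj s1 s2 L1 L2 f12.
- move=> t tab /eqP; rewrite -subr_eq0 -nm_gt0 => m0.
  have [k1 k2 _ _ _] := h t tab.
  have m20 : 0 < nm (c1 t - c2 t) / 2 by rewrite divr_gt0.
  have [d1 d10 hd1] := cvgr_eps k1 m20; have [d2 d20 hd2] := cvgr_eps k2 m20.
  exists (Num.min d1 d2); first by rewrite lt_min d10.
  move=> s _; rewrite lt_min => /andP[/hd1 s1 /hd2 s2] es.
  have := nm_triB (c1 t) (c1 s) (c2 t); rewrite [nm (c1 t - c1 s)]nmB {2}es.
  by move: s1 s2; lra.
Qed.

(** A curve of regular points parametrized by the angle of [f], where [c] is the value that
    corresponds to angle 0. *)
Variant lift (c : C R) (a b : R) (eta : R -> C R) : Prop :=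
  Lift of (forall t, a < t < b -> [/\ eta x @[x --> t] --> eta t, regular (eta t) &
                                      f (eta t) = c * cis t]).

Lemma liftW c a b a' b' eta : a <= a' -> b' <= b -> lift c a b eta -> lift c a' b' eta.
Proof.
move=> aa bb [h]; split=> t /andP[ta tb]; apply: h.
by rewrite (le_lt_trans aa ta) (lt_le_trans tb bb).
Qed.

Lemma lift_uniq c a b eta eta' t0 : lift c a b eta -> lift c a b eta' -> a < t0 < b ->
  eta t0 = eta' t0 -> forall t, a < t < b -> eta t = eta' t.
Proof.
move=> [h] [h'] t0ab e0; apply: (curve_uniq (@itvoo_interval R a b) _ t0ab e0) => t tab.
have [k1 reg f1] := h t tab; have [k2 [L2 _] f2] := h' t tab.
by split; [exact: k1|exact: k2|exact: reg|exact: L2|rewrite f1 f2].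
Qed.

Definition glue a b (eta eta' : R -> C R) t := if a < t < b then eta t else eta' t.

(** The overlap of two intervals is an interval, so lifts that agree at one point agree on all of
    it, and the preference built into [glue] is harmless. *)
Lemma lift_glue c a b eta a' b' eta' t0 : lift c a b eta -> lift c a' b' eta' ->
  a < t0 < b -> a' < t0 < b' -> eta t0 = eta' t0 ->
  lift c (Num.min a a') (Num.max b b') (glue a b eta eta') /\
  forall t, a' < t < b' -> glue a b eta eta' t = eta' t.
Proof.
move=> l1 l2 tab tab' e0.
have agree t : a < t < b -> a' < t < b' -> eta t = eta' t.
  move=> t1 t2; apply: (@lift_uniq c (Num.max a a') (Num.min b b') _ _ t0).
  - by apply: liftW l1; rewrite ?le_max ?ge_min lexx.
  - by apply: liftW l2; rewrite ?le_max ?ge_min lexx orbT.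
  - by rewrite gt_max lt_min; case/andP: tab => -> ->; case/andP: tab' => -> ->.
  - exact: e0.
  - by rewrite gt_max lt_min; case/andP: t1 => -> ->; case/andP: t2 => -> ->.
have glueE t : a' < t < b' -> glue a b eta eta' t = eta' t.
  by move=> t2; rewrite /glue; case: ifPn => // t1; exact: agree.
have near_itv (u v t : R) : u < t < v -> \forall x \near t, u < x < v.
  move=> /andP[ut tv]; apply/rnbhsP; exists (Num.min (t - u) (v - t)).
    by rewrite lt_min !subr_gt0 ut.
  by move=> x; rewrite lt_min !ltr_norml => /andP[/andP[h1 h2] /andP[h3 h4]]; apply/andP; split; lra.
split=> //; case: l1 l2 => h [h']; split=> t tu.
have [t1|t1] := boolP (a < t < b).
  have [c1 reg ft] := h t t1; rewrite {2 3 4}/glue t1; split=> //.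
  apply: cvg_trans c1; apply: near_eq_cvg; apply: filterS (near_itv _ _ _ t1) => x xab.
  by rewrite /glue xab.
have t2 : a' < t < b'.
  move: tu tab tab' t1; rewrite gt_min lt_max !negb_and -!leNgt => /andP[h1 h2] /andP[h3 h4] /andP[h5 h6].
  move=> /orP[ta|bt].
    by case/orP: h1 => h1; [move: ta; rewrite leNgt h1|rewrite h1 (le_lt_trans ta) // (lt_trans h3)].
  by case/orP: h2 => h2; [move: bt; rewrite leNgt h2|rewrite h2 andbT (lt_le_trans _ bt) // (lt_trans h5)].
have [c1 reg ft] := h' t t2; rewrite glueE//; split=> //.
apply: cvg_trans c1; apply: near_eq_cvg; apply: filterS (near_itv _ _ _ t2) => x xab.
by rewrite glueE.
Qed.

Lemma lift_shift c a b eta s : lift c a b eta ->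
  lift (c * cis s) (a - s) (b - s) (fun t => eta (t + s)).
Proof.
move=> [h]; split=> t; rewrite ltrBlDr ltrBrDr => /h[ct reg ft]; split=> //.
- have c1 : x + s @[x --> t] --> t + s by apply: (cvgD cvg_id); exact: cvg_cst.
  exact: (cvg_comp _ _ c1 ct).
- by rewrite ft cisD; ring.
Qed.

(* A chart at p, re-based so that its angle at p is T. *)
Lemma chart_at c T p : regular p -> f p = c * cis T -> exists (h0 r : R) psi,
  [/\ 0 < h0, 0 < r, lift c (T - h0) (T + h0) psi, psi T = p &
   [/\ forall w, nm (w - p) < r -> L w -> exists2 t, T - h0 < t < T + h0 & w = psi t &
    forall w v, nm (w - p) < r -> nm (v - p) < r -> L w -> L v -> f w = f v -> w = v]].
Proof.
move=> reg fp.
have [h0 [r [psi [x [h00 r0 psi0 hpsi [h1 h2 _ _ _]]]]]] := regular_chart reg.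
exists h0, r, (fun t => psi (t - T)); split; [exact: h00|exact: r0| | |split; last exact: h2].
- have l0 : lift (f p) (- h0) h0 psi by split=> t; rewrite -ltr_norml; exact: hpsi.
  have := lift_shift (- T) l0; rewrite opprK [- h0 + T]addrC [h0 + T]addrC.
  by rewrite fp -mulrA -cisD subrr cis0 mulr1.
- by rewrite subrr psi0.
- move=> w wr Lw; have [h hh ->] := h1 w wr Lw; exists (T + h); last by rewrite addrC addKr.
  by rewrite -ltr_distl addrC addKr.
Qed.

(** * Maximal curves *)

Section MaximalLift.
Variable p0 : C R.
Hypothesis reg0 : regular p0.
Let c0 := f p0.

Definition lift_through a b eta := [/\ a < 0, 0 < b, lift c0 a b eta & eta 0 = p0].
Definition ldom t := exists a b eta, lift_through a b eta /\ a < t < b.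
(* Independent of the choice made by xget, by lift_through_uniq. *)
Definition mlift t : C R :=
  xget p0 [set w | exists a b eta, [/\ lift_through a b eta, a < t < b & w = eta t]].

Lemma lift_through_uniq a b eta a' b' eta' t : lift_through a b eta ->
  lift_through a' b' eta' -> a < t < b -> a' < t < b' -> eta t = eta' t.
Proof.
move=> [a0 b0 l1 e1] [a0' b0' l2 e2] t1 t2.
apply: (@lift_uniq c0 (Num.max a a') (Num.min b b') _ _ 0).
- by apply: liftW l1; rewrite ?le_max ?ge_min lexx.
- by apply: liftW l2; rewrite ?le_max ?ge_min lexx orbT.
- by rewrite gt_max lt_min a0 b0 a0' b0'.
- by rewrite e1 e2.
- by rewrite gt_max lt_min; case/andP: t1 => -> ->; case/andP: t2 => -> ->.
Qed.

Lemma mliftE a b eta t : lift_through a b eta -> a < t < b -> ldom t /\ mlift t = eta t.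
Proof.
move=> l tab; split; first by exists a, b, eta.
rewrite /mlift; case: xgetP => [w _ [a' [b' [eta' [l' tab' ->]]]]|/(_ (eta t)) h].
  exact: lift_through_uniq l' l tab' tab.
by exfalso; apply: h; exists a, b, eta.
Qed.

Lemma ldom2 t s : ldom t -> ldom s -> exists a b eta,
  [/\ lift_through a b eta, a < t < b & a < s < b].
Proof.
move=> [a [b [eta [[a0 b0 l e] tab]]]] [a' [b' [eta' [[a0' b0' l' e'] sab]]]].
have [l2 h2] := lift_glue l l' (introT andP (conj a0 b0)) (introT andP (conj a0' b0')) (etrans e (esym e')).
exists (Num.min a a'), (Num.max b b'), (glue a b eta eta'); split.
- split=> //; first by rewrite gt_min a0.
  + by rewrite lt_max b0.
  + by rewrite h2 ?a0'.
- by rewrite gt_min lt_max; case/andP: tab => -> ->.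
- by rewrite gt_min lt_max; case/andP: sab => -> ->; rewrite !orbT.
Qed.

(** A lift that agrees with [mlift] at one point can be glued to it, hence is already part of it. *)
Lemma ldom_maximal a b eta t0 : lift c0 a b eta -> a < t0 < b -> ldom t0 ->
  mlift t0 = eta t0 -> forall t, a < t < b -> ldom t /\ mlift t = eta t.
Proof.
move=> l tab [a' [b' [eta' [l' tab']]]] e t tab2.
have [_ e'] := mliftE l' tab'; have [a0 b0 l1 e1] := l'.
have [l2 h2] := lift_glue l1 l tab' tab (etrans (esym e') e).
rewrite -(h2 t tab2); apply: (@mliftE (Num.min a' a) (Num.max b' b)).
  split=> //; [by rewrite gt_min a0|by rewrite lt_max b0|by rewrite /glue a0 b0].
by rewrite gt_min lt_max; case/andP: tab2 => -> ->; rewrite !orbT.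
Qed.

Lemma ldom0 : ldom 0 /\ mlift 0 = p0.
Proof.
have e0 : f p0 = c0 * cis 0 by rewrite cis0 mulr1.
have [h0 [r [psi [h00 r0 l psi0 _]]]] := chart_at reg0 e0.
have l' : lift_through (0 - h0) (0 + h0) psi.
  by split=> //; rewrite ?sub0r ?add0r ?oppr_lt0.
by rewrite -[in RHS]psi0; apply: mliftE l' _; rewrite sub0r add0r oppr_lt0 h00.
Qed.

Lemma mliftP t : ldom t -> [/\ mlift x @[x --> t] --> mlift t, regular (mlift t),
  f (mlift t) = c0 * cis t & exists2 d : R, 0 < d & forall x : R, `|x - t| < d -> ldom x].
Proof.
move=> [a [b [eta [l tab]]]]; have [_ _ [h] _] := l.
have [ct reg ft] := h t tab; have [_ et] := mliftE l tab.
have [d d0 hd] : exists2 d : R, 0 < d & forall x, `|x - t| < d -> a < x < b.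
  case/andP: tab => at_ tb; exists (Num.min (t - a) (b - t)).
    by rewrite lt_min !subr_gt0 at_.
  by move=> x; rewrite lt_min !ltr_norml => /andP[/andP[h1 h2] /andP[h3 h4]]; apply/andP; split; lra.
rewrite et; split=> //; last by exists d => // x /hd /(mliftE l)[].
apply: cvg_trans ct; apply: near_eq_cvg; apply/rnbhsP; exists d => // x /hd xab.
by have [_ ->] := mliftE l xab.
Qed.

Lemma ldom_interval x y t : ldom x -> ldom y -> x <= t <= y -> ldom t.
Proof.
move=> Dx Dy /andP[xt ty]; have [a [b [eta [l /andP[ax _] /andP[_ yb]]]]] := ldom2 Dx Dy.
by apply: (mliftE l _).1; rewrite (lt_le_trans ax xt) (le_lt_trans ty yb).
Qed.

Definition mcurve : set (C R) := [set mlift t | t in ldom].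

(** A chart at [p], with its angle shifted to match [mlift] at a nearby point of the curve, is a
    lift that meets the maximal one and so lies in it; and the chart covers [L] near [p]. *)
Lemma mcurve_saturated p : regular p ->
  (forall r, 0 < r -> exists2 w, mcurve w & nm (w - p) < r) ->
  exists2 r : R, 0 < r & forall w, nm (w - p) < r -> L w -> mcurve w.
Proof.
move=> reg hp.
have [h0 [r [psi [h00 r0 l0 psi0 [surj _]]]]] := chart_at (c := f p) (T := 0) reg ltac:(by rewrite cis0 mulr1).
exists r => // w wr Lw.
have [_ [t Dt <-] tr] := hp r r0; have [_ [Lt _] ft _] := mliftP Dt.
have [s sh se] := surj _ tr Lt; have [u uh ue] := surj _ wr Lw.
have [hl] := (l0); have [_ _ fs] := hl s sh.
(* The shifted chart has base value [c0], because both parametrizations give the same [f] at the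
   common point. *)
have cE : f p * cis (s - t) = c0.
  apply: (mulIf (cis_neq0 t)); rewrite -mulrA -cisD subrK -fs -se ft//.
have := lift_shift (s - t) l0; rewrite cE => l1.
have ht : 0 - h0 - (s - t) < t < 0 + h0 - (s - t) by case/andP: sh => s1 s2; apply/andP; split; lra.
have he : mlift t = psi (t + (s - t)) by rewrite addrC subrK -se.
have hu : 0 - h0 - (s - t) < u - (s - t) < 0 + h0 - (s - t) by rewrite !ltrD2r.
have [Du mu] := ldom_maximal l1 ht Dt he hu.
by exists (u - (s - t)); [exact: Du|rewrite mu subrK -ue].
Qed.

(* A repeated value would make the curve periodic. *)
Lemma mlift_shift s t x : ldom s -> ldom t -> mlift s = mlift t -> ldom x ->
  ldom (x + (s - t)) /\ mlift (x + (s - t)) = mlift x.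
Proof.
move=> Ds Dt e Dx; have [_ _ fs _] := mliftP Ds; have [_ _ ft _] := mliftP Dt.
have [a [b [eta [l1 xab tab]]]] := ldom2 Dx Dt; have [_ _ l _] := l1.
have [_ ex] := mliftE l1 xab; have [_ et] := mliftE l1 tab.
have cE : c0 * cis (t - s) = c0.
  by apply: (mulIf (cis_neq0 s)); rewrite -mulrA -cisD subrK -ft -e fs.
have l2 := lift_shift (t - s) l; rewrite cE in l2.
have hs : a - (t - s) < s < b - (t - s) by case/andP: tab => h1 h2; apply/andP; split; lra.
have es : mlift s = eta (s + (t - s)) by rewrite addrC subrK e.
have hx : a - (t - s) < x + (s - t) < b - (t - s).
  by case/andP: xab => h1 h2; apply/andP; split; lra.
have [D1 e1] := ldom_maximal l2 hs Ds es hx.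
split; first exact: D1.
by rewrite e1 ex; congr eta; ring.
Qed.

Lemma curve_dist_pos (g : R -> C R) (a b : R) z : a <= b ->
  (forall t, a <= t <= b -> g x @[x --> t] --> g t /\ g t != z) ->
  exists2 m : R, 0 < m & forall t : R, a <= t <= b -> m <= nm (g t - z).
Proof.
move=> ab hg; have cn : {within `[a, b], continuous (fun t => nm (g t - z))}.
  apply: continuous_in_subspaceT => t /set_mem /=; rewrite in_itv /= => /hg[ct _].
  have c1 : g x - z @[x --> t] --> g t - z by apply: (cvgB ct); exact: cvg_cst.
  exact: (cvg_nm c1).
have [c cab hc] := EVT_min ab cn.
exists (nm (g c - z)); first by rewrite nm_gt0 subr_eq0; apply: (hg c _).2; move: cab; rewrite in_itv.
by move=> t tab; apply: hc; rewrite in_itv.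
Qed.

Lemma value_isolated p : L p ->
  exists2 r : R, 0 < r & forall v, nm (v - p) < r -> f v = f p -> v = p.
Proof.
by move=> Lp; have [n [g [_ hg gp h]]] := component_order Lp; exact: isolated_value hg gp h.
Qed.

Lemma value_cluster w c T : L w ->
  (forall e : R, 0 < e -> exists v (t : R), [/\ nm (v - w) < e, `|t - T| < e & f v = c * cis t]) ->
  f w = c * cis T.
Proof.
move=> Lw h; have [_ dw _ _] := level_setP (component_sub Lw).
have cf := derivable_cont dw.
have cc : c * cis t @[t --> T] --> c * cis T.
  by apply: cvgM; [exact: cvg_cst|exact: cis_cont].
apply/eqP; rewrite -subr_eq0 -nm_eq0 eq_le nm_ge0 andbT; apply/ler_addgt0Pr => e e0; rewrite add0r.
have e20 : 0 < e / 2 by rewrite divr_gt0.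
have [d1 d10 hd1] := cvg_eps cf e20; have [d2 d20 hd2] := cvgr_eps cc e20.
have m0 : 0 < Num.min d1 d2 by rewrite lt_min d10.
have [v [t [vm tm fv]]] := h _ m0.
move: vm tm; rewrite !lt_min => /andP[/hd1 v1 _] /andP[_ /hd2].
rewrite -fv => v2; have := nm_triB (f w) (f v) (c * cis T).
rewrite [nm (f w - f v)]nmB => v3; apply: ltW.
by move: v1 v2 v3; lra.
Qed.

(** * Ends of a maximal curve that accumulates at a non-regular point *)

Section Ends.
Variable z : C R.
Hypotheses (nz : forall w, regular w -> w != z)
  (Hz : forall r, 0 < r -> exists2 w, mcurve w & nm (w - z) < r).

(** With a repeated value, the whole image would be that of the compact [[s, t]], which keeps a
    positive distance from the non-regular point [z]. *)
Lemma mlift_inj s t : ldom s -> ldom t -> mlift s = mlift t -> s = t.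
Proof.
wlog st : s t / s < t => [h|] Ds Dt e.
  have [/h->//|/h h'|//] := ltgtP s t; by rewrite h'.
exfalso; pose P := t - s; have P0 : 0 < P by rewrite subr_gt0.
have down x : ldom x -> ldom (x - P) /\ mlift (x - P) = mlift x.
  by move=> Dx; rewrite /P opprB; exact: (mlift_shift Ds Dt e Dx).
have up x : ldom x -> ldom (x + P) /\ mlift (x + P) = mlift x.
  by move=> Dx; exact: (mlift_shift Dt Ds (esym e) Dx).
(* At most [n] translations by the period bring [x] into [[s, t]], from the right here and from the
   left in [small]. *)
have big n : forall x, ldom x -> s <= x -> x < s + P *+ n -> exists2 y, s <= y <= t & mlift y = mlift x.
  elim: n => [|n IH] x Dx sx; first by rewrite mulr0n addr0 ltNge sx.
  rewrite mulrS => xn; have [xt|tx] := leP x t; first by exists x; rewrite ?sx.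
  have [Dy <-] := down _ Dx; apply: IH; [exact: Dy|rewrite /P; move: tx; lra|].
  by rewrite ltrBlDr -addrA [_ + P]addrC.
have small n : forall x, ldom x -> x <= t -> t - P *+ n < x -> exists2 y, s <= y <= t & mlift y = mlift x.
  elim: n => [|n IH] x Dx xt; first by rewrite mulr0n subr0 ltNge xt.
  rewrite mulrS => xn; have [sx|xs] := leP s x; first by exists x; rewrite ?sx.
  have [Dy <-] := up _ Dx; apply: IH; [exact: Dy|rewrite /P; move: xs; lra|].
  by move: xn; rewrite opprD addrA; lra.
have [m m0 hm] : exists2 m : R, 0 < m & forall y, s <= y <= t -> m <= nm (mlift y - z).
  apply: curve_dist_pos; first exact: ltW.
  move=> y syt; have [cy ry _ _] := mliftP (ldom_interval Ds Dt syt).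
  by split; [exact: cy|exact: nz].
have [_ [x Dx <-]] := Hz m0; apply/negP; rewrite -leNgt.
have [k hk] := mulrn_unbounded (`|x| + `|s| + `|t|) P0.
have hx := ler_norm x; have hs := ler_norm (- s); have ht := ler_norm t.
have hx' := ler_norm (- x); rewrite !normrN in hs hx'.
have a1 := normr_ge0 s; have a2 := normr_ge0 t.
have [xs|sx] := leP s x.
  by have [|y ys <-] := big k x Dx xs; [move: hk; lra|exact: hm].
have [||y ys <-] := small k x Dx; [by move: sx st; lra|move: hk; lra|exact: hm].
Qed.

(** [sg] treats both directions at once. The points at the angles [2 pi k] are distinct and share
    the value [c0] of [f], which would not be isolated at a cluster point of them in [L]. *)
Lemma ldom_bounded (sg : R) : sg = 1 \/ sg = -1 -> exists2 x : R, 0 <= x & ~ ldom (sg * x).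
Proof.
move=> hsg; apply: contrapT => hD.
have D (x : R) : 0 <= x -> ldom (sg * x).
  by move=> x0; apply: contrapT => nD; apply: hD; exists x.
pose a k : R := pi *+ 2 *+ k; have pi0 : 0 < (pi *+ 2 : R) by rewrite pmulrn_lgt0 ?pi_gt0.
have a0 k : 0 <= a k by rewrite (mulrn_wge0 _ (ltW pi0)).
have cisa k : cis (sg * a k) = 1.
  have e : cis (a k) = 1.
    by elim: k => [|k IH]; rewrite /a; [rewrite mulr0n; exact: cis0|rewrite mulrS cisD cis2pi mul1r; exact: IH].
  by case: hsg => ->; rewrite ?mul1r ?mulN1r ?cisN e ?invr1.
have [v Lv hv] : exists2 v, L v & forall r N, 0 < r -> exists2 n, (N <= n)%N & nm (mlift (sg * a n) - v) < r.
  by apply: (compact_cluster cL) => n; have [_ [Ln _] _ _] := mliftP (D _ (a0 n)); exact: Ln.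
have fa n : f (mlift (sg * a n)) = c0.
  by have [_ _ -> _] := mliftP (D _ (a0 n)); rewrite cisa mulr1.
have fv : f v = c0.
  rewrite -[c0]mulr1 -cis0; apply: (value_cluster Lv) => e e0.
  have [n _ hn] := hv e 0%N e0; exists (mlift (sg * a n)), 0.
  rewrite subrr normr0 cis0 mulr1 fa; split; [exact: hn|exact: e0|reflexivity].
have [r r0 hr] := value_isolated Lv; rewrite fv in hr.
have [n _ /hr -/(_ (fa n)) en] := hv r 0%N r0.
have [m nm_ /hr -/(_ (fa m)) em] := hv r n.+1 r0.
have := mlift_inj (D _ (a0 n)) (D _ (a0 m)); rewrite en em => /(_ erefl) e.
have : a n = a m.
  by case: hsg e => ->; [rewrite !mul1r|rewrite !mulN1r => /oppr_inj].
by move=> /(mulrIn (lt0r_neq0 pi0)) nm'; move: nm_; rewrite nm' ltnn.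
Qed.

Lemma ldom_sup (sg : R) : sg = 1 \/ sg = -1 ->
  exists2 T : R, 0 < T & forall x : R, 0 <= x -> ldom (sg * x) <-> x < T.
Proof.
move=> hsg.
have asg y := normr_sg y hsg.
have [D0 _] := ldom0.
have dn (x y : R) : 0 <= x <= y -> ldom (sg * y) -> ldom (sg * x).
  case: hsg => ->; rewrite ?mul1r ?mulN1r => /andP[x0 xy] Dy.
    by apply: (ldom_interval D0 Dy); rewrite x0.
  by apply: (ldom_interval Dy D0); rewrite lerN2 xy oppr_le0.
have up (x : R) : ldom (sg * x) -> exists2 d : R, 0 < d & forall y, `|y - x| < d -> ldom (sg * y).
  move=> /mliftP[_ _ _ [d d0 hd]]; exists d; [exact: d0|move=> y yx; apply: hd].
  by rewrite -mulrBr asg.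
pose S := [set x | 0 <= x /\ ldom (sg * x)].
have [B B0 hB] := ldom_bounded hsg.
have ubS : ubound S B.
  by move=> x [x0 Dx]; rewrite leNgt; apply/negP => /ltW Bx; apply: hB; apply: dn Dx; rewrite B0.
have S0 : S 0 by split; [exact: lexx|rewrite mulr0; exact: D0].
have hS : has_sup S by split; [exists 0|exists B].
pose T := sup S.
have DT (x : R) : 0 <= x -> ldom (sg * x) <-> x < T.
  move=> x0; split=> [/up[d d0 hd]|/(sup_gt (proj1 hS))[y [y0 Dy] xy]].
    apply: (@lt_le_trans _ _ (x + d / 2)); first by rewrite ltrDl divr_gt0.
    apply: (sup_upper_bound hS); split; first by move: x0 d0; lra.
    by apply: hd; rewrite addrC addKr gtr0_norm; move: d0; lra.
  by apply: (dn x y) Dy; rewrite x0 (ltW xy).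
exists T; last exact: DT.
by apply/(DT _ (lexx 0)); rewrite mulr0; exact: D0.
Qed.

(** Cluster points at the end exist by compactness and have the value [c0 * cis (sg * T)]. At a
    regular one, a chart would extend the curve past [T]. As this value is isolated, the curve
    cannot meet a small circle around the cluster point arbitrarily late, so it converges. *)
Lemma ldom_end (sg : R) : sg = 1 \/ sg = -1 -> exists (T : R) v, [/\ 0 < T,
  forall x : R, 0 <= x -> ldom (sg * x) <-> x < T, L v, ~ regular v &
  forall r, 0 < r -> exists2 d : R, 0 < d & forall x : R, T - d < x < T -> nm (mlift (sg * x) - v) < r].
Proof.
move=> hsg; have asg y := normr_sg y hsg.
have [T T0 DT] := ldom_sup hsg.
have contS (x : R) : 0 <= x < T -> forall r : R, 0 < r ->
    exists2 d : R, 0 < d & forall y, `|y - x| < d -> nm (mlift (sg * y) - mlift (sg * x)) < r.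
  move=> /andP[x0 /(DT x x0)/mliftP[c _ _ _]] r r0.
  have [d d0 hd] := cvgr_eps c r0; exists d; [exact: d0|move=> y yx; apply: hd; rewrite -mulrBr asg; exact: yx].
have clus (u : nat -> R) : (forall n, [/\ 0 <= u n, u n < T & T - T / n.+1%:R < u n]) ->
    exists v, [/\ L v, f v = c0 * cis (sg * T) & forall r d : R, 0 < r -> 0 < d -> exists n,
      `|u n - T| < d /\ nm (mlift (sg * u n) - v) < r].
  move=> hu; have Lu n : L (mlift (sg * u n)).
    by have [h1 /(DT _ h1)/mliftP[_ [h2 _] _ _] _] := hu n; exact: h2.
  have [v Lv hv] := compact_cluster cL Lu.
  have near (r d : R) : 0 < r -> 0 < d -> exists n, `|u n - T| < d /\ nm (mlift (sg * u n) - v) < r.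
    move=> r0 d0; have [N hN] := harmonic_lt T0 d0; have [n Nn nr] := hv r N r0.
    exists n; split; last exact: nr.
    have [_ h2 h3] := hu n; have h4 := hN n Nn; rewrite ltr_norml.
    move: (T / n.+1%:R) h3 h4 => q h3 h4.
    by apply/andP; split; move: h2 h3 h4 d0; lra.
  exists v; split; [exact: Lv| |exact: near].
  apply: (value_cluster Lv) => e e0; have [n [h1 h2]] := near e e e0 e0.
  exists (mlift (sg * u n)), (sg * u n); rewrite -mulrBr asg; split; [exact: h2|exact: h1|].
  by have [h3 /(DT _ h3)/mliftP[_ _ h4 _] _] := hu n; exact: h4.
(* [T - T / n.+2%:R] lies strictly between [T - T / n.+1%:R] and [T], as [clus] requires, and is
   nonnegative. *)
have u0 n := harmonic_approach n T0.
have [v [Lv fv hv]] := clus _ u0.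
exists T, v; split; [exact: T0|exact: DT|exact: Lv| |].
  move=> rv; have [h0 [r [psi [h00 r0 l psiT [surj inj]]]]] := chart_at rv fv.
  have [hl] := l; have TT : sg * T - h0 < sg * T < sg * T + h0 by apply/andP; split; lra.
  have [cT _ _] := hl _ TT; have [d d0 hd] := cvgr_eps cT r0; rewrite psiT in hd.
  have m0 : 0 < Num.min d h0 by rewrite lt_min d0.
  have [n []] := hv r _ r0 m0; have [x0 xT _] := u0 n; set x := T - _ in x0 xT *.
  rewrite lt_min => /andP[xd xh] xr.
  have xI : sg * T - h0 < sg * x < sg * T + h0.
    by move: xh; rewrite -asg mulrBr distrC ltr_norml => /andP[h1 h2]; apply/andP; split; lra.
  have Dx : ldom (sg * x) by apply/DT.
  have [_ [Lx _] fx _] := mliftP Dx; have [_ [Lx' _] fx'] := hl _ xI.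
  have ex : mlift (sg * x) = psi (sg * x).
    apply: (inj _ _ xr _ Lx Lx' _); last by rewrite fx.
    by apply: hd; rewrite -mulrBr asg.
  have [DT' _] := ldom_maximal l xI Dx ex TT.
  by move: DT' => /(DT _ (ltW T0)); rewrite ltxx.
move=> r' r'0; have [r1 r10 hr1] := value_isolated Lv.
pose r := Num.min r' r1; have r0 : 0 < r by rewrite lt_min r'0.
(* Near [T] the distance to [v] is never [r / 2]: otherwise such times would yield a cluster point
   on that circle with the same value as [v]. *)
have [d d0 hd] : exists2 d : R, 0 < d & forall x : R, 0 <= x -> T - d < x < T -> nm (mlift (sg * x) - v) != r / 2.
  apply: contrapT => hn.
  have hn' (d : R) : 0 < d -> exists x : R, [/\ 0 <= x, x < T, T - d < x & nm (mlift (sg * x) - v) = r / 2].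
    move=> d0; apply: contrapT => hx; apply: hn; exists d; first exact: d0.
    by move=> x x0 /andP[x1 x2]; apply/eqP => e; apply: hx; exists x.
  have /choice[u hu] : forall n, exists x : R, [/\ 0 <= x, x < T, T - T / n.+1%:R < x & nm (mlift (sg * x) - v) = r / 2].
    by move=> n; apply: hn'; rewrite divr_gt0.
  have [|w [Lw fw hw]] := clus u; first by move=> n; have [] := hu n.
  have nw : nm (w - v) = r / 2.
    apply/eqP; rewrite -subr_eq0 -normr_eq0 eq_le normr_ge0 andbT; apply/ler_addgt0Pr => e e0; rewrite add0r.
    have [n [_ hn1]] := hw e 1 e0 ltr01; have [_ _ _ hn2] := hu n; rewrite -hn2 distrC.
    apply: (le_trans (nm_dist _ _)); rewrite opprB addrA subrK; exact: ltW.
  have : w = v.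
    apply: hr1; last by rewrite fw.
    by rewrite nw (@lt_le_trans _ _ r)// ?ge_min ?lexx ?orbT//; move: r0; lra.
  by move=> wv; move: nw r0; rewrite wv subrr nm0; lra.
pose d' := Num.min d T; have d'0 : 0 < d' by rewrite lt_min d0.
have [d'd d'T] : d' <= d /\ d' <= T by rewrite !ge_min !lexx orbT.
have r20 : 0 < r / 2 by rewrite divr_gt0.
exists d'; first exact: d'0.
have [n [xd xr]] := hv _ _ r20 d'0; have [x0 xT _] := u0 n; set x := T - _ in x0 xT xd xr.
have rr' : r / 2 < r' by rewrite (@lt_le_trans _ _ r) ?ge_min ?lexx//; move: r0; lra.
move=> y yT; apply: lt_trans rr'; move: y yT.
clearbody d' x r.
have rng (y : R) : T - d' < y < T -> 0 <= y < T /\ T - d < y < T.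
  by move=> /andP[y1 ->]; rewrite !andbT; split; [move: y1 d'T|move: y1 d'd]; lra.
(* Never on the circle, the curve stays inside because it is inside at [x]. *)
apply: (@interval_ind R _ (fun y => nm (mlift (sg * y) - v) < r / 2) x).
- exact: itvoo_interval.
- move=> y /rng[y0 _] yr.
  have [e e0 he] := contS y y0 (r / 2 - nm (mlift (sg * y) - v)) ltac:(by rewrite subr_gt0).
  exists e; [exact: e0|move=> y' _ /he h].
  have := nm_triB (mlift (sg * y')) (mlift (sg * y)) v; move: h; lra.
- move=> y /rng[y0 yd] /negP; rewrite -leNgt le_eqVlt eq_sym (negbTE (hd y _ yd)) ?(andP y0).1//= => yr.
  have [e e0 he] := contS y y0 (nm (mlift (sg * y) - v) - r / 2) ltac:(by rewrite subr_gt0).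
  exists e; [exact: e0|move=> y' _ /he h h'].
  by have := nm_triB (mlift (sg * y)) (mlift (sg * y')) v; rewrite nmB in h; move: h h'; lra.
- apply/andP; split; last exact: xT.
  by move: xd; rewrite ltr_norml => /andP[h1 _]; move: h1; lra.
- exact: xr.
Qed.

End Ends.

(** * Sets open and closed in the regular part of L *)

Definition adherent (A : set (C R)) p := forall r, 0 < r -> exists2 w, A w & nm (w - p) < r.

(** Through these sets, arbitrary paths can be compared with maximal curves by their images
    alone. *)
Definition regular_clopen (O : set (C R)) := [/\ O `<=` regular,
  forall p, O p -> exists2 r : R, 0 < r & forall w, nm (w - p) < r -> L w -> O w &
  forall p, regular p -> adherent O p -> O p].

Lemma regular_clopen_curve O (I : set R) (c : R -> C R) t0 : regular_clopen O ->
  is_interval I -> (forall t, I t -> c x @[x --> t] --> c t /\ regular (c t)) ->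
  I t0 -> O (c t0) -> forall t, I t -> O (c t).
Proof.
move=> [_ oO clO] itvI hc It0 Ot0; apply: (interval_ind itvI _ _ It0 Ot0).
- move=> t It Ot; have [ct _] := hc t It; have [r r0 hr] := oO _ Ot.
  have [d d0 hd] := cvgr_eps ct r0; exists d; first exact: d0.
  by move=> x Ix /hd xr; apply: hr xr _; have [_ []] := hc x Ix.
- move=> t It nOt; have [ct rt] := hc t It; apply: contrapT => h; apply: nOt.
  apply: clO; first exact: rt.
  move=> r r0; have [d d0 hd] := cvgr_eps ct r0; apply: contrapT => h'; apply: h.
  exists d; first exact: d0.
  by move=> x Ix /hd xr Ox; apply: h'; exists (c x).
Qed.

Lemma mcurve_clopen : regular_clopen mcurve.
Proof.
have reg p : mcurve p -> regular p by move=> [t /mliftP[_ h _ _] <-].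
split; first exact: reg.
- move=> p Mp; apply: (mcurve_saturated (reg _ Mp)) => r r0.
  by exists p; [exact: Mp|rewrite subrr nm0].
- move=> p rp hp; have [r r0 hr] := mcurve_saturated rp hp.
  by apply: hr; [rewrite subrr nm0|case: rp].
Qed.

Lemma mcurve_start : mcurve p0.
Proof. by have [D0 e0] := ldom0; exists 0. Qed.

(** [ldom] is an interval, so membership propagates along the whole curve; with [mcurve_clopen],
    this makes [mcurve] a connected component of the regular part. *)
Lemma mcurve_least O p : regular_clopen O -> mcurve p -> O p -> mcurve `<=` O.
Proof.
move=> hO [s Ds sp]; rewrite -sp => Os _ [t Dt <-].
apply: (@regular_clopen_curve O ldom mlift s hO _ _ Ds Os t Dt).
- by move=> x y Dx Dy u; exact: ldom_interval.
- by move=> x /mliftP[].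
Qed.

(** [vm] is the limit at the smaller angle [a], [vp] at the larger angle [b]; they may be the same
    vertex. *)
Definition curve_ends (a b : R) vm vp := [/\ a < 0, 0 < b,
  forall t, ldom t <-> a < t < b, vertices f L vm /\ vertices f L vp &
  forall r, 0 < r -> exists2 d : R, 0 < d & forall t,
    (a < t < a + d -> nm (mlift t - vm) < r) /\ (b - d < t < b -> nm (mlift t - vp) < r)].

Lemma vertex_regular p : L p -> ~ regular p -> vertices f L p.
Proof.
move=> Lp h; split; first exact: Lp.
by apply/eqP; apply: contraT => h'; case: h; split; [exact: Lp|exact: h'].
Qed.

Lemma regular_neq_vertex p w : vertices f L p -> regular w -> w != p.
Proof. by move=> [_ dp] [_]; apply: contra_neq => ->. Qed.

Lemma curve_ends_exist p : vertices f L p -> adherent mcurve p ->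
  exists a b vm vp, curve_ends a b vm vp.
Proof.
move=> vp hp; have np := regular_neq_vertex vp.
have [T1 [v1 [T10 D1 L1 n1 c1]]] := ldom_end np hp (sg := 1) (or_introl erefl).
have [T2 [v2 [T20 D2 L2 n2 c2]]] := ldom_end np hp (sg := -1) (or_intror erefl).
have V1 := vertex_regular L1 n1; have V2 := vertex_regular L2 n2; clear n1 n2.
(* With [sg = -1] the angle is measured backwards, whence the lower end [- T2]. *)
exists (- T2), T1, v2, v1; split; [by rewrite oppr_lt0|exact: T10| | |].
- move=> t; have [t0|t0] := leP 0 t.
    have := D1 t t0; rewrite mul1r => ->; split=> [-> |/andP[]//].
    by rewrite andbT (lt_le_trans _ t0) ?oppr_lt0.
  have := D2 (- t); rewrite mulN1r opprK oppr_ge0 => /(_ (ltW t0)) ->.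
  rewrite ltrNl; split=> [-> |/andP[]//]; exact: lt_trans t0 T10.
- by split; [exact: V2|exact: V1].
- move=> r r0; have [d1 d10 h1] := c1 r r0; have [d2 d20 h2] := c2 r r0.
  exists (Num.min d1 d2); first by rewrite lt_min d10.
  have [m1 m2] : Num.min d1 d2 <= d1 /\ Num.min d1 d2 <= d2 by rewrite !ge_min !lexx orbT.
  move=> t; split=> /andP[t1 t2].
    have := h2 (- t); rewrite mulN1r opprK; apply; apply/andP; split; move: t1 t2 m2; lra.
  by have := h1 t; rewrite mul1r; apply; rewrite t2 andbT; move: t1 m1; lra.
Qed.

End MaximalLift.

(** * Edges are the maximal curves with their end vertices *)

Lemma within_eps (g : R -> C R) (a b : R) : {within `[a, b], continuous g} <->
  forall x, a <= x <= b -> forall e, 0 < e -> exists2 d : R, 0 < d &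
    forall y, a <= y <= b -> `|y - x| < d -> nm (g y - g x) < e.
Proof.
split=> [/subspace_continuousP h x xab e e0|h].
  have /ccvgP/(_ e e0)/rnbhsP[d d0 hd] := h x ltac:(by rewrite /= in_itv).
  by exists d; [exact: d0|move=> y yab /hd; apply; rewrite /= in_itv].
apply/subspace_continuousP => x /=; rewrite in_itv /= => xab.
apply/ccvgP => e e0; have [d d0 hd] := h x xab e e0.
by apply/rnbhsP; exists d; [exact: d0|move=> y /hd yd; rewrite /= in_itv; exact: yd].
Qed.

Lemma path_closed (g : R -> C R) (a b : R) p : {within `[a, b], continuous g} ->
  adherent (g @` `[a, b]) p -> exists2 t, a <= t <= b & g t = p.
Proof.
move=> cg hp; have cK := continuous_compact cg (@segment_compact _ a b).
have clK : closed (g @` `[a, b]) by apply: compact_closed => //; exact: norm_hausdorff.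
have [|t] := clK p; last by rewrite /= in_itv /= => tab; exists t.
by move=> A /cnbhsP[r r0 hr]; have [w Kw wr] := hp r r0; exists w; split; [|exact: hr].
Qed.
Lemma within_interior (g : R -> C R) (a b t : R) : {within `[a, b], continuous g} ->
  a < t < b -> g x @[x --> t] --> g t.
Proof.
move=> /within_eps hg /andP[at_ tb]; apply/ccvgP => e e0.
have [d d0 hd] := hg t ltac:(by rewrite !ltW) e e0; apply/rnbhsP.
exists (Num.min d (Num.min (t - a) (b - t))); first by rewrite !lt_min d0 !subr_gt0 at_.
move=> x; rewrite !lt_min => /and3P[xd]; rewrite !ltr_norml => /andP[h1 h2] /andP[h3 h4].
by apply: hd; [apply/andP; split; lra|exact: xd].
Qed.

(** Open: in a chart coordinate the path is an injective real function, and [injective_cover]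
    applies. Closed: the whole path is compact and its two end points are not regular. *)
Lemma path_clopen (g : R -> C R) : {within `[0, 1], continuous g} ->
  {in `]0, 1[ &, injective g} -> (forall t, 0 < t < 1 -> regular (g t)) ->
  vertices f L (g 0) -> vertices f L (g 1) ->
  regular_clopen (g @` [set t | 0 < t < 1]).
Proof.
move=> cg inj reg v0 v1; split; first by move=> _ [t /reg h <-].
- move=> _ [t0 t01 <-]; have [/andP[t00 t0l]] := t01.
  have [_ [r [_ [x [_ r0 _ _ [_ _ xinj x0 cx]]]]]] := regular_chart (reg _ t01).
  have [d d0 hd] := cvgr_eps (within_interior cg t01) r0.
  (* Halved so that the closed interval [[t0 - m, t0 + m]] stays inside []0, 1[] and is mapped into
     the chart. *)
  pose m := Num.min d (Num.min t0 (1 - t0)) / 2.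
  have m0 : 0 < m by rewrite divr_gt0// !lt_min d0 t00 subr_gt0.
  have [md mt ml] : [/\ m < d, m < t0 & m < 1 - t0].
    have : m < Num.min d (Num.min t0 (1 - t0)) by rewrite /m; move: m0; rewrite /m; lra.
    by rewrite !lt_min => /and3P[].
  clearbody m.
  have rng t : t0 - m <= t <= t0 + m -> 0 < t < 1 /\ nm (g t - g t0) < r.
    move=> /andP[h1 h2]; split; first by apply/andP; split; lra.
    by apply: hd; rewrite ltr_norml; apply/andP; split; lra.
  have cxg : {within `[t0 - m, t0 + m], continuous (fun t => x (g t))}.
    apply: continuous_in_subspaceT => t /set_mem /=; rewrite in_itv /= => /rng[tI tr].
    exact: (cvg_comp _ _ (within_interior cg tI) (cx _ tr)).
  have xginj t s : t0 - m <= t <= t0 + m -> t0 - m <= s <= t0 + m -> x (g t) = x (g s) -> t = s.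
    move=> /rng[tI tr] /rng[sI sr] e; apply: inj; rewrite ?in_itv//.
    by apply: xinj e => //; [case: (reg _ tI)|case: (reg _ sI)].
  have tm : t0 - m < t0 < t0 + m by apply/andP; split; lra.
  have [k k0 hk] := injective_cover (g := fun t => x (g t)) tm cxg x0 xginj.
  have cx0 := cx (g t0); rewrite subrr nm0 in cx0.
  have /cvgrPdist_lt /(_ k k0) /cnbhsP[r' r'0 hr'] := cx0 r0.
  exists (Num.min r r'); first by rewrite lt_min r0.
  move=> w; rewrite lt_min => /andP[wr /hr']; rewrite x0 sub0r normrN => /hk[t /rng[tI tr] xt] Lw.
  exists t; first exact: tI.
  by apply: xinj xt => //; case: (reg _ tI).
- move=> p rp hp; have [|t /andP[]] := path_closed (p := p) cg.
    move=> r r0; have [_ [t tI <-] tr] := hp r r0; exists (g t); last exact: tr.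
    by exists t => //=; rewrite in_itv /=; case/andP: tI => /ltW -> /ltW ->.
  rewrite !le_eqVlt => /predU1P[<-|t0] /predU1P[h|t1] gp; try by
    (exfalso; move: rp; rewrite -gp ?h; case: v0 v1 => [_ e0] [_ e1] [_]; rewrite ?e0 ?e1 eqxx).
  by exists t; [rewrite /= t0|].
Qed.

Lemma edge_adherent v w (e : set (C R)) u A : edge f L v w e -> A `<=` e -> adherent A u -> e u.
Proof.
move=> [g [[cg _ ->] _]] sub hu; have [|t tI <-] := path_closed (p := u) cg.
  by move=> r r0; have [x /sub Ax xr] := hu r r0; exists x.
by exists t => //; rewrite /= in_itv.
Qed.

Lemma path_adherent (g : R -> C R) (t : R) : {within `[0, 1], continuous g} -> 0 <= t <= 1 ->
  adherent (g @` [set t | 0 < t < 1]) (g t).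
Proof.
move=> /within_eps cg t01 r r0; have [d d0 hd] := cg t t01 r r0.
pose q := Num.min d 1 / 2; have q0 : 0 < q by rewrite divr_gt0// lt_min d0 ltr01.
have : q < Num.min d 1 by rewrite /q; move: q0; rewrite /q; lra.
rewrite lt_min => /andP[qd q1]; clearbody q; case/andP: t01 => t0 t1.
(* Moves [t] towards the midpoint by the fraction [q], which lands in []0, 1[] even from an end
   point. *)
pose s := t + q * (1 / 2 - t).
have s01 : 0 < s < 1 by rewrite /s; apply/andP; split; nra.
exists (g s); first by exists s.
apply: hd; first by case/andP: s01 => /ltW -> /ltW ->.
by rewrite /s ltr_norml; apply/andP; split; nra.
Qed.

(** The open path and the maximal curve through one of its points are both connected and clopen in
    the regular part, so each contains the other. *)
Lemma edge_curve v w (e : set (C R)) : edge f L v w e -> exists p0,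
  [/\ regular p0, e = mcurve p0 `|` [set v; w], vertices f L v /\ vertices f L w &
      adherent (mcurve p0) v /\ adherent (mcurve p0) w].
Proof.
move=> [g [[cg inj eE] [eL [vv vw] [g0 g1] reg]]].
have regI t : 0 < t < 1 -> regular (g t).
  move=> tI; have Lt : L (g t).
    by apply: eL; rewrite eE; exists t => //=; rewrite in_itv /=; case/andP: tI => /ltW -> /ltW ->.
  split; first exact: Lt.
  by apply/eqP => dt; apply: (reg t); [rewrite in_itv|split].
rewrite -g0 in vv *; rewrite -g1 in vw *.
pose c : R := 1 / 2; have h2 : 0 < c < 1 by rewrite /c; apply/andP; split; lra.
clearbody c.
have r2 := regI _ h2; exists (g c).
have cO := path_clopen cg inj regI vv vw.
have OE : mcurve (g c) = g @` [set t | 0 < t < 1].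
  apply/seteqP; split.
    by apply: (mcurve_least cO (mcurve_start r2)); exists c.
  have hg (x : R) : 0 < x < 1 -> g y @[y --> x] --> g x /\ regular (g x).
    by move=> xI; split; [exact: within_interior cg xI|exact: regI].
  move=> _ [t tI <-].
  exact: (regular_clopen_curve (mcurve_clopen _) (@itvoo_interval R 0 1) hg h2 (mcurve_start r2) tI).
rewrite OE; split.
- exact: r2.
- rewrite eE; apply/seteqP; split.
    move=> _ [t /= + <-]; rewrite in_itv /= => /andP[]; rewrite !le_eqVlt.
    move=> /predU1P[<- _|t0 /predU1P[->|t1]]; [by right; left|by right; right|left].
    by exists t; [rewrite /= t0|].
  move=> _ [[t /andP[t0 t1] <-]|[->|->]].
  + by exists t => //=; rewrite in_itv /= !ltW.
  + by exists 0 => //=; rewrite in_itv /= lexx ler01.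
  + by exists 1 => //=; rewrite in_itv /= lexx ler01.
- by split.
- by split; apply: path_adherent; rewrite ?lexx ?ler01.
Qed.

Lemma curve_ends_adherent p a b vm vp : curve_ends p a b vm vp ->
  adherent (mcurve p) vm /\ adherent (mcurve p) vp.
Proof.
move=> [a0 b0 D _ hc]; split=> r r0; have [d d0 hd] := hc r r0.
  pose q := Num.min d (- a) / 2; have : 0 < Num.min d (- a) by rewrite lt_min d0 oppr_gt0.
  move=> m0; have : q < Num.min d (- a) by rewrite /q; lra.
  rewrite lt_min => /andP[qd qa]; have q0 : 0 < q by rewrite divr_gt0.
  clearbody q; exists (mlift p (a + q)).
    by exists (a + q) => //; apply/D; apply/andP; split; lra.
  by apply: (hd _).1; apply/andP; split; lra.
pose q := Num.min d b / 2; have : 0 < Num.min d b by rewrite lt_min d0.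
move=> m0; have : q < Num.min d b by rewrite /q; lra.
rewrite lt_min => /andP[qd qb]; have q0 : 0 < q by rewrite divr_gt0.
clearbody q; exists (mlift p (b - q)).
  by exists (b - q) => //; apply/D; apply/andP; split; lra.
by apply: (hd _).2; apply/andP; split; lra.
Qed.

(** The angle interval is rescaled affinely to []0, 1[] and the limit vertices are put at 0 and 1,
    where [curve_ends] gives continuity. *)
Lemma curve_edge p a b vm vp : regular p -> curve_ends p a b vm vp ->
  edge f L vm vp (mcurve p `|` [set vm; vp]).
Proof.
move=> rp hce; have [hvm _] := curve_ends_adherent hce.
have [a0 b0 D [Vm Vp] hc] := hce.
have inj := mlift_inj (fun w => @regular_neq_vertex _ w Vm) hvm.
have ab : 0 < b - a by lra.
pose h t := a + t * (b - a).
have hI t : 0 < t < 1 -> a < h t < b.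
  by move=> /andP[t0 t1]; rewrite /h; apply/andP; split; nra.
have hDE t : 0 < t < 1 -> ldom p (h t) by move=> /hI tI; apply/D.
pose g t := if t <= 0 then vm else if 1 <= t then vp else mlift p (h t).
have gI t : 0 < t < 1 -> g t = mlift p (h t).
  by move=> /andP[t0 t1]; rewrite /g leNgt t0 /= leNgt t1.
have g0 : g 0 = vm by rewrite /g lexx.
have g1 : g 1 = vp by rewrite /g ler10 lexx.
have eE : mcurve p `|` [set vm; vp] = g @` `[0, 1].
  apply/seteqP; split.
    move=> _ [[t /D /andP[at_ tb] <-]|[->|->]].
    + pose s := (t - a) / (b - a); have s01 : 0 < s < 1.
        rewrite /s (ltr_pdivrMr _ _ ab) mul1r ltrD2r tb andbT.
        by apply: divr_gt0 ab; rewrite subr_gt0.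
      exists s; first by rewrite /= in_itv /=; case/andP: s01 => /ltW -> /ltW ->.
      by rewrite (gI _ s01) /h /s divfK ?lt0r_neq0// addrC subrK.
    + by exists 0 => //=; rewrite in_itv /= lexx ler01.
    + by exists 1 => //=; rewrite in_itv /= lexx ler01.
  move=> _ [t /= + <-]; rewrite in_itv /= => /andP[]; rewrite !le_eqVlt.
  move=> /predU1P[<- _|t0 /predU1P[->|t1]]; [by right; left|by right; right|left].
  by exists (h t); [apply: hDE; rewrite t0|rewrite gI ?t0].
exists g; split; split.
- apply/within_eps => x /andP[x0 x1] e e0; have [d d0 hd] := hc e e0.
  have q0 : 0 < d / (b - a) by rewrite divr_gt0.
  have [xE|xn0] := eqVneq x 0.
    exists (Num.min 1 (d / (b - a))); first by rewrite lt_min ltr01.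
    move=> y /andP[y0 y1]; rewrite xE subr0 ger0_norm// lt_min => /andP[yl yd]; rewrite g0.
    have [->|yn0] := eqVneq y 0; first by rewrite g0 subrr nm0.
    have y0' : 0 < y by rewrite lt_neqAle eq_sym yn0.
    rewrite gI ?y0'//; apply: (hd _).1; rewrite /h; rewrite ltr_pdivlMr// in yd.
    by apply/andP; split; nra.
  have [xE1|xn1] := eqVneq x 1.
    exists (Num.min 1 (d / (b - a))); first by rewrite lt_min ltr01.
    move=> y /andP[y0 y1]; rewrite xE1 distrC ger0_norm ?subr_ge0// lt_min => /andP[yl yd]; rewrite g1.
    have [->|yn1] := eqVneq y 1; first by rewrite g1 subrr nm0.
    have y1' : y < 1 by rewrite lt_neqAle yn1.
    have y0' : 0 < y by lra.
    rewrite gI ?y0'//; apply: (hd _).2; rewrite /h; rewrite ltr_pdivlMr// in yd.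
    by apply/andP; split; nra.
  have xI : 0 < x < 1 by rewrite !lt_neqAle eq_sym xn0 xn1 x0.
  have [cm _ _ _] := mliftP (hDE x xI).
  have [d' d'0 hd'] := cvgr_eps cm e0; case/andP: (xI) => x0' x1'.
  have q'0 : 0 < d' / (b - a) by rewrite divr_gt0.
  exists (Num.min (d' / (b - a)) (Num.min x (1 - x))); first by rewrite !lt_min q'0 x0' subr_gt0.
  move=> y yI; rewrite !lt_min => /and3P[yd]; rewrite !ltr_norml => /andP[h1 h2] /andP[h3 h4].
  have yI' : 0 < y < 1 by apply/andP; split; lra.
  rewrite !gI//; apply: hd'; rewrite /h opprD addrACA subrr add0r -mulrBl normrM (gtr0_norm ab).
  by rewrite -ltr_pdivlMr.
- move=> t s; rewrite !in_itv /= => tI sI; rewrite !gI// => /inj.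
  move=> /(_ (hDE _ tI) (hDE _ sI)) /addrI; exact: (mulIf (lt0r_neq0 ab)).
- exact: eE.
- move=> _ [[t /mliftP[_ [Lt _] _ _] <-]|[->|->]]; [exact: Lt|by case: Vm|by case: Vp].
- by split.
- by split.
- move=> t; rewrite in_itv /= => tI [_ dt]; rewrite gI// in dt.
  by have [_ [_ dt'] _ _] := mliftP (hDE _ tI); move: dt'; rewrite dt eqxx.
Qed.

(** Both pairs of end points are the vertices adherent to the same open curve, hence agree as sets;
    a path may run against the angle, whence the two cases. *)
Lemma edgeP v w (e : set (C R)) : edge f L v w e -> exists p a b vm vp,
  [/\ regular p, curve_ends p a b vm vp, e = mcurve p `|` [set vm; vp] &
      (v = vm /\ w = vp) \/ (v = vp /\ w = vm)].
Proof.
move=> he; have [p [rp eE [vv vw] [hv hw]]] := edge_curve he.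
have [a [b [vm [vp hce]]]] := curve_ends_exist rp vv hv.
have he' := curve_edge rp hce; have [hvm hvp] := curve_ends_adherent hce.
have [_ _ _ [Vm Vp] _] := hce.
have nM u : vertices f L u -> ~ mcurve p u.
  by move=> Vu [t /mliftP[_ rt _ _] tu]; have := regular_neq_vertex Vu rt; rewrite tu eqxx.
have in' u : vertices f L u -> adherent (mcurve p) u -> u = vm \/ u = vp.
  by move=> Vu hu; have [/(nM _ Vu)|] := edge_adherent he' (@subsetUl _ _ _) hu.
have in1 u : vertices f L u -> adherent (mcurve p) u -> u = v \/ u = w.
  move=> Vu hu; have : e u by apply: (edge_adherent he _ hu); rewrite eE; exact: subsetUl.
  by rewrite eE => -[/(nM _ Vu)|].
have vwE : (v = vm /\ w = vp) \/ (v = vp /\ w = vm).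
  have := in' _ vv hv; have := in' _ vw hw; have := in1 _ Vm hvm; have := in1 _ Vp hvp.
  by move=> [->|->] [->|->] [h1|h1] [h2|h2]; subst; tauto.
exists p, a, b, vm, vp; split; [exact: rp|exact: hce| |exact: vwE].
by rewrite eE; case: vwE => -[-> ->] //; congr (_ `|` _); rewrite setUC.
Qed.

Lemma edge_sym v w (e : set (C R)) : edge f L v w e -> edge f L w v e.
Proof.
move=> [g [[cg inj eE] [eL [vv vw] [g0 g1] reg]]].
have E1 (t : R) : 1 - (1 - t) = t by rewrite opprB addrC subrK.
have I1 (t : R) : (0 <= 1 - t <= 1) = (0 <= t <= 1) by rewrite subr_ge0 gerBl andbC.
have I2 (t : R) : (0 < 1 - t < 1) = (0 < t < 1) by rewrite subr_gt0 gtrBl andbC.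
exists (fun t => g (1 - t)); split; split.
- apply/within_eps => x xI e' e0; move/within_eps: cg => /(_ (1 - x)); rewrite I1.
  move=> /(_ xI e' e0)[d d0 hd]; exists d; first exact: d0.
  move=> y yI yx; apply: hd; first by rewrite I1.
  by rewrite opprB addrC addrA subrK distrC.
- move=> t s; rewrite !in_itv /= => tI sI /inj; rewrite !in_itv /= !I2.
  by move=> /(_ tI sI) /addrI /oppr_inj.
- rewrite eE; apply/seteqP; split=> _ [t /= + <-]; rewrite in_itv /= => tI.
    by exists (1 - t); [rewrite /= in_itv /= I1|rewrite E1].
  by exists (1 - t) => //; rewrite /= in_itv /= I1.
- exact: eL.
- by split.
- by rewrite subr0 subrr.
- by move=> t; rewrite in_itv /= => tI; apply: reg; rewrite in_itv /= I2.
Qed.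

(** Dividing numerator and denominator by [cis (t / 2)] leaves [i sin (t / 2)] over
    [cos (t / 2)]. *)
Lemma cayley_cis (c : C R) t : c != 0 -> `|t| < 1 ->
  c * cis t + c != 0 /\ cayley c (c * cis t) = iC * rc (tan (t / 2)).
Proof.
move=> c_neq0 t1; pose h := t / 2; have u0 := cis_neq0 h.
have hh : `|h| < 1 / 2.
  by move: t1; rewrite /h !ltr_norml => /andP[t1 t2]; apply/andP; split; lra.
have cosh : cos h != 0.
  rewrite gt_eqF// cos_gt0_pihalf// -ltr_norml (lt_trans hh)//.
  by rewrite ltr_pM2r// (lt_le_trans _ (pi_ge2 R))// ltr1n.
have tE : cis t = cis h * cis h by rewrite -cisD; congr cis; rewrite /h; lra.
have sum : cis h + (cis h)^-1 = 2 * rc (cos h).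
  by rewrite -cisN; apply: C_inj; rewrite ?reD ?imD ?reM ?imM /= ?cosN ?sinN; ring.
have dif : cis h - (cis h)^-1 = 2 * (iC * rc (sin h)).
  by rewrite -cisN; apply: C_inj; rewrite ?reD ?imD ?reN ?imN ?reM ?imM /= ?cosN ?sinN; ring.
have s0 : cis h + (cis h)^-1 != 0 by rewrite sum mulf_neq0 ?pnatr_eq0// rc_eq0.
have hp : c * cis t + c = c * cis h * (cis h + (cis h)^-1) by rewrite tE; field.
have hm : c * cis t - c = c * cis h * (cis h - (cis h)^-1) by rewrite tE; field.
have hp0 : c * cis t + c != 0 by rewrite hp !mulf_neq0.
split; first exact: hp0.
rewrite /cayley hp hm invfM mulrACA divff ?mulf_neq0// mul1r dif sum /tan -/h rcM rcV.
by field; rewrite rc_eq0 cosh.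
Qed.

Definition sgn (j : bool) : R := if j then 1 else -1.

Lemma signed_iE j : signed_i j = iC * rc (sgn j).
Proof. by case: j; rewrite /signed_i /sgn ?rcN rc1 ?mulr1 ?mulrN1. Qed.

Lemma sgn_sgn j x : sgn j * (sgn j * x) = x.
Proof. by case: j; rewrite /sgn ?mul1r// !mulN1r opprK. Qed.

Lemma normr_sgn j x : `|sgn j * x| = `|x|.
Proof. by case: j; rewrite /sgn ?mul1r// mulN1r normrN. Qed.

Lemma tan_sgn_atan j y : tan (sgn j * atan y) = sgn j * y.
Proof. by case: j; rewrite /sgn ?mul1r ?mulN1r ?tanN atanK. Qed.

Lemma atan_small n d : (0 < n)%N -> 0 < d -> exists2 s1 : R, 0 < s1 &
  forall s, 0 < s < s1 -> 0 < atan (s ^+ n) *+ 2 < d.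
Proof.
move=> n0 d0.
have /cvgrPdist_lt/(_ _ d0) : atan (s ^+ n) *+ 2 @[s --> (0 : R)] --> (atan (0 ^+ n) *+ 2 : R).
  by apply: cvgMn; apply: continuous_cvg; [exact: continuous_atan|exact: exprn_continuous].
rewrite expr0n gtn_eqF//= atan0 mul0rn => /rnbhsP[s1 s10 h]; exists s1; first exact: s10.
move=> s /andP[s0 ss]; have sn : 0 < s ^+ n by exact: exprn_gt0.
have a0 : 0 < atan (s ^+ n) by rewrite -(atan0 R) lt_atan.
rewrite pmulrn_lgt0 ?a0//=.
by have := h s; rewrite subr0 sub0r normrN !gtr0_norm ?pmulrn_lgt0//; apply.
Qed.
(** * Edges at a vertex *)

Section Star.
Variables (z : C R) (n : nat) (s0 r0 : R) (A : bool -> 'I_n -> R -> C R).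
Hypotheses (Vz : vertices f L z) (n0 : (0 < n)%N) (s00 : 0 < s0) (r00 : 0 < r0)
  (hA : forall j k s, `|s| < s0 -> [/\ A j k x @[x --> s] --> A j k s,
     L (A j k s), s != 0 -> derive1 f (A j k s) != 0, f (A j k s) + f z != 0 &
     cayley (f z) (f (A j k s)) = signed_i j * rc s ^+ n])
  (A0 : forall j k, A j k 0 = z)
  (Ainj : forall j k k' s, `|s| < s0 -> s != 0 -> A j k s = A j k' s -> k = k')
  (Aex : forall w j s, nm (w - z) < r0 -> s != 0 ->
     cayley (f z) (f w) = signed_i j * rc s ^+ n -> `|s| < s0 /\ exists k, w = A j k s).

Lemma germ_regular j k s : 0 < s < s0 -> A j k x @[x --> s] --> A j k s /\ regular (A j k s).
Proof.
move=> /andP[sp ss]; have := hA j k (s := s); rewrite gtr0_norm// => /(_ ss)[cA LA dA _ _].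
by split; [exact: cA|split; [exact: LA|apply: dA; rewrite gt_eqF]].
Qed.

(** Without [z], an arc is a curve of regular points over an interval. *)
Lemma germ_clopen O j k s t : regular_clopen O -> 0 < s < s0 -> 0 < t < s0 ->
  O (A j k s) -> O (A j k t).
Proof.
move=> hO hs ht Os.
exact: (regular_clopen_curve hO (@itvoo_interval R 0 s0) (@germ_regular j k) hs Os ht).
Qed.

Lemma germ_near j k r : 0 < r -> exists2 d : R, 0 < d & forall s, 0 < s < d ->
  s < s0 /\ nm (A j k s - z) < r.
Proof.
move=> rp; have := hA j k (s := 0); rewrite normr0 => /(_ s00)[cA _ _ _ _].
have [d d0 hd] := cvgr_eps cA rp; exists (Num.min d s0); first by rewrite lt_min d0.
move=> s /andP[sp]; rewrite lt_min => /andP[sd ->]; split; first by [].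
by have := hd s; rewrite A0 subr0 gtr0_norm//; apply.
Qed.

Lemma germ_adherent O j k s : regular_clopen O -> 0 < s < s0 -> O (A j k s) -> adherent O z.
Proof.
move=> hO hs Os r rp; have [d d0 hd] := germ_near j k rp.
have [|h1 h2] := hd (d / 2); first by apply/andP; split; lra.
exists (A j k (d / 2)); last exact: h2.
by apply: germ_clopen Os => //; apply/andP; split; lra.
Qed.

(** The angle [e] is approached from above for [j = true] and from below for [j = false], so the
    angle of [f] grows away from [v] exactly when [j] is [true], as in [signed_i]. *)
Definition end_at p j e v := forall r, 0 < r -> exists2 d : R, 0 < d &
  forall t, 0 < sgn j * (t - e) < d -> ldom p t /\ nm (mlift p t - v) < r.

(* The angle, near an end of angle e, of the point of coordinate s on an arc. *)
Definition turn j e s : R := e + sgn j * (atan (s ^+ n) *+ 2).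

Lemma turnK j e s : sgn j * (turn j e s - e) = atan (s ^+ n) *+ 2.
Proof. by rewrite /turn addrC addKr sgn_sgn. Qed.

Lemma end_value p j e : end_at p j e z -> f z = f p * cis e.
Proof.
move=> hend; case: Vz => Lz _; apply: (value_cluster Lz) => e' e'0.
have [d d0 hd] := hend e' e'0.
pose q := Num.min d e' / 2; have m0 : 0 < Num.min d e' by rewrite lt_min d0.
have q0 : 0 < q by rewrite divr_gt0.
have : q < Num.min d e' by rewrite /q; lra.
rewrite lt_min => /andP[qd qe]; clearbody q; pose t := e + sgn j * q.
have te : sgn j * (t - e) = q by rewrite /t addrC addKr sgn_sgn.
have [|Dt tz] := hd t; first by rewrite te q0.
exists (mlift p t), t; split; first exact: tz.
- by rewrite -(normr_sgn j) te gtr0_norm.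
- by have [_ _ ft _] := mliftP Dt.
Qed.

Lemma end_cayley p j e t : end_at p j e z -> ldom p t -> `|t - e| < 1 ->
  f (mlift p t) + f z != 0 /\
  cayley (f z) (f (mlift p t)) = iC * rc (tan ((t - e) / 2)).
Proof.
move=> hend Dt te; have [_ _ ft _] := mliftP Dt; have fz := end_value hend.
have fz0 : f z != 0 by apply: level_set_neq0; apply: component_sub; case: Vz.
have -> : f (mlift p t) = f z * cis (t - e).
  by rewrite ft fz -mulrA -cisD addrC subrK.
exact: cayley_cis fz0 te.
Qed.

(** At [turn j e s] the Cayley transform of [f] along the curve is the value prescribed on the arcs
    of sign [j]. [Aex] puts one such point on an arc, and [curve_uniq] keeps the curve on that
    arc. *)
Lemma end_germ p j e : end_at p j e z -> exists k (s1 : R), [/\ 0 < s1, s1 <= s0 &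
  forall s, 0 < s < s1 -> ldom p (turn j e s) /\ mlift p (turn j e s) = A j k s].
Proof.
move=> hend; have [d d0 hd] := hend r0 r00.
have m0 : 0 < Num.min d 1 by rewrite lt_min d0 ltr01.
have [s1 s10 hs1] := atan_small n0 m0.
pose s2 := Num.min s1 s0; have s20 : 0 < s2 by rewrite lt_min s10.
have [s21 s2s0] : s2 <= s1 /\ s2 <= s0 by rewrite !ge_min !lexx orbT.
clearbody s2.
have T s : 0 < s < s2 -> [/\ ldom p (turn j e s), nm (mlift p (turn j e s) - z) < r0,
    f (mlift p (turn j e s)) + f z != 0 &
    cayley (f z) (f (mlift p (turn j e s))) = signed_i j * rc s ^+ n].
  move=> /andP[sp ss]; have := hs1 s; rewrite sp (lt_le_trans ss s21) => /(_ erefl).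
  rewrite -(turnK j e) lt_min => /andP[h1 /andP[h2 h3]].
  have [|Dt tz] := hd (turn j e s); first by rewrite h1 h2.
  have te : `|turn j e s - e| < 1 by rewrite -(normr_sgn j) gtr0_norm.
  have [fa ca] := end_cayley hend Dt te; split; [exact: Dt|exact: tz|exact: fa|rewrite ca].
  have -> : (turn j e s - e) / 2 = sgn j * atan (s ^+ n).
    by rewrite /turn addrC addKr -[_ *+ 2]mulr_natr mulrA mulfK.
  by rewrite tan_sgn_atan signed_iE rcM rcX mulrA.
have sI : 0 < s2 / 2 < s2 by apply/andP; split; lra.
have [D1 n1 _ c1] := T _ sI.
have [|_ [k wE]] := Aex n1 _ c1; first by rewrite gt_eqF// divr_gt0.
exists k, s2; split; [exact: s20|exact: s2s0|].
have key s : 0 < s < s2 -> mlift p (turn j e s) = A j k s.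
  apply: (@curve_uniq [set s | 0 < s < s2] (fun s => mlift p (turn j e s)) (A j k) (s2 / 2)).
  - exact: itvoo_interval.
  - move=> t tI; have [Dt _ ft ct] := T t tI; have [km reg _ _] := mliftP Dt.
    have tI0 : 0 < t < s0 by case/andP: tI => -> h; rewrite (lt_le_trans h s2s0).
    have [kA [LA _]] := germ_regular j k tI0.
    have [|_ _ _ fA cA] := hA j k (s := t); first by case/andP: tI0 => h ?; rewrite gtr0_norm.
    split; [|exact: kA|exact: reg|exact: LA|].
    + have kt : turn j e s @[s --> t] --> turn j e t.
        apply: cvgD; first exact: cvg_cst.
        apply: cvgM; first exact: cvg_cst.
        by apply: cvgMn; apply: continuous_cvg; [exact: continuous_atan|exact: exprn_continuous].
      exact: (cvg_comp _ _ kt km).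
    + have fz0 : f z != 0 by apply: level_set_neq0; apply: component_sub; case: Vz.
      exact: (cayley_inj fz0 ft fA (etrans ct (esym cA))).
  - exact: sI.
  - exact: wE.
by move=> s sI'; split; [have [] := T s sI'|exact: key].
Qed.

(** The two expressions of the Cayley transform give [tan ((t - e) / 2) = sgn j' * s ^+ n]. The sign
    determines [j'], and inverting [tan] determines [t]. *)
Lemma germ_time p j e t j' k s : end_at p j e z -> ldom p t -> `|t - e| < 1 ->
  0 < sgn j * (t - e) -> 0 < s < s0 -> mlift p t = A j' k s -> j' = j /\ t = turn j e s.
Proof.
move=> hend Dt te tj /andP[sp ss] mt; have [_ ca] := end_cayley hend Dt te.
have := hA j' k (s := s); rewrite gtr0_norm// => /(_ ss)[_ _ _ _ cA].
have tanE : tan ((t - e) / 2) = sgn j' * s ^+ n.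
  have := ca; rewrite mt cA signed_iE -mulrA -rcX -rcM => h.
  have := congr1 imC h; rewrite !imM /= !(mul0r, mulr0, mul1r, add0r) => h'.
  by rewrite h'.
have tE : t - e = sgn j' * (atan (s ^+ n) *+ 2).
  have : (t - e) / 2 = sgn j' * atan (s ^+ n).
    rewrite -(tanK (x := (t - e) / 2)); last first.
      rewrite in_itv /= -ltr_norml (@lt_trans _ _ (1 / 2))//.
        by move: te; rewrite !ltr_norml => /andP[h1 h2]; apply/andP; split; lra.
      by rewrite ltr_pM2r// (lt_le_trans _ (pi_ge2 R))// ltr1n.
    by rewrite tanE /sgn; case: (j'); rewrite ?mul1r// !mulN1r atanN.
  by move=> h; rewrite mulrnAr -h -mulr_natr divfK.
have a0 : 0 < atan (s ^+ n) *+ 2.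
  by rewrite pmulrn_lgt0// -(atan0 R) lt_atan// exprn_gt0.
have jj : j' = j.
  move: tj; rewrite tE /sgn; case: (j); case: (j') => //; rewrite ?mul1r ?mulN1r ?opprK => h;
  by exfalso; move: h a0; lra.
split; first exact: jj.
by rewrite /turn -jj -tE addrC subrK.
Qed.

Definition end_angle (a b : R) (j : bool) := if j then a else b.
Definition end_pt (vm vp : C R) (j : bool) := if j then vm else vp.

Lemma curve_end_at p a b vm vp j : curve_ends p a b vm vp ->
  end_at p j (end_angle a b j) (end_pt vm vp j).
Proof.
move=> [a0 b0 D _ hc] r rp; have [d d0 hd] := hc r rp.
exists (Num.min d (b - a)); first by rewrite lt_min d0 subr_gt0 (lt_trans a0 b0).
move=> t; rewrite lt_min /sgn; case: j => /=; rewrite ?mul1r ?mulN1r => /andP[h1 /andP[h2 h3]].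
  have tI : a < t < b by apply/andP; split; lra.
  split; first exact/D.
  by apply: (hd t).1; apply/andP; split; lra.
have tI : a < t < b by apply/andP; split; lra.
split; first exact/D.
by apply: (hd t).2; apply/andP; split; lra.
Qed.

(** An end at another vertex stays away from [z]; near an end at [z] the angle is within 1 of [e],
    as [germ_time] requires. *)
Lemma end_escape p e v j : end_at p j e v -> exists d m : R, [/\ 0 < d, 0 < m &
  forall t, 0 < sgn j * (t - e) < d -> ldom p t /\
    (m <= nm (mlift p t - z) \/ (v = z /\ `|t - e| < 1))].
Proof.
move=> hend; have [vz|vz] := eqVneq v z.
  have [d d0 hd] := hend 1 ltr01; exists (Num.min d 1), 1; split.
  - by rewrite lt_min d0 ltr01.
  - exact: ltr01.
  move=> t; rewrite lt_min => /andP[h1 /andP[h2 h3]].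
  have [|Dt _] := hd t; first by rewrite h1.
  split; first exact: Dt.
  by right; split; [exact: vz|rewrite -(normr_sgn j) gtr0_norm].
have m0 : 0 < nm (v - z) / 2 by rewrite divr_gt0// nm_gt0 subr_eq0.
have [d d0 hd] := hend _ m0; exists d, (nm (v - z) / 2); split; [exact: d0|exact: m0|].
move=> t /hd[Dt tv]; split; [exact: Dt|left].
by have := nm_triB v (mlift p t) z; rewrite [nm (v - mlift p t)]nmB; move: tv; lra.
Qed.

(** Along the arc the curve comes arbitrarily close to [z]. Its middle part is compact and regular,
    hence away from [z], and so are ends at other vertices; such a point is thus near an end at [z],
    which [germ_time] identifies. *)
Lemma germ_location p a b vm vp j k s : curve_ends p a b vm vp ->
  0 < s < s0 -> mcurve p (A j k s) -> end_pt vm vp j = z /\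
  forall d, 0 < d -> exists s', [/\ 0 < s' < d, s' < s0 &
    mlift p (turn j (end_angle a b j) s') = A j k s'].
Proof.
move=> hce hs Ms.
suff key d : 0 < d -> exists s', [/\ 0 < s' < d, s' < s0, end_pt vm vp j = z &
    mlift p (turn j (end_angle a b j) s') = A j k s'].
  split; first by have [? []] := key 1 ltr01.
  by move=> d /key[s' [h1 h2 _ h3]]; exists s'.
move=> dp; have [a0 b0 D [Vm Vp] _] := hce.
have [d1 [m1 [d10 m10 h1]]] := end_escape (curve_end_at true hce).
have [d2 [m2 [d20 m20 h2]]] := end_escape (curve_end_at false hce).
rewrite /= in h1 h2.
(* Thirds keep the two end zones disjoint, so the middle part [[a + q1, b - q2]] is a proper
   interval. *)
pose q1 := Num.min d1 (b - a) / 3; pose q2 := Num.min d2 (b - a) / 3.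
have ab : 0 < b - a by lra.
have mm1 : 0 < Num.min d1 (b - a) by rewrite lt_min d10.
have mm2 : 0 < Num.min d2 (b - a) by rewrite lt_min d20.
have [q10 q20] : 0 < q1 /\ 0 < q2 by rewrite /q1 /q2; split; lra.
have : q1 * 3 <= Num.min d1 (b - a) by rewrite /q1 divfK.
rewrite le_min => /andP[q1d q1b].
have : q2 * 3 <= Num.min d2 (b - a) by rewrite /q2 divfK.
rewrite le_min => /andP[q2d q2b].
clearbody q1 q2; clear mm1 mm2.
have q12 : a + q1 <= b - q2 by lra.
have [|m m0 hm] := @curve_dist_pos (mlift p) _ _ z q12.
  move=> t /andP[t1 t2]; have /mliftP[ct rt _ _] : ldom p t by apply/D; apply/andP; split; lra.
  by split; [exact: ct|exact: regular_neq_vertex Vz rt].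
(* Closer to [z] than the middle part and than any end that is not at [z]. *)
have M0 : 0 < Num.min m (Num.min m1 m2) by rewrite !lt_min m0 m10.
have [d' d'0 hd'] := germ_near j k M0.
pose s' := Num.min d d' / 2; have mm : 0 < Num.min d d' by rewrite lt_min dp.
have s'0 : 0 < s' by rewrite divr_gt0.
have : s' < Num.min d d' by rewrite /s'; lra.
rewrite lt_min => /andP[s'd s'd']; clearbody s'.
have [|s's0] := hd' s'; first by rewrite s'0.
rewrite !lt_min => /and3P[n1 n2 n3].
have s'I : 0 < s' < s0 by rewrite s'0.
have [t Dt mt] := germ_clopen (mcurve_clopen p) hs s'I Ms.
have [at_ tb] : a < t /\ t < b by move/D: (Dt) => /andP[].
exists s'; suff [e1 e2] : end_pt vm vp j = z /\ t = turn j (end_angle a b j) s'.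
  by split; [rewrite s'0|exact: s's0|exact: e1|rewrite -e2].
have [t1|t1] := ltP t (a + q1).
  have [|_ [h|[vz te]]] := h1 t; first by rewrite /sgn mul1r; apply/andP; split; lra.
    by move: n2; rewrite -mt ltNge h.
  have hend : end_at p true a z by rewrite -vz; exact: (curve_end_at true hce).
  have [|jt tE] := germ_time hend Dt te _ s'I mt; first by rewrite /sgn mul1r subr_gt0.
  by rewrite tE jt.
have [t2|t2] := ltP (b - q2) t.
  have [|_ [h|[vz te]]] := h2 t; first by rewrite /sgn mulN1r; apply/andP; split; lra.
    by move: n3; rewrite -mt ltNge h.
  have hend : end_at p false b z by rewrite -vz; exact: (curve_end_at false hce).
  have [|jt tE] := germ_time hend Dt te _ s'I mt; first by rewrite /sgn mulN1r; lra.
  by rewrite tE jt.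
by exfalso; move: n1; rewrite -mt ltNge hm// t1.
Qed.

(** Each of the two arcs is met at arbitrarily small parameters near the [j]-end, where by
    [end_germ] the curve follows a single arc. *)
Lemma germ_unique p a b vm vp j k k' s : curve_ends p a b vm vp -> 0 < s < s0 ->
  mcurve p (A j k s) -> mcurve p (A j k' s) -> k = k'.
Proof.
move=> hce hs Mk Mk'; have [vz hk] := germ_location hce hs Mk.
have [_ hk'] := germ_location hce hs Mk'.
have hend := curve_end_at j hce; rewrite vz in hend.
have [k1 [s1 [s10 s1s0 h1]]] := end_germ hend.
have eqk1 k2 : (forall d, 0 < d -> exists s', [/\ 0 < s' < d, s' < s0 &
    mlift p (turn j (end_angle a b j) s') = A j k2 s']) -> k2 = k1.
  move=> h; have [s' [s'I s's0 e2]] := h _ s10; have [_ e1] := h1 _ s'I.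
  case/andP: s'I => s'0 _; apply: (Ainj (s := s') (j := j)).
  - by rewrite gtr0_norm.
  - by rewrite gt_eqF.
  - by rewrite -e1 -e2.
by rewrite (eqk1 k hk) (eqk1 k' hk').
Qed.

(** The end points are recovered from the set [mcurve p], so the edge depends on the open curve and
    not on its base point. *)
Definition star_edge p := mcurve p `|` [set v | vertices f L v /\ adherent (mcurve p) v].

Lemma mcurve_not_vertex p v : vertices f L v -> ~ mcurve p v.
Proof.
by move=> Vv [t /mliftP[_ rt _ _] tv]; have := regular_neq_vertex Vv rt; rewrite tv eqxx.
Qed.

Lemma star_edgeE p a b vm vp : regular p -> curve_ends p a b vm vp ->
  star_edge p = mcurve p `|` [set vm; vp].
Proof.
move=> rp hce; have [_ _ _ [Vm Vp] _] := hce; have [am ap] := curve_ends_adherent hce.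
apply/seteqP; split=> v [Mv|]; try by left.
  move=> [Vv av]; have [Mv|h] := edge_adherent (curve_edge rp hce) (@subsetUl _ _ _) av.
    by left.
  by right.
by move=> [->|->]; right; split.
Qed.

Lemma mcurve_same p q : regular p -> mcurve p q -> mcurve q = mcurve p.
Proof.
move=> rp Mq; have rq : regular q by have [sub _ _] := mcurve_clopen p; exact: sub.
have h := mcurve_least (mcurve_clopen p) (mcurve_start rq) Mq.
apply/seteqP; split; first exact: h.
exact: mcurve_least (mcurve_clopen q) Mq (mcurve_start rq).
Qed.

Let half_in : 0 < s0 / 2 < s0.
Proof. by have h := s00; apply/andP; split; lra. Qed.

(* j = true: the edge leaving z along the k-th outgoing arc; j = false: the edge
   reaching z along the k-th incoming arc. *)
Definition germ_edge j k := star_edge (A j k (s0 / 2)).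

Lemma germ_base_regular j k : regular (A j k (s0 / 2)).
Proof. by have [] := germ_regular j k half_in. Qed.

Lemma germ_base_ends j k : exists a b vm vp, curve_ends (A j k (s0 / 2)) a b vm vp.
Proof.
have rp := germ_base_regular j k; apply: (curve_ends_exist rp Vz).
exact: germ_adherent (mcurve_clopen _) half_in (mcurve_start rp).
Qed.

Lemma germ_edge_mcurve j k j' k' : germ_edge j k = germ_edge j' k' ->
  mcurve (A j k (s0 / 2)) (A j' k' (s0 / 2)).
Proof.
move=> e; have rp := germ_base_regular j' k'.
have : germ_edge j k (A j' k' (s0 / 2)) by rewrite e; left; exact: mcurve_start.
by move=> [//|[Vv _]]; have := regular_neq_vertex Vv rp; rewrite eqxx.
Qed.

Lemma germ_edge_inj j : injective (germ_edge j).
Proof.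
move=> k k' e; have [a [b [vm [vp hce]]]] := germ_base_ends j k.
have rp := germ_base_regular j k.
exact: (germ_unique hce half_in (mcurve_start rp) (germ_edge_mcurve e)).
Qed.

(** The arc that [end_germ] finds near the end lies in the curve as far as its base point at
    [s0 / 2]. *)
Lemma end_germ_edge p a b vm vp j : regular p -> curve_ends p a b vm vp ->
  end_pt vm vp j = z -> exists k, star_edge p = germ_edge j k.
Proof.
move=> rp hce vz; have hend := curve_end_at j hce; rewrite vz in hend.
have [k [s1 [s10 s1s0 h1]]] := end_germ hend; exists k.
have hI : 0 < s1 / 2 < s1 by apply/andP; split; lra.
have [D1 e1] := h1 _ hI; have hI' : 0 < s1 / 2 < s0 by apply/andP; split; lra.
have M1 : mcurve p (A j k (s1 / 2)) by exists (turn j (end_angle a b j) (s1 / 2)).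
have M2 := germ_clopen (mcurve_clopen p) hI' half_in M1.
by rewrite /germ_edge /star_edge (mcurve_same rp M2).
Qed.

(** The sign [j] tells which end of the edge is at [z]; a loop has both there. *)
Lemma edge_germ w (e : set (C R)) : edge f L z w e ->
  exists j k, e = germ_edge j k /\ (w = z -> exists k', e = germ_edge (~~ j) k').
Proof.
move=> /edgeP[p [a [b [vm [vp [rp hce -> hz]]]]]].
rewrite -(star_edgeE rp hce).
case: hz => -[zE wE].
  have [k ek] := end_germ_edge (j := true) rp hce (esym zE); exists true, k; split; first exact: ek.
  move=> wz; apply: (end_germ_edge (j := false) rp hce); by rewrite /end_pt -wE.
have [k ek] := end_germ_edge (j := false) rp hce (esym zE); exists false, k; split; first exact: ek.
move=> wz; apply: (end_germ_edge (j := true) rp hce); by rewrite /end_pt -wE.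
Qed.

Lemma edge_end_pt vm vp (e : set (C R)) j : edge f L vm vp e ->
  edge f L (end_pt vm vp j) (end_pt vm vp (~~ j)) e.
Proof. by case: j => //; exact: edge_sym. Qed.

(** An arc of sign [j] puts the [j]-end of its edge at [z]; an arc of the opposite sign on the same
    edge puts the other end there too. *)
Lemma germ_edge_edge j k : exists w, edge f L z w (germ_edge j k) /\
  ((exists k', germ_edge j k = germ_edge (~~ j) k') -> w = z).
Proof.
have rp := germ_base_regular j k; have [a [b [vm [vp hce]]]] := germ_base_ends j k.
have [vz _] := germ_location hce half_in (mcurve_start rp).
have he := edge_end_pt j (curve_edge rp hce); rewrite -(star_edgeE rp hce) vz in he.
exists (end_pt vm vp (~~ j)); split; first exact: he.
by move=> [k' /germ_edge_mcurve Mk]; have [] := germ_location hce half_in Mk.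
Qed.

(** A loop at [z] contains no other vertex, so no edge is counted both as a loop and as a link. *)
Lemma loop_link w (e : set (C R)) : edge f L z z e -> edge f L z w e -> w = z.
Proof.
move=> /edge_curve[p [rp eE _ _]] [g [[cg _ eE'] [_ [_ vw] [_ g1] _]]].
have : e w by rewrite eE' -g1; exists 1 => //=; rewrite in_itv /= lexx ler01.
by rewrite eE => -[/(mcurve_not_vertex vw)|[]].
Qed.

Let X j := germ_edge j @` setT.

Lemma loop_edgesE : loop_edges f L z = X true `&` X false.
Proof.
apply/seteqP; split=> e.
  move=> /edge_germ[[] [k [-> /(_ erefl)[k' e']]]] /=.
    by split; [exists k|exists k'].
  by split; [exists k'|exists k].
move=> [[k _ <-] [k' _ e']]; have [w [he hw]] := germ_edge_edge true k.
by rewrite /loop_edges /= -{2}hw//; exists k'.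
Qed.

Lemma link_edgesE : link_edges f L z = (X true `|` X false) `\` (X true `&` X false).
Proof.
rewrite -loop_edgesE; apply/seteqP; split=> e.
  move=> [w wz he]; split.
    by have [[] [k [-> _]]] := edge_germ he; [left|right]; exists k.
  by move=> hl; move: wz; rewrite (loop_link hl he) eqxx.
move=> [XY nl]; have [w he] : exists w, edge f L z w e.
  by case: XY => -[k _ <-]; [have [w []] := germ_edge_edge true k|have [w []] := germ_edge_edge false k]; exists w.
exists w; last exact: he.
by apply/eqP => wz; apply: nl; rewrite /loop_edges /= -{2}wz.
Qed.

Lemma star_degree : has_degree f L z (2 * n).
Proof.
have cX j : (X j #= `I_n)%card by apply: card_image_ord; exact: germ_edge_inj.
have [a [b [ha hb nE]]] := card_symdiff (cX true) (cX false).
by exists a, b; rewrite link_edgesE loop_edgesE.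
Qed.

End Star.

Lemma vertex_degree z : vertices f L z -> has_degree f L z (2 * (mult f z + 1)).
Proof.
move=> Vz; have [Lz dz] := Vz; have [_ _ _ hf] := level_setP (component_sub Lz).
have [n [g [n0 hg gz h]]] := component_order Lz.
(* [f'] has order [n - 1] at [z], so [mult f z + 1] is the number [n] of arcs of each sign. *)
rewrite (mult_eq (order_derive n0 hf hg gz h)) addn1 prednK//.
have [s0 [r [A [s00 r0 [h1 h2 h3 h4 _]]]]] := level_arcs Lz n0 hg gz h.
exact: star_degree Vz n0 s00 r0 h1 h2 h3 h4.
Qed.

End LevelSets.

Theorem proposition2p6 (R : realType) (G G' : set (C R)) (f : C R -> C R)
    (eps : R) (L : set (C R)) (z : C R)
    (openG : open G) (openG' : open G') (clG : closure G `<=` G')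
    (merof : meromorphic_on G' f) (eps_gt0 : 0 < eps)
    (compL : exists2 x, level_set G' f eps x &
               L = connected_component (level_set G' f eps) x)
    (bndL : bounded_set L) (LG : L `<=` G)
    (vz : vertices f L z) :
  has_degree f L z (2 * (mult f z + 1))%N.
Proof.
have [x Ex LE] := compL.
have LsubE : L `<=` level_set G' f eps by rewrite LE; exact: connected_component_sub.
(* Limits of points of [L] lie in the closure of [G], hence in [G'], where the level set is
   relatively closed. *)
have clE : closure L `<=` level_set G' f eps.
  move=> w clw; apply: (level_set_closed merof).
    by apply: clG; apply: closureS clw; exact: LG.
  move=> r r0; have hr : nbhs w [set v | nm (v - w) < r] by apply/cnbhsP; exists r.
  have [v [Lv vr]] := clw _ hr.
  by exists v; [exact: LsubE|exact: vr].
(* The closure of [L] is connected and contained in the level set, hence in the component [L]. *)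
have clL : closed L.
  suff : closure L `<=` L by move=> h w /h.
  rewrite {2}LE; apply: connected_component_max.
  - by apply: subset_closure; rewrite LE; exact: connected_component_refl.
  - exact: clE.
  - by apply: connected_closure; rewrite LE; exact: component_connected.
exact: (vertex_degree openG' merof eps_gt0 compL (bounded_closed_compactC bndL clL) vz).
Qed.
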